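(* Let $d\ge 2$ be a fixed constant. There is an algorithm that, given a hypergraph $\mathcal{H}=(V,E)$ with $m$ hyperedges, each of cardinality at most $d$, computes in $O(m^2)$ time a set $E_p\subseteq E$ such that $(V,E\setminus E_p)$ is an interval hypergraph and $|E_p|\le (d+1)\cdot|E^*|$, where $E^*$ is a minimum-cardinality set of hyperedges whose removal from $\mathcal{H}$ yields an interval hypergraph.
   Context: A hypergraph $(V,E)$ is an interval hypergraph if there is a linear order (permutation) of $V$ such that every hyperedge $e\in E$ consists of consecutive vertices in this order. Interval Hypergraph Edge Deletion asks, for a given hypergraph $(V,E)$, for a smallest set $E_p\subseteq E$ such that $(V,E\setminus E_p)$ is an interval hypergraph. The rank of a hypergraph is the maximum cardinality of its hyperedges. *)

(* Defs.v *)
From mathcomp Require Import all_boot all_order.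
From mathcomp Require Import perm.
Set Implicit Arguments. Unset Strict Implicit. Unset Printing Implicit Defensive.

Definition consecutive_in n (p : {perm 'I_n}) (e : {set 'I_n}) : Prop :=
  forall x y z : 'I_n, x \in e -> y \in e ->
    p x <= p z -> p z <= p y -> z \in e.

Definition interval_hypergraph n (E : {set {set 'I_n}}) : Prop :=
  exists p : {perm 'I_n}, forall e, e \in E -> consecutive_in p e.

(* A unit-cost RAM (addition / truncated subtraction, indirect access). *)

Inductive instr : Type :=
  | IConst of nat & nat        (* M[i] := c              *)
  | IAdd of nat & nat & nat    (* M[i] := M[j] + M[k]    *)
  | ISub of nat & nat & nat    (* M[i] := M[j] - M[k]    *)
  | ILoad of nat & nat         (* M[i] := M[M[j]]        *)
  | IStore of nat & nat        (* M[M[i]] := M[j]        *)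
  | IJz of nat & nat           (* if M[i] = 0 goto l     *)
  | IJmp of nat
  | IHalt.

Definition program := seq instr.
Definition memory := nat -> nat.

Definition upd (M : memory) (a v : nat) : memory :=
  fun b => if b == a then v else M b.

(* [run P fuel pc M] executes P from program counter pc with memory M,
   each instruction (including the final IHalt) costing one step.
   Returns [Some M'] iff the machine halts within [fuel] steps. *)
Fixpoint run (P : program) (fuel pc : nat) (M : memory) : option memory :=
  match fuel with
  | 0 => None
  | f.+1 =>
    match nth IHalt P pc with
    | IHalt => Some M
    | IConst i c => run P f pc.+1 (upd M i c)
    | IAdd i j k => run P f pc.+1 (upd M i (M j + M k))
    | ISub i j k => run P f pc.+1 (upd M i (M j - M k))
    | ILoad i j => run P f pc.+1 (upd M i (M (M j)))
    | IStore i j => run P f pc.+1 (upd M (M i) (M j))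
    | IJz i l => run P f (if M i == 0 then l else pc.+1) M
    | IJmp l => run P f l M
    end
  end.

(* Input encoding of a hypergraph with vertex set 'I_n and hyperedge list
   es = [e_0; ...; e_{m-1}]:  n, m, then for each hyperedge its cardinality
   followed by its vertices (in increasing order).  All other cells are 0. *)
Definition encode_edge n (e : {set 'I_n}) : seq nat :=
  #|e| :: [seq val x | x <- enum e].

Definition encode n (es : seq {set 'I_n}) : seq nat :=
  n :: size es :: flatten [seq encode_edge e | e <- es].

Definition init_mem (s : seq nat) : memory := fun a => nth 0 s a.

(* Output convention: after halting, cell i (i < m) is nonzero iff the
   hyperedge e_i is put into the deleted set E_p. *)
Definition output_set n (es : seq {set 'I_n}) (M : memory) : {set {set 'I_n}} :=
  [set e | (e \in es) && (M (index e es) != 0)].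

(* Main.v *)
(** Call a family of edges locally interval if any [d + 1] of its edges form an
    interval hypergraph.  In a locally interval family of rank [d] every vertex has
    bounded degree, and by an analysis of asteroidal triples in the spirit of Tucker
    a subfamily that is not interval contains a chordless cycle of at least [d + 2]
    edges.
    Such a cycle meets every vertex of its component in one of its edges, so the
    edges of a component that avoid a given vertex form an interval hypergraph.

    The algorithm first inserts the edges one by one.  A new obstruction with at most
    [d + 1] edges may be taken connected, so it lies in the ball of radius [d] around
    the inserted edge, which has bounded size; all its edges are deleted, whereas a
    solution must delete at least one of them.  The remaining family is locally
    interval.  In each of its components that is not interval, all edges at a vertex
    [u] of minimum degree are deleted.  This is good enough: after removing a solution,
    the remaining edges at the leftmost vertex of an interval order of the component
    are initial segments of distinct sizes, so there are at most [d] of them, and the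
    degree of [u] is at most [d] plus the number of edges that the solution deletes in
    the component.  A component that is not interval is recognised near any of its
    vertices [v] by an edge at [v] two of whose vertices start an asteroidal
    configuration, which takes boundedly many searches of the component; a search
    costs [O(m)] per edge of the component, and all of them together [O(m ^ 2)]. *)

Require Import Defs.
From mathcomp Require Import all_boot all_order.
From mathcomp Require Import perm zify.
From Stdlib Require Import ClassicalEpsilon.
Set Implicit Arguments. Unset Strict Implicit. Unset Printing Implicit Defensive.

(** * Orders of set systems without asteroidal triples *)

(** The number d + 1 bounds Tucker's obstructions other than cycles. When an edge [f] with a vertex
    off a path meets an inner stretch of that path, the stretch and the extra vertex all lie in [f],
    so the stretch has at most d - 1 vertices, and [f] with the path edges around it is a family of
    at most d + 1 edges. Only chordless cycles can be longer, and an edge of size d cannot cover the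
    vertices of a cycle of d + 2 edges. Interval orders are built by induction on vertex sets
    without asteroidal triples. Two features of the machine shape the rest. The number of vertices
    is not bounded in terms of m, so no table indexed by vertices may be cleared or scanned;
    vertices are marked by time stamps that grow, and untouched memory is known to be 0. And
    constants depending on d are free, so a search in a ball of bounded size needs no search code: a
    fixed decision tree of equality tests between its cells identifies the ball up to renaming of
    vertices, and the answer is stored in the leaf. *)

Ltac arith_only := repeat match goal with H : ?P |- _ =>
  lazymatch P with
  | nat => fail
  | is_true (leq _ _) => fail
  | is_true (leq _ _ && leq _ _) => fail
  | @eq nat _ _ => fail
  | is_true (@eq_op _ _ _) => fail
  | or (is_true (leq _ _)) _ => fail
  | or (@eq nat _ _) _ => fail
  | _ => clear H
  end end.
Ltac ar := arith_only; lia.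

Section AT.
Variables (T : finType) (F : {set {set T}}).
Implicit Types (X B C e : {set T}) (a b c x y z u v : T).

Definition link X z : rel T := fun u v =>
  [&& u \in X, v \in X & [exists e in F, [&& u \in e, v \in e & z \notin e]]].

(** Relative to [X]: the paths run inside [X], but the edges are not cut down to it, so an edge
    still avoids or hits the third vertex as in [F]. *)
Definition AT_free X := forall x y z, x \in X -> y \in X -> z \in X ->
  x != y -> y != z -> x != z ->
  connect (link X z) x y -> connect (link X x) y z -> connect (link X y) x z -> False.

(** Ranks in [nat] replace permutations because ranks of several sets combine arithmetically;
    injectivity makes strict inequalities sufficient. *)
Definition order_on X (r : T -> nat) := {in X &, injective r} /\
  forall e x y z, e \in F -> x \in X -> y \in X -> z \in X ->
    x \in e -> y \in e -> r x < r z -> r z < r y -> z \in e.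

Lemma linkP X z u v : reflect (exists e, [/\ e \in F, u \in e, v \in e & z \notin e] /\ u \in X /\ v \in X)
   (link X z u v).
Proof.
apply: (iffP and3P).
  move=> [uX vX /exists_inP[e eF /and3P[ue ve ze]]]; by exists e.
move=> [e [[eF ue ve ze] [uX vX]]]; split=> //; apply/exists_inP; exists e => //; exact/and3P.
Qed.

Lemma link_sym X z : symmetric (link X z).
Proof.
by move=> u v; apply/linkP/linkP => -[e [[eF ue ve ze] [uX vX]]]; exists e.
Qed.

Lemma conn_sym X z u v : connect (link X z) u v = connect (link X z) v u.
Proof. apply: sym_connect_sym; exact: link_sym. Qed.

Lemma conn_mono X X' z u v : X \subset X' -> connect (link X z) u v -> connect (link X' z) u v.
Proof.
move=> sX; apply: connect_sub => p q /linkP[e [[eF pe qe ze] [pX qX]]].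
apply: connect1; apply/linkP; exists e; split=> //; split; exact: (subsetP sX).
Qed.

Lemma AT_free_sub X X' : X \subset X' -> AT_free X' -> AT_free X.
Proof.
move=> sX h x y z xX yX zX xy yz xz c1 c2 c3.
apply: (h x y z) => //; try exact: (subsetP sX); exact: (conn_mono sX).
Qed.

Lemma conn_ind X z a y (P : T -> Prop) : connect (link X z) a y -> P a ->
  (forall u v, connect (link X z) a u -> P u -> link X z u v -> P v) -> P y.
Proof.
move=> /connectP[p pp ->] Pa step; move: pp Pa.
suff H : forall q b, connect (link X z) a b -> path (link X z) b q -> P b -> P (last b q).
  by move=> pp Pa; apply: H.
elim=> [//|w q IH] b cb /= /andP[bw pq] Pb; apply: IH => //.
  by apply: connect_trans cb _; apply: connect1.
exact: step bw.
Qed.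

Lemma bound_ex (r : T -> nat) : exists N, forall x, r x < N.
Proof. by exists (\max_x r x).+1 => x; rewrite ltnS leq_bigmax. Qed.

Lemma lexi_leq N p q p' q' : q' < N -> p * N + q <= p' * N + q' -> p <= p'.
Proof. by move=> h1 h2; rewrite leqNgt; apply/negP => h3; nia. Qed.

(** Substitution: the condition on edges makes [B] a module, so it can be contracted to [b], the
    quotient and [B] ordered separately, and the order of [B] inserted at the place of [b]. *)
Lemma module_order X B b r' rB : b \in B -> B \subset X ->
  (forall e, e \in F -> [\/ B \subset e, [disjoint e & B] | e :&: X \subset B]) ->
  order_on (b |: (X :\: B)) r' -> order_on B rB ->
  exists r, order_on X r.
Proof.
move=> bB sB mB [ir' cr'] [irB crB].
have [N hN] := bound_ex rB.
pose phi x := if x \in B then b else x.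
(* Lexicographic: first the place in the quotient, then the place in [B]; [N] exceeds every rank in
   [rB]. *)
pose r x := r' (phi x) * N + (if x \in B then rB x else 0).
have phiX x : x \in X -> phi x \in b |: (X :\: B).
  by move=> xX; rewrite /phi !inE; case: ifP => xB; rewrite ?eqxx ?xB ?xX ?orbT.
have N0 : 0 < N by apply: leq_ltn_trans (hN b).
have lexi x y : r x <= r y -> r' (phi x) <= r' (phi y).
  by apply: lexi_leq; case: ifP => _.
have rB_of x y : x \in B -> y \in B -> (r x < r y) = (rB x < rB y).
  by move=> xB yB; rewrite /r /phi xB yB ltn_add2l.
have ltphi x z : x \in X -> z \in X -> r x < r z -> ~~ ((x \in B) && (z \in B)) -> r' (phi x) < r' (phi z).
  move=> xX zX lt nB; rewrite ltn_neqAle lexi ?(ltnW lt) // andbT; apply/eqP => E.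
  have {}E := ir' _ _ (phiX _ xX) (phiX _ zX) E; move: E nB lt; rewrite /phi; case: ifP; case: ifP => // zB xB E.
  - by move: zB; rewrite -E bB.
  - by move: xB; rewrite E bB.
  - by rewrite E ltnn.
exists r; split.
  move=> x y xX yX E.
  have [/andP[xB yB]|nB] := boolP ((x \in B) && (y \in B)).
    apply: irB => //; move: E; rewrite /r /phi xB yB; exact: addnI.
  have E' : r' (phi x) = r' (phi y) by apply/eqP; rewrite eqn_leq !lexi ?E.
  have := ir' _ _ (phiX _ xX) (phiX _ yX) E'; move: nB; rewrite /phi; case: ifP; case: ifP => // yB xB _ E2.
  - by move: yB; rewrite -E2 bB.
  - by move: xB; rewrite E2 bB.
move=> e x y z eF xX yX zX xe ye xz zy.
have [Be|eB|eXB] := mB e eF.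
- have [zB|zB] := boolP (z \in B); first exact: (subsetP Be).
  have phie w : w \in e -> phi w \in e by rewrite /phi; case: ifP => // _ _; apply: (subsetP Be).
  have := cr' e (phi x) (phi y) z eF (phiX _ xX) (phiX _ yX); have := phiX z zX.
  have -> : phi z = z by rewrite /phi (negbTE zB).
  move=> zX'; apply=> //; try exact: phie.
    by have := ltphi x z xX zX xz; rewrite (negbTE zB) andbF /= => /(_ isT); rewrite {2}/phi (negbTE zB).
  by have := ltphi z y zX yX zy; rewrite (negbTE zB) /= => /(_ isT); rewrite {1}/phi (negbTE zB).
- have nB w : w \in e -> w \notin B by move=> we; rewrite (disjointFr eB).
  have pe w : w \in e -> phi w = w by move=> /nB /negbTE h; rewrite /phi h.
  have h := cr' e x y (phi z) eF.
  have hz : phi z \in e.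
    apply: h => //; try exact: phiX.
    + by rewrite -(pe x) // phiX.
    + by rewrite -(pe y) // phiX.
    + by have := ltphi x z xX zX xz; rewrite (negbTE (nB x xe)) (pe x) // => ->.
    + by have := ltphi z y zX yX zy; rewrite (negbTE (nB y ye)) andbF (pe y) // => ->.
  by move: hz; rewrite /phi; case: ifP => // zB be; have := nB _ be; rewrite bB.
- have inB w : w \in e -> w \in X -> w \in B by move=> we wX; apply: (subsetP eXB); rewrite inE we.
  have xB := inB x xe xX; have yB := inB y ye yX.
  have zB : z \in B.
    apply: contraT => zB.
    have := ltphi x z xX zX xz; rewrite (negbTE zB) andbF => /(_ isT) h1.
    have := ltphi z y zX yX zy; rewrite (negbTE zB) => /(_ isT) h2.
    by have := ltn_trans h1 h2; rewrite /phi xB yB ltnn.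
  by apply: (crB e x y z) => //; rewrite -rB_of.
Qed.

Lemma conn_avoid X z u v : connect (link X z) u v -> u != z -> v != z.
Proof.
move=> c uX; apply: (conn_ind (P := fun v => v != z) c) => // p q _ _ /linkP[e [[_ _ qe ze]]] _.
by apply: contraNneq ze => <-.
Qed.

(* The vertices of [X] are ranked by how many of them separate them from [a]. *)
Lemma end_order X a :
  (forall X', #|X'| < #|X| -> AT_free X' -> exists r, order_on X' r) ->
  (forall X' b, #|X'| < #|X| -> AT_free X' -> b \in X' ->
     (forall x y, x \in X' -> y \in X' -> x != b -> y != b -> connect (link X' b) x y) ->
     exists2 r, order_on X' r & forall x, x \in X' -> r b <= r x) ->
  AT_free X -> a \in X ->
  (forall x y, x \in X -> y \in X -> x != a -> y != a -> connect (link X a) x y) ->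
  exists2 r, order_on X r & forall x, x \in X -> r a <= r x.
Proof.
move=> IHg IHc atf aX ca.
pose sep y := [set x in X | ~~ connect (link X x) a y].
pose r1 y := #|sep y|.
have sep_refl x : x \in X -> x != a -> x \in sep x.
  move=> xX xa; rewrite inE xX /=; apply/negP => c.
  by have := conn_avoid c; rewrite eq_sym xa eqxx => /(_ isT).
(* A path from [a] to [y] that avoids [z] must use an edge containing [x], and up to that edge it
   connects [a] with [x] while avoiding [z]. *)
have sep_trans z x y : z \in sep x -> x \in sep y -> z \in sep y.
  rewrite !inE => /andP[zX zx] /andP[xX xy]; rewrite zX /=.
  apply: contra zx => c.
  have : connect (link X x) a y \/ connect (link X z) a x.
    apply: (conn_ind (P := fun v => connect (link X x) a v \/ connect (link X z) a x) c).
      by left.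
    move=> u v cu [cu'|]; last by right.
    move=> /linkP[e [[eF ue ve ze] [uX vX]]].
    have [xe|xe] := boolP (x \in e).
      by right; apply: connect_trans cu _; apply: connect1; apply/linkP; exists e.
    by left; apply: connect_trans cu' _; apply: connect1; apply/linkP; exists e.
  by case=> // c'; rewrite c' in xy.
(* If neither separates the other from [a], then [x], [y], [a] are an asteroidal triple; [ca]
   supplies the connection that avoids [a]. *)
have sep_tot x y : x \in X -> y \in X -> x != y -> x != a -> y != a -> x \in sep y \/ y \in sep x.
  move=> xX yX xy xa ya.
  have [|h] := boolP (x \in sep y); first by left.
  have [|h'] := boolP (y \in sep x); first by right.
  exfalso; move: h h'; rewrite !inE xX yX /= !negbK => c1 c2.
  apply: (atf x y a) => //; first exact: ca.
    by rewrite conn_sym.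
  by rewrite conn_sym.
have sep_r1 x y : x \in sep y -> r1 x <= r1 y.
  by move=> h; apply: subset_leq_card; apply/subsetP => z zx; apply: sep_trans h.
have r1a : r1 a = 0.
  by apply/eqP; rewrite cards_eq0 -subset0; apply/subsetP => x; rewrite !inE connect0 andbF.
have r1_gt0 y : y \in X -> y != a -> 0 < r1 y.
  move=> yX ya; apply/card_gt0P; exists y; exact: sep_refl.
have r1_sep x y : x \in X -> y \in X -> x != a -> r1 x <= r1 y -> x \in sep y.
  move=> xX yX xa le.
  have [ya|ya] := eqVneq y a.
    by have := r1_gt0 x xX xa; move: le; rewrite ya r1a; case: (r1 x).
  have [<-|xy] := eqVneq x y; first exact: sep_refl.
  apply: contraT => h; have [|yx] := sep_tot x y xX yX xy xa ya; first by rewrite (negbTE h).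
  have : r1 y < r1 x.
    apply: proper_card; apply/properP; split; last by exists x => //; exact: sep_refl.
    by apply/subsetP => z; move=> zy; apply: sep_trans yx.
  by rewrite ltnNge le.
(* As [x] does not separate [y] from [a], an edge through [y] and [y'] that misses [x] would connect
   [a] with [y'], although [x] separates them. *)
have edge e y y' x : e \in F -> y \in e -> y' \in e -> y \in X -> y' \in X -> x \in X ->
    r1 y < r1 x -> r1 x <= r1 y' -> x \in e.
  move=> eF ye y'e yX y'X xX lt le; apply: contraT => xe.
  have xa : x != a by apply: contraTneq lt => ->; rewrite r1a.
  have := r1_sep _ _ xX y'X xa le; rewrite inE xX /=.
  have : x \notin sep y by apply: contraL lt => /sep_r1; rewrite -leqNgt.
  rewrite inE xX /= negbK => c /negP[]; apply: connect_trans c _.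
  by apply: connect1; apply/linkP; exists e.
pose cls al := [set x in X | r1 x == al].
have clsP al x : (x \in cls al) = (x \in X) && (r1 x == al) by rewrite inE.
have a_ncls al : 0 < al -> a \notin cls al by move=> h; rewrite clsP r1a eq_sym (gtn_eqF h) andbF.
(* each class gets an order in which every edge leaving it upwards is a final segment *)
have cls_ord al : exists r, order_on (cls al) r /\
   forall e x y y', e \in F -> x \in cls al -> y \in cls al -> y' \in X -> al < r1 y' ->
     y \in e -> y' \in e -> r y < r x -> x \in e.
  case: (posnP al) => [->|al0].
    have c0 : forall x, x \in cls 0 -> x = a.
      move=> x; rewrite clsP => /andP[xX /eqP r0]; apply/eqP; apply: contraT => xa.
      by have := r1_gt0 x xX xa; rewrite r0.
    exists (fun=> 0); split; last by move=> e x y y' _ xc yc _ _ _ _; rewrite ltnn.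
    by split=> [x y /c0-> /c0->|].
  have sub : cls al \subset X by apply/subsetP => x; rewrite clsP => /andP[].
  have [/exists_inP[b0 b0X hb0]|none] := boolP [exists b in X, al < r1 b]; last first.
    have [|r ordr] := IHg (cls al) _ (AT_free_sub sub atf).
      apply: proper_card; apply/properP; split=> //; exists a => //; exact: a_ncls.
    exists r; split=> // e x y y' _ _ _ y'X lt; case/negP: none; apply/exists_inP; by exists y'.
  (* One vertex [b] of the next higher class stands for everything above: an edge leaving the class
     upwards contains [b]. An order of the class with [b] at an end makes the trace of such an edge
     adjacent to that end; it is reversed below so that [b] comes last. *)
  pose b := [arg min_(b < b0 | (b \in X) && (al < r1 b)) r1 b].
  have [bX ltb minb] : [/\ b \in X, al < r1 b & forall c, c \in X -> al < r1 c -> r1 b <= r1 c].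
    rewrite /b; case: arg_minnP; first by rewrite b0X.
    move=> b' /andP[b'X lt] h; split=> // c cX hc; apply: h; by rewrite cX.
  pose X' := b |: cls al.
  have sX' : X' \subset X by rewrite subUset sub1set bX.
  have bc : b \notin cls al by rewrite clsP bX /= neq_ltn ltb orbT.
  have [||||r [ir cr] rmin] := IHc X' b.
  - apply: proper_card; apply/properP; split=> //; exists a => //.
    by rewrite !inE r1a aX /= (eq_sym 0) (gtn_eqF al0) orbF; apply: contraTneq ltb => <-; rewrite r1a.
  - exact: AT_free_sub sX' atf.
  - by rewrite !inE eqxx.
  - move=> x y xX' yX' xb yb.
    have xc : x \in cls al by move: xX'; rewrite in_setU1 (negbTE xb).
    have yc : y \in cls al by move: yX'; rewrite in_setU1 (negbTE yb).
    have := xc; rewrite clsP => /andP[xX /eqP rx].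
    have : b \notin sep x by apply: contraL ltb => /sep_r1; rewrite rx -leqNgt.
    rewrite inE bX /= negbK => cbx.
    (* A path from [a] that avoids [b] enters the class from below, and the entering edge contains
       the whole class. It joins any two vertices of the class, which is the connectivity that [IHc]
       asks for. *)
    have [e [eF ce be]] : exists e, [/\ e \in F, cls al \subset e & b \notin e].
      have : x \in cls al -> al <= r1 x -> exists e, [/\ e \in F, cls al \subset e & b \notin e].
        move=> _; apply: (conn_ind (P := fun v => al <= r1 v -> _) cbx).
          by rewrite r1a leqn0 => /eqP al1; rewrite al1 in al0.
        move=> u v cu IH /linkP[e [[eF ue ve be] [uX vX]]] lev.
        have [|ltu] := leqP al (r1 u); first exact: IH.
        exists e; split=> //; apply/subsetP => w; rewrite clsP => /andP[wX /eqP rw].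
        by apply: (edge e u v w) => //; rewrite rw.
      by apply=> //; rewrite rx.
    apply: connect1; apply/linkP; exists e; split; last by rewrite xX' yX'.
    by split=> //; apply: (subsetP ce).
  have [N hN] := bound_ex r.
  have sc x : x \in cls al -> x \in X' by move=> h; rewrite in_setU1 h orbT.
  exists (fun x => N - r x); split; first split.
  + move=> x y xc yc E; apply: ir; try exact: sc.
    by have := hN x; have := hN y; ar.
  + move=> e x y z eF xc yc zc xe ye lt1 lt2; apply: (cr e y x z) => //; try exact: sc.
      by have := hN x; have := hN y; have := hN z; ar.
    by have := hN x; have := hN y; have := hN z; ar.
  move=> e x y y' eF xc yc y'X lty' ye y'e lt.
  have := yc; rewrite clsP => /andP[yX /eqP ry].
  have be : b \in e.
    by apply: (edge e y y' b) => //; [rewrite ry | exact: minb].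
  apply: (cr e b y x) => //; try exact: sc; try by rewrite !inE eqxx.
    rewrite ltn_neqAle rmin ?sc // andbT; apply: contraNneq bc => E.
    by rewrite (ir b x _ (sc _ xc) E) // !inE eqxx.
  by have := hN x; have := hN y; ar.
have [g hg] := @fin_all_exists 'I_(#|T|.+1) (fun=> T -> nat) (fun al r => order_on (cls al) r /\
   forall e x y y', e \in F -> x \in cls al -> y \in cls al -> y' \in X -> al < r1 y' ->
     y \in e -> y' \in e -> r y < r x -> x \in e) (fun al => cls_ord al).
have r1T x : r1 x < #|T|.+1 by rewrite ltnS max_card.
pose rc x := g (inord (r1 x)) x.
have [N hN] := bound_ex rc.
pose r x := r1 x * N + rc x.
have lexi x y : r x <= r y -> r1 x <= r1 y.
  exact: lexi_leq.
have inc x : x \in X -> x \in cls (r1 x) by rewrite clsP eqxx andbT.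
have hc x := hg (inord (r1 x)).
have vi x : nat_of_ord (inord (r1 x) : 'I_(#|T|.+1)) = r1 x by rewrite inordK.
exists r; last first.
  move=> x xX; have [->//|xa] := eqVneq x a.
  have := r1_gt0 x xX xa; rewrite /r r1a mul0n add0n => h.
  by rewrite -(prednK h) mulSn -addnA (leq_trans (ltnW (hN a))) // leq_addr.
split.
  move=> x y xX yX E.
  have E1 : r1 x = r1 y by apply/eqP; rewrite eqn_leq !lexi ?E.
  have [[ir _] _] := hc x; rewrite vi in ir; apply: ir; rewrite ?inc //.
    by rewrite E1 inc.
  by move: E; rewrite /r /rc E1 => /addnI.
move=> e x y z eF xX yX zX xe ye xz zy.
have l1 := lexi _ _ (ltnW xz); have l2 := lexi _ _ (ltnW zy).
move: l1; rewrite leq_eqVlt => /orP[/eqP E1|l1]; last exact: (edge e x y z).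
have xz' : rc x < rc z by move: xz; rewrite /r E1 ltn_add2l.
have [[ir cr] up] := hc x; rewrite vi in ir cr up.
move: l2; rewrite leq_eqVlt => /orP[/eqP E2|l2]; last first.
  apply: (up e z x y) => //; rewrite ?inc //; first by rewrite E1 inc.
    by rewrite E1.
  by move: xz'; rewrite /rc E1.
have zy' : rc z < rc y by move: zy; rewrite /r E2 ltn_add2l.
apply: (cr e x y z) => //; rewrite ?inc //.
- by rewrite E1 E2 inc.
- by rewrite E1 inc.
- by move: xz'; rewrite /rc E1.
by move: zy'; rewrite /rc E1 E2.
Qed.

(** Choose [a] and a component of the rest avoiding [a], as large as possible. Its complement is a
    module: an edge leaving the component contains [a], and if it missed another vertex [z] of the
    complement, then the component and [a] would lie in one larger component avoiding [z]. If the
    module is only [a], the rest is connected and the second statement applies; otherwise both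
    factors are smaller. *)
Lemma AT_free_order_strong k :
  (forall X, #|X| <= k -> AT_free X -> exists r, order_on X r) /\
  (forall X b, #|X| <= k -> AT_free X -> b \in X ->
     (forall x y, x \in X -> y \in X -> x != b -> y != b -> connect (link X b) x y) ->
     exists2 r, order_on X r & forall x, x \in X -> r b <= r x).
Proof.
elim: k => [|k [IHg IHc]].
  split=> X; rewrite leqn0 cards_eq0.
    by move=> /eqP-> _; exists (fun=> 0); split=> [x y|e x y z _]; rewrite in_set0.
  by move=> b /eqP-> _; rewrite inE.
have Hc X b : #|X| <= k.+1 -> AT_free X -> b \in X ->
     (forall x y, x \in X -> y \in X -> x != b -> y != b -> connect (link X b) x y) ->
     exists2 r, order_on X r & forall x, x \in X -> r b <= r x.
  move=> hX; apply: end_order.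
    by move=> X' h; apply: IHg; rewrite -ltnS (leq_trans h).
  by move=> X' b' h; apply: IHc; rewrite -ltnS (leq_trans h).
split=> // X hX atf.
pose cl (p : T * T) := [set y in X | (y != p.1) && connect (link X p.1) p.2 y].
pose good (p : T * T) := [&& p.1 \in X, p.2 \in X & p.2 != p.1].
have [/existsP[p0 hp0]|none] := boolP [exists p, good p]; last first.
  exists (fun=> 0); split=> [x y xX yX _|//].
  apply/eqP; apply: contraT => xy; case/negP: none; apply/existsP; exists (y, x).
  by rewrite /good /= xX yX.
pose p := [arg max_(p > p0 | good p) #|cl p|].
have [gp maxp] : good p /\ forall q, good q -> #|cl q| <= #|cl p|.
  by rewrite /p; case: arg_maxnP.
case: p gp maxp => a c; rewrite /good /= => /and3P[aX cX ca] maxp.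
pose C := cl (a, c); pose B := X :\: C.
have cC : c \in C by rewrite inE cX ca /= connect0.
have aC : a \notin C by rewrite inE /= eqxx /= andbF.
have aB : a \in B by rewrite inE aC.
have CX x : x \in C -> x \in X by rewrite inE => /and3P[].
have mB e : e \in F -> [\/ B \subset e, [disjoint e & B] | e :&: X \subset B].
  move=> eF.
  have [eXB|/subsetPn[c1]] := boolP (e :&: X \subset B); first exact: Or33.
  rewrite inE => /andP[c1e c1X]; rewrite inE c1X andbT negbK => c1C.
  have [|] := boolP [disjoint e & B]; first by move=> h; apply: Or32.
  rewrite -setI_eq0 => /set0Pn[b1]; rewrite inE => /andP[b1e]; rewrite inE => /andP[b1C b1X].
  apply: Or31.
  have ae : a \in e.
    apply: contraT => ae; case/negP: b1C; rewrite inE b1X /=.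
    rewrite (contraNneq _ ae) => [|<- //]; move: c1C; rewrite inE => /and3P[_ _ h].
    by apply: connect_trans h _; apply: connect1; apply/linkP; exists e.
  apply/subsetP => z; rewrite inE => /andP[zC zX].
  have [->//|za] := eqVneq z a.
  apply: contraT => ze.
  have c1z : c1 != z by apply: contraNneq zC => <-.
  suff : a |: C \subset cl (z, c1).
    move=> /subset_leq_card; rewrite cardsU1 aC add1n => h.
    have := leq_trans h (maxp (z, c1) _); rewrite ltnn => -> //.
    by rewrite /good /= zX c1X.
  apply/subsetP => y; rewrite in_setU1 => /orP[/eqP->|yC].
    rewrite inE aX /= eq_sym za /=; apply: connect1; apply/linkP; by exists e.
  rewrite inE CX //=; apply/andP; split; first by apply: contraNneq zC => <-.
  have cc : connect (link X a) c1 y.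
    move: c1C yC; rewrite !inE /= => /and3P[_ _ h1] /and3P[_ _ h2].
    by apply: connect_trans h2; rewrite conn_sym.
  apply: (conn_ind (P := fun v => connect (link X z) c1 v) cc) => // u v cu cu' /linkP[e' [[e'F ue ve ae'] [uX vX]]].
  apply: connect_trans cu' _; apply: connect1; apply/linkP; exists e'; do !split => //.
  apply: contra zC => ze'; rewrite inE zX za /=.
  have := c1C; rewrite inE /= => /and3P[_ _ h1]; apply: connect_trans h1 _; apply: connect_trans cu _.
  by apply: connect1; apply/linkP; exists e'.
have sBX : B \subset X by apply: subsetDl.
have BltX : #|B| < #|X|.
  apply: proper_card; apply/properP; split=> //; exists c => //; by rewrite inE cC.
have [B1|B2] := leqP #|B| 1.
  have BE : B = [set a].
    by apply/esym/eqP; rewrite eqEcard sub1set aB cards1.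
  have [x y xX yX xa ya|r or _] := Hc X a hX atf aX; last by exists r.
  have inC w : w \in X -> w != a -> w \in C.
    move=> wX wa; apply: contraT => wC; have : w \in B by rewrite inE wC.
    by rewrite BE inE (negbTE wa).
  move: (inC x xX xa) (inC y yX ya); rewrite !inE /= => /and3P[_ _ h1] /and3P[_ _ h2].
  by apply: connect_trans h2; rewrite conn_sym.
have [|rB oB] := IHg B _ (AT_free_sub sBX atf).
  by rewrite -ltnS (leq_trans BltX).
have s' : a |: (X :\: B) \subset X by rewrite subUset sub1set aX subsetDl.
have [|r' o'] := IHg (a |: (X :\: B)) _ (AT_free_sub s' atf).
  have h1 := cardsID B X; have h2 : X :&: B = B by apply/setIidPr.
  rewrite h2 in h1; rewrite cardsU1 in_setD aB /= add1n.
  by ar.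
exact: (module_order aB sBX mB o' oB).
Qed.

Lemma AT_free_order X : AT_free X -> exists r, order_on X r.
Proof. by have [h _] := AT_free_order_strong #|X|; apply: h. Qed.

End AT.

(** * Locally interval families without cycles *)

Lemma classical_min (P : nat -> Prop) : (exists n, P n) ->
  exists n, P n /\ forall k, k < n -> ~ P k.
Proof.
move=> [n]; elim/ltn_ind: n => n IH Pn.
have [[k [kn Pk]]|h] := classic (exists k, k < n /\ P k); first exact: (IH k).
by exists n; split=> // k kn Pk; apply: h; exists k.
Qed.

Lemma last_false (P : pred nat) j : ~~ P 0 -> P j ->
  exists a, [/\ a < j, ~~ P a & forall i, a < i -> i <= j -> P i].
Proof.
move=> P0; elim: j => [|j IH] Pj; first by rewrite Pj in P0.
have [/IH[a [aj Pa ha]]|nPj] := boolP (P j).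
  exists a; split=> // [|i ai]; first exact: ltnW.
  by rewrite leq_eqVlt => /orP[/eqP->//|]; exact: ha.
by exists j; split=> // i ji ij; have -> : i = j.+1 by apply/eqP; rewrite eqn_leq ij.
Qed.

Lemma first_false (P : pred nat) j s : P j -> ~~ P s -> j < s ->
  exists b, [/\ j < b, b <= s, ~~ P b & forall i, j <= i -> i < b -> P i].
Proof.
move=> Pj Ps js.
have [a [h1 h2 h3]] := @last_false (fun i => P (s - i)) (s - j)
   ltac:(by rewrite /= subn0) ltac:(by rewrite /= subKn // ltnW).
exists (s - a); split=> //; try ar.
move=> i ji ib; have := h3 (s - i) ltac:(ar) ltac:(ar); by rewrite subKn //; ar.
Qed.

Lemma uniq_leq_card (T : finType) (A : {set T}) (l : seq T) :
  uniq l -> {subset l <= A} -> size l <= #|A|.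
Proof. by move=> ul sl; rewrite cardE uniq_leq_size // => x /sl; rewrite mem_enum. Qed.

Section Intervals.
Variable (T : finType).
Implicit Types (F R S : {set {set T}}) (e f : {set T}) (p q u v w : T).

Definition convex (r : T -> nat) e := forall x y z,
  x \in e -> y \in e -> r x < r z -> r z < r y -> z \in e.

Definition interval F := exists r : T -> nat, injective r /\ forall e, e \in F -> convex r e.

Lemma interval_sub F F' : F \subset F' -> interval F' -> interval F.
Proof. by move=> /subsetP s [r [ir cr]]; exists r; split=> // e /s; apply: cr. Qed.

Fixpoint walk R k u v : Prop :=
  if k is k'.+1 then exists e w, [/\ e \in R, u \in e, w \in e & walk R k' w v] else u = v.

Definition joined R u v := exists k, walk R k u v.

Lemma walk_cat R k k' u v w : walk R k u v -> walk R k' v w -> walk R (k + k') u w.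
Proof.
elim: k u => [|k IH] u /=; first by move=> ->.
by move=> [e [p [eR ue pe wk]]] wk'; exists e, p; split=> //; apply: IH.
Qed.

Lemma walk1 R e u v : e \in R -> u \in e -> v \in e -> walk R 1 u v.
Proof. by move=> eR ue ve; exists e, v. Qed.

Lemma walk_rev R k u v : walk R k u v -> walk R k v u.
Proof.
elim: k u => [|k IH] u; first by move=> ->.
move=> [e [p [eR ue pe /IH wk]]]; rewrite -addn1; apply: walk_cat wk _; exact: walk1 eR _ _.
Qed.

Lemma joined_trans R u v w : joined R u v -> joined R v w -> joined R u w.
Proof. by move=> [k h] [k' h']; exists (k + k'); apply: walk_cat h h'. Qed.

Lemma joined_sym R u v : joined R u v -> joined R v u.
Proof. by move=> [k h]; exists k; apply: walk_rev. Qed.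

Lemma joined1 R e u v : e \in R -> u \in e -> v \in e -> joined R u v.
Proof. by move=> eR ue ve; exists 1; apply: walk1 eR ue ve. Qed.

Definition incident s (x : nat -> T) (g : nat -> {set T}) :=
  forall i, i < s -> x i \in g i /\ x i.+1 \in g i.

(** Paths as in Tucker's theorem: [g i] contains no path vertices besides its two ends, but the
    edges may share further vertices. *)
Definition tpath s (x : nat -> T) (g : nat -> {set T}) := incident s x g /\
  forall i j, i < s -> j <= s -> x j \in g i -> j = i \/ j = i.+1.

Lemma walk_incident R s x g a b : incident s x g -> a <= b -> b <= s ->
  (forall i, a <= i -> i < b -> g i \in R) -> walk R (b - a) (x a) (x b).
Proof.
move=> inc ab; rewrite -(subnKC ab); move: (b - a) => k {ab b} hs hR; rewrite addKn.
elim: k hs hR => [|k IH] hs hR; first by rewrite addn0.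
rewrite -[X in walk R X]addn1; apply: (walk_cat (v := x (a + k))).
  by apply: IH => [|i h1 h2]; [ar | apply: hR => //; ar].
have [h1 h2] := inc (a + k) ltac:(ar).
by apply: (walk1 (e := g (a + k))); rewrite ?addnS // hR //; ar.
Qed.

Lemma joined_incident R s x g a b : incident s x g -> a <= b -> b <= s ->
  (forall i, a <= i -> i < b -> g i \in R) -> joined R (x a) (x b).
Proof.
move=> h1 h2 h3 h4; exists (b - a); exact: walk_incident h1 h2 h3 h4.
Qed.

Lemma walk_seq R k u v : walk R k u v -> exists x g, [/\ x 0 = u, x k = v,
  incident k x g & forall i, i < k -> g i \in R].
Proof.
elim: k u => [|k IH] u; first by move=> ->; exists (fun=> v), (fun=> set0); split.
move=> [e [p [eR ue pe /IH[x [g [x0 xk inc gR]]]]]].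
exists (fun i => if i is j.+1 then x j else u), (fun i => if i is j.+1 then g j else e).
by split=> // [] [|i] //=; rewrite ?x0 // ltnS => h; [apply: inc | apply: gR].
Qed.

(** Minimality gives more than [tpath]: edges that are not consecutive are disjoint. *)
Definition shortest R s u v x g := [/\ x 0 = u, x s = v, forall i, i < s -> g i \in R,
  tpath s x g & forall i j p, i.+1 < j -> j < s -> p \in g i -> p \in g j -> False].

(** A chord, or a vertex common to two edges that are not consecutive, would be a shortcut. *)
Lemma shortest_walk R k u v : walk R k u v -> (forall j, j < k -> ~ walk R j u v) ->
  exists x g, shortest R k u v x g.
Proof.
move=> /walk_seq[x [g [x0 xk inc gR]]] hmin; exists x, g.
have jump a b p : a <= k -> b <= k -> a.+1 < b -> forall i, i < k ->
   x a \in g i -> x b \in g i -> False.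
  move=> ak bk ab i ik xa xb; apply: (hmin ((a - 0) + (1 + (k - b)))); first by ar.
  rewrite -x0 -[in X in walk _ _ _ X]xk; apply: (walk_cat (v := x a)).
    by apply: walk_incident (inc) _ _ _ => // j _ h; apply: gR; ar.
  apply: (walk_cat (v := x b)); first exact: (walk1 (gR _ ik)).
  by apply: walk_incident (inc) _ _ _ => // j _ h; apply: gR; ar.
split=> //; first split=> //.
  move=> i j ik jk xj; have [xi xi1] := inc i ik.
  case: (ltngtP j i) => [ji|ij|]; [ | | by left].
    by case: (jump j i.+1 u _ _ _ i); rewrite // ltnW.
  right; apply/eqP; rewrite eqn_leq ij andbT leqNgt; apply/negP => h.
  by case: (jump i j u _ _ _ i); rewrite // ltnW.
move=> i j p ij jk pi pj; have ik : i < k by ar.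
apply: (hmin ((i - 0) + (2 + (k - j.+1)))); first by ar.
have [xi _] := inc i ik; have [_ xj1] := inc j jk.
rewrite -x0 -[in X in walk _ _ _ X]xk; apply: (walk_cat (v := x i)).
  by apply: walk_incident (inc) _ _ _ => //; [ar | move=> l _ h; apply: gR; ar].
apply: (walk_cat (v := x j.+1)).
  apply: (walk_cat (k := 1) (v := p)); first exact: (walk1 (gR _ ik)).
  exact: (walk1 (gR _ jk)).
by apply: walk_incident (inc) _ _ _ => // l _ h; apply: gR; ar.
Qed.

Lemma tpath_shift s x g a s' : tpath s x g -> a + s' <= s ->
  tpath s' (fun i => x (a + i)) (fun i => g (a + i)).
Proof.
move=> [inc tr] h; split=> [i hi|i j hi hj xj].
  by have := inc (a + i) ltac:(ar); rewrite addnS.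
by have := tr (a + i) (a + j) ltac:(ar) ltac:(ar) xj; ar.
Qed.

Lemma tpath_rev s x g : tpath s x g ->
  tpath s (fun i => x (s - i)) (fun i => g (s - i.+1)).
Proof.
move=> [inc tr]; split=> [i hi|i j hi hj xj].
  have := inc (s - i.+1) ltac:(ar).
  by rewrite (_ : (s - i.+1).+1 = s - i); [case | ar].
by have := tr (s - i.+1) (s - j) ltac:(ar) ltac:(ar) xj; ar.
Qed.

Lemma shortest_rev R s u v x g : shortest R s u v x g ->
  shortest R s v u (fun i => x (s - i)) (fun i => g (s - i.+1)).
Proof.
move=> [x0 xs gR tp sp]; split.
- by rewrite subn0.
- by rewrite subnn.
- by move=> i hi; apply: gR; ar.
- exact: tpath_rev.
- by move=> i j p ij js pi pj; apply: (sp (s - j.+1) (s - i.+1) p) => //; ar.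
Qed.

Lemma tpath_neq s x g i j : tpath s x g -> 1 < s -> i < j -> j <= s -> x i != x j.
Proof.
move=> [inc tr] s1 ij js; apply/eqP => E.
have [xi xi1] := inc i ltac:(ar).
have [|ej] := tr i j ltac:(ar) js ltac:(by rewrite -E); first by ar.
subst j; have [i1|i1] := ltnP i.+1 s.
  have [h _] := inc i.+1 i1; by case: (tr i.+1 i i1 ltac:(ar) ltac:(by rewrite E)); ar.
case: i ij js E xi xi1 i1 => [|i] ij js E xi xi1 i1; first by ar.
have [_ h] := inc i ltac:(ar).
by case: (tr i i.+2 ltac:(ar) js ltac:(by rewrite -E)); ar.
Qed.

Lemma interval_rev F : interval F -> exists r r' : T -> nat, [/\ injective r, injective r',
  forall e, e \in F -> convex r e, forall e, e \in F -> convex r' e & forall u v, (r u < r v) = (r' v < r' u)].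
Proof.
move=> [r [ir cr]]; have [N hN] := bound_ex r.
have E u v : (r u < r v) = (N - r v < N - r u) by have := hN u; have := hN v; ar.
exists r, (fun u => N - r u); split=> //.
  by move=> u v h; apply: ir; have := hN u; have := hN v; ar.
by move=> e eF x y z xe ye h1 h2; apply: (cr e eF y x z) => //; rewrite E.
Qed.

Definition increasing (r : T -> nat) s (x : nat -> T) := forall i, i < s -> r (x i) < r (x i.+1).

Lemma increasing_lt r s x i j : increasing r s x -> i < j -> j <= s -> r (x i) < r (x j).
Proof.
move=> h ij; rewrite -(subnKC ij); move: (j - i.+1) => k; elim: k => [|k IH] hk.
  by rewrite addn0; apply: h; ar.
by rewrite addnS; apply: ltn_trans (IH ltac:(ar)) (h (i.+1 + k) ltac:(ar)).
Qed.

(** Reversing the order makes the first step go up. A later step down would push an end of one of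
    two consecutive edges into the other edge. *)
Lemma interval_tpath S s x g : interval S -> tpath s x g -> 1 < s ->
  (forall i, i < s -> g i \in S) ->
  exists r, [/\ injective r, forall e, e \in S -> convex r e & increasing r s x].
Proof.
move=> /interval_rev[r0 [r0' [ir0 ir0' cr0 cr0' E]]] tp s1 gS.
have [r [ir cr r01]] : exists r, [/\ injective r, forall e, e \in S -> convex r e & r (x 0) < r (x 1)].
  have : r0 (x 0) != r0 (x 1) by apply: contra (tpath_neq tp s1 (ltn0Sn 0) (ltnW s1)) => /eqP/ir0->.
  by rewrite neq_ltn => /orP[h|]; [exists r0|rewrite E => h; exists r0'].
exists r; split=> //; elim=> [//|i IH] hi.
have {}IH := IH (ltnW hi); case: (tp) => inc tr.
have [a1 a2] := inc i (ltnW hi); have [b1 b2] := inc _ hi.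
have n1 : x i.+2 \notin g i by apply/negP => /tr; ar.
have n2 : x i \notin g i.+1 by apply/negP => /tr; ar.
rewrite ltnNge leq_eqVlt; apply/negP => /orP[/eqP/ir h|h].
  by have := tpath_neq tp s1 (ltnSn i.+1) hi; rewrite h eqxx.
case: (ltngtP (r (x i)) (r (x i.+2))) => [h1|h1|/ir h1].
- by case/negP: n1; apply: (cr _ (gS _ (ltnW hi)) (x i) (x i.+1)).
- by case/negP: n2; apply: (cr _ (gS _ hi) (x i.+2) (x i.+1)).
- by case/negP: n1; rewrite -h1.
Qed.

(** The edges of an increasing path cover all ranks from [x 0] to [x s], so no vertex outside them
    fits in between. *)
Lemma increasing_outside r s x g u : injective r -> incident s x g -> increasing r s x ->
  (forall i, i < s -> convex r (g i)) -> (forall i, i < s -> u \notin g i) -> 0 < s ->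
  r u < r (x 0) \/ r (x s) < r u.
Proof.
move=> ir inc inr cr nu; case: s inc inr cr nu => // s inc inr cr nu _.
case: (ltngtP (r u) (r (x 0))) => [|h|/ir h]; first by left.
  right; elim: s inc inr cr nu => [|s IH] inc inr cr nu.
    have [a1 a2] := inc 0 isT.
    case: (ltngtP (r (x 1)) (r u)) => // [h2|/ir h2].
      by have := nu 0 isT; rewrite (cr 0 isT (x 0) (x 1)).
    by have := nu 0 isT; rewrite -h2 a2.
  have {}IH : r (x s.+1) < r u by apply: IH => i hi; [apply: inc | apply: inr | apply: cr | apply: nu]; ar.
  have [a1 a2] := inc s.+1 (ltnSn _).
  case: (ltngtP (r (x s.+2)) (r u)) => // [h2|/ir h2].
    by have := nu s.+1 (ltnSn _); rewrite (cr s.+1 (ltnSn _) (x s.+1) (x s.+2)).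
  by have := nu s.+1 (ltnSn _); rewrite -h2 a2.
by have [a1 _] := inc 0 isT; have := nu 0 isT; rewrite h a1.
Qed.

Lemma tpath_uniq s (x : nat -> T) g a k : tpath s x g -> 1 < s -> a + k <= s.+1 -> uniq (map x (iota a k)).
Proof.
move=> tp s1 hk; rewrite map_inj_in_uniq ?iota_uniq // => i j; rewrite !mem_iota => hi hj E.
case: (ltngtP i j) => // h.
  by have := tpath_neq tp s1 h ltac:(ar); rewrite E eqxx.
by have := tpath_neq tp s1 h ltac:(ar); rewrite E eqxx.
Qed.

Lemma tpath2 (x0 x1 x2 : T) (g0 g1 : {set T}) : x0 \in g0 -> x1 \in g0 -> x1 \in g1 -> x2 \in g1 ->
  x2 \notin g0 -> x0 \notin g1 ->
  tpath 2 (fun i => if i is i'.+1 then if i' is _.+1 then x2 else x1 else x0)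
     (fun i => if i is _.+1 then g1 else g0).
Proof.
move=> a b c e n1 n2; split; first by case=> [|[|]].
case=> [|[|//]]; case=> [|[|[|//]]] //= _ _ h; try ar.
  by rewrite h in n1.
by rewrite h in n2.
Qed.

End Intervals.

(** * Obstructions of bounded size and asteroidal triples *)

Section SmallObstructions.
Variables (T : finType) (F : {set {set T}}) (d : nat).
Implicit Types (R S : {set {set T}}) (e f : {set T}) (p q u v w : T).
Hypothesis d2 : 2 <= d.
Hypothesis rankF : forall e, e \in F -> #|e| <= d.

Definition locally_interval := forall S, S \subset F -> #|S| <= d.+1 -> interval S.

(** Absence of Tucker's obstruction M_I; a chordless cycle is given as a path with a closing edge
    [f]. *)
Definition no_cycle := forall s x g f, 1 < s -> tpath s x g -> (forall i, i < s -> g i \in F) ->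
  f \in F -> x 0 \in f -> x s \in f -> (forall j, 0 < j -> j < s -> x j \notin f) -> False.

Hypothesis locF : locally_interval.

Lemma small_interval (l : seq {set T}) : {subset l <= F} -> size l <= d.+1 -> interval [set e in l].
Proof.
move=> sl hl; apply: locF; first by apply/subsetP => e; rewrite inE; apply: sl.
by apply: leq_trans hl; rewrite cardsE; apply: card_size.
Qed.

Lemma sub_iota_map (g : nat -> {set T}) a k : (forall i, a <= i -> i < a + k -> g i \in F) ->
  {subset map g (iota a k) <= F}.
Proof. by move=> h e /mapP[i]; rewrite mem_iota => /andP[h1 h2] ->; apply: h. Qed.

(* Tucker's obstruction M_III *)
Lemma path_attach s x g f u j : tpath s x g -> (forall i, i < s -> g i \in F) -> f \in F ->
  u \in f -> (forall i, i < s -> u \notin g i) -> x 0 \notin f -> x s \notin f ->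
  j <= s -> x j \notin f.
Proof.
move=> tp gF fF uf ug x0 xs js; apply/negP => xj.
(* [a] and [b] will be the positions just before and just after the run of path vertices in [f]
   around [x j]. *)
have [a [aj na ha]] := @last_false (fun i => x i \in f) j x0 xj.
have {}js : j < s by rewrite ltn_neqAle js andbT; apply: contraNneq xs => <-.
have [b [jb bs nb hb]] := @first_false (fun i => x i \in f) j s xj xs js.
have s1 : 1 < s by ar.
have tp' := tpath_shift tp (a := a) (s' := b - a) ltac:(ar).
have [r [ir cr inr]] : exists r, [/\ injective r, forall e, e \in [set e in f :: map g (iota a (b - a))] -> convex r e
  & increasing r (b - a) (fun i => x (a + i))].
  apply: interval_tpath tp' _ _; last 2 first.
  - by ar.
  - by move=> i hi; rewrite !inE; apply/orP; right; apply: map_f; rewrite mem_iota; ar.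
  apply: small_interval.
    move=> e; rewrite inE => /orP[/eqP->//|]; apply: sub_iota_map => i h1 h2; apply: gF; ar.
  rewrite /= size_map size_iota.
  (* The [b - a - 1] vertices of the run and [u] lie in [f], so [b - a <= d], and [f] with the
     [b - a] path edges is small enough to be interval. *)
  have := rankF fF; have := @uniq_leq_card _ f (u :: map x (iota a.+1 (b - a.+1))).
  rewrite /= size_map size_iota (tpath_uniq tp) //; last by ar.
  rewrite andbT => h1 h2; suff : (b - a.+1).+1 <= #|f| by ar.
  apply: h1.
    apply/negP => /mapP[i]; rewrite mem_iota => hi E; case: (tp) => inc _.
    have := inc i.-1 ltac:(ar); rewrite (_ : i.-1.+1 = i) -?E; last by ar.
    by case=> _; apply/negP; apply: ug; ar.
  move=> w; rewrite inE => /orP[/eqP->//|/mapP[i]]; rewrite mem_iota => hi ->.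
  have [ij|ij] := leqP i j; first by apply: ha => //; ar.
  by apply: hb; ar.
have cf : convex r f by apply: cr; rewrite !inE eqxx.
have cg i : i < b - a -> convex r (g (a + i)).
  by move=> hi; apply: cr; rewrite !inE; apply/orP; right; apply: map_f; rewrite mem_iota; ar.
have xaj := increasing_lt inr (i := 0) (j := j - a) ltac:(ar) ltac:(ar).
have xjb := increasing_lt inr (i := j - a) (j := b - a) ltac:(ar) ltac:(ar).
rewrite /= addn0 !subnKC in xaj xjb; try ar.
(* [u] lies beyond one end of the stretch, which forces [x a] or [x b] into [f]. *)
have := increasing_outside (u := u) ir (proj1 tp') inr cg; rewrite /= addn0 subnKC; last by ar.
case=> [i hi||h|h].
- by apply: ug; ar.
- by ar.
- by case/negP: na; apply: (cf u (x j)).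
- by case/negP: nb; apply: (cf (x j) u).
Qed.

Section Attach.
Variables (s : nat) (x : nat -> T) (g : nat -> {set T}) (f : {set T}) (u : T).
Hypotheses (tp : tpath s x g) (gF : forall i, i < s -> g i \in F) (fF : f \in F)
  (uf : u \in f) (ug : forall i, i < s -> u \notin g i) (x0 : x 0 \notin f) (xs : x s \notin f).

(** Rerouting the path through [p] instead of [x i.+1] gives a path of two edges to which
    [path_attach] applies. *)
Lemma attach_meet i p : i.+1 < s -> p \in g i -> p \in g i.+1 -> p \in f -> False.
Proof.
move=> hi pi pi1 pf; case: (tp) => inc tr.
have [a1 a2] := inc i (ltnW hi); have [b1 b2] := inc _ hi.
have n1 : x i.+2 \notin g i by apply/negP => /tr; ar.
have n2 : x i \notin g i.+1 by apply/negP => /tr; ar.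
have := path_attach (j := 1) (tpath2 a1 pi pi1 b2 n1 n2) _ fF uf.
rewrite pf => /= h; suff : false by [].
apply: h => //.
- by case=> [|[|]] // _; apply: gF; ar.
- by case=> [|[|]] // _; apply: ug; ar.
- by apply: (path_attach tp gF fF uf ug x0 xs); ar.
- by apply: (path_attach tp gF fF uf ug x0 xs); ar.
Qed.

(* Tucker's obstruction M_IV *)
Lemma attach_middle i p : i.+2 < s -> p \in g i.+1 -> p \in f -> False.
Proof.
move=> hi pi pf; case: (tp) => inc tr.
have s1 : 1 < s by ar.
have A j : j <= s -> x j \notin f by move=> h; apply: path_attach tp gF fF uf ug x0 xs h.
have n1 : p \notin g i by apply/negP => h; apply: (attach_meet (i := i) (p := p)) => //; ar.
have n2 : p \notin g i.+2 by apply/negP => h; apply: (attach_meet (i := i.+1) (p := p)) => //; ar.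
have [a1 a2] := inc i ltac:(ar); have [b1 b2] := inc i.+1 ltac:(ar); have [c1 c2] := inc _ hi.
have tp' := tpath_shift tp (a := i) (s' := 3) ltac:(ar).
have [r [ir cr inr]] : exists r, [/\ injective r, forall e, e \in [set e in [:: f; g i; g i.+1; g i.+2]] -> convex r e
  & increasing r 3 (fun j => x (i + j))].
  apply: interval_tpath tp' _ _ => //; last first.
    by case=> [|[|[|//]]] _; rewrite !inE ?addn0 ?addn1 ?addn2 eqxx ?orbT.
  apply: small_interval.
    by move=> e; rewrite !inE => /or4P[] /eqP->; [exact: fF | apply: gF; ar | apply: gF; ar | apply: gF; ar].
  (* [p] differs from both ends of the middle edge, which therefore has three vertices; so [d >= 3]
     and four edges are still a small family. *)
  have := rankF (gF (i := i.+1) ltac:(ar)).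
  have := @uniq_leq_card _ (g i.+1) [:: p; x i.+1; x i.+2] => /= h h'; suff : 3 <= #|g i.+1| by ar.
  apply: h.
    rewrite !inE andbT (tpath_neq tp s1) //; last by ar.
    rewrite andbT negb_or; apply/andP; split.
      by apply: contraNneq n1 => ->.
    by apply: contraNneq n2 => ->.
  by move=> w; rewrite !inE => /or3P[] /eqP->.
have := inr 0 isT; have := inr 1 isT; have := inr 2 isT; rewrite /= addn0 addn1 addn2 addn3 => i3 i2 i1.
have cf : convex r f by apply: cr; rewrite !inE eqxx.
have cg j : j < 3 -> convex r (g (i + j)).
  by case: j => [|[|[|//]]] _; apply: cr; rewrite !inE ?addn0 ?addn1 ?addn2 eqxx ?orbT.
have cg0 := cg 0 isT; have cg1 := cg 1 isT; have cg2 := cg 2 isT; rewrite addn0 addn1 addn2 in cg0 cg1 cg2.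
have m1 : x i \notin g i.+1 by apply/negP => /tr; ar.
have m2 : x i.+3 \notin g i.+1 by apply/negP => /tr; ar.
have p1 : r (x i.+1) < r p.
  case: (ltngtP (r (x i.+1)) (r p)) => // [h|/ir h]; last by rewrite -h a2 in n1.
  case: (ltngtP (r (x i)) (r p)) => [h2|h2|/ir h2].
  - by case/negP: n1; apply: (cg0 (x i) (x i.+1)).
  - by case/negP: m1; apply: (cg1 p (x i.+1)).
  - by case/negP: m1; rewrite h2.
have p2 : r p < r (x i.+2).
  case: (ltngtP (r p) (r (x i.+2))) => // [h|/ir h]; last by rewrite h c1 in n2.
  case: (ltngtP (r (x i.+3)) (r p)) => [h2|h2|/ir h2].
  - by case/negP: m2; apply: (cg1 (x i.+2) p).
  - by case/negP: n2; apply: (cg2 (x i.+2) (x i.+3)).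
  - by case/negP: m2; rewrite h2.
have := increasing_outside (u := u) ir (proj1 tp') inr cg; rewrite /= addn0 addn3.
case=> // [j hj|h|h]; first by apply: ug; ar.
  by case/negP: (A i.+1 ltac:(ar)); apply: (cf u p) => //; ar.
by case/negP: (A i.+2 ltac:(ar)); apply: (cf p u) => //; ar.
Qed.

End Attach.

Hypothesis nocyc : no_cycle.

(** A gap in the trace of [f], taken between the nearest vertices of [f] on both sides, would be
    closed by [f] to a chordless cycle. *)
Lemma trace_convex s x g f a b j : tpath s x g -> (forall i, i < s -> g i \in F) -> f \in F ->
  x a \in f -> x b \in f -> a <= j -> j <= b -> b <= s -> x j \in f.
Proof.
move=> tp gF fF xa xb aj jb bs; apply: contraT => nj.
have aj' : a < j by rewrite ltn_neqAle aj andbT; apply: contraNneq nj => <-.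
have jb' : j < b by rewrite ltn_neqAle jb andbT; apply: contraNneq nj => ->.
have [a' [h1 h2 h3]] := @last_false (fun i => x (a + i) \notin f) (j - a)
   ltac:(by rewrite /= addn0 xa) ltac:(by rewrite /= subnKC).
have [b' [k1 k2 k3 k4]] := @first_false (fun i => x i \notin f) j b nj ltac:(by rewrite /= xb) jb'.
exfalso; apply: (nocyc (s := b' - (a + a')) _ (tpath_shift tp (a := a + a') _) _ fF); rewrite ?addn0.
- by ar.
- by ar.
- by move=> i hi; apply: gF; ar.
- by move: h2; rewrite negbK.
- by rewrite subnKC; [move: k3; rewrite negbK | ar].
- move=> i i0 hi; have [ij|ij] := leqP (a + a' + i) j.
    by have := h3 (a' + i); rewrite addnA; apply; ar.
  by apply: k4; ar.
Qed.

(** A shortest connection in [R] from [e] to [f] forms a chordless cycle with [w], unless its length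
    is 0, which means that [e] and [f] meet on an edge of [R]. *)
Lemma closing e f w R p q : e \in F -> f \in F -> w \in e -> w \in f -> R \subset F ->
  (forall e', e' \in R -> w \notin e') -> joined R p q -> p \in e -> q \in f ->
  (exists2 e', e' \in R & p \in e') -> (exists2 e', e' \in R & q \in e') ->
  exists e' v, [/\ v \in e, v \in f, e' \in R & v \in e'].
Proof.
move=> eF fF we wf RF wR [k0 hk0] pe qf pR qR.
pose P k := exists p q, [/\ walk R k p q, p \in e, q \in f, (exists2 e', e' \in R & p \in e')
   & (exists2 e', e' \in R & q \in e')].
have [k [[p' [q' [wk pe' qf' [ep epR pep] qR']]] hmin]] : exists k, P k /\ forall j, j < k -> ~ P j.
  by apply: classical_min; exists k0, p, q.
have [j hj|x [g [x0 xk gR tp sp]]] := shortest_walk wk.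
  by move=> wj; apply: (hmin j hj); exists p', q'; split=> //; exists ep.
have [k0'|kpos] := posnP k.
  by exists ep, p'; split=> //; rewrite -x0; move: xk; rewrite k0' => ->.
exfalso; case: (tp) => inc tr.
have inR j : j <= k -> exists2 e', e' \in R & x j \in e'.
  case: j => [|j] hj; first by exists (g 0); [apply: gR | case: (inc 0 kpos)].
  by exists (g j); [apply: gR | case: (inc j hj)].
have ne j : 0 < j -> j <= k -> x j \notin e.
  move=> j0 jk; apply/negP => h; apply: (hmin (k - j)); first by ar.
  exists (x j), q'; split=> //; last exact: inR.
  by rewrite -xk; apply: walk_incident inc _ _ _ => // i _; apply: gR.
have nf j : j < k -> x j \notin f.
  move=> jk; apply/negP => h; apply: (hmin (j - 0)); first by ar.
  exists p', (x j); split=> //; [|by exists ep|by apply: inR; exact: ltnW].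
  by rewrite -x0; apply: walk_incident inc _ _ _ => // [|i _ hi]; [exact: ltnW | apply: gR; ar].
apply: (nocyc (s := k.+1) (x := fun i => if i is j.+1 then x j else w) (g := fun i => if i is j.+1 then g j else e)
   _ _ _ fF) => //.
- split; first by case=> [|i] //= hi; [rewrite x0 | apply: inc].
  case=> [|i] [|j] //= hi hj h; try ar.
  + case: j hj h => [|j] hj h; first by right.
    by move: h; rewrite (negbTE (ne _ _ _)).
  + by move: h; rewrite (negbTE (wR _ (gR _ hi))).
  + by have [->|->] := tr i j hi hj h; [left | right].
- by case=> [|i] //= hi; apply: (subsetP RF); apply: gR.
- by rewrite /= xk.
- by case=> [|j] //= _ hj; apply: nf.
Qed.

Definition avoiding z := [set e in F | z \notin e].

Lemma avoidingF z e : e \in avoiding z -> e \in F.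
Proof. by rewrite inE => /andP[]. Qed.

Lemma avoiding_notin z e : e \in avoiding z -> z \notin e.
Proof. by rewrite inE => /andP[]. Qed.

Definition triple x y z s t r := [/\ x != y, y != z, x != z &
  [/\ walk (avoiding z) s x y, walk (avoiding y) t x z & walk (avoiding x) r y z]].

(** An asteroidal triple of least total length with shortest connections. The longest one, from [x]
    to [y], is the base; the two others are the sides. *)
Definition conf x y z s t r (xs : nat -> T) (g : nat -> {set T}) (w : nat -> T) (f : nat -> {set T}) (v : nat -> T) (h : nat -> {set T}) :=
  [/\ 1 < s, t <= s /\ r <= s,
    (forall x' y' z' s' t' r', triple x' y' z' s' t' r' -> s + t + r <= s' + t' + r'),
    x != y /\ y != z /\ x != z &
   [/\ shortest (avoiding z) s x y xs g, shortest (avoiding y) t x z w f & shortest (avoiding x) r y z v h]].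

Lemma conf_sym x y z s t r (xs : nat -> T) (g : nat -> {set T}) (w : nat -> T) (f : nat -> {set T}) (v : nat -> T) (h : nat -> {set T}) : conf x y z s t r xs g w f v h ->
  conf y x z s r t (fun i => xs (s - i)) (fun i => g (s - i.+1)) v h w f.
Proof.
move=> [s1 [ts rs] hmin [n1 [n2 n3]] [Sg Sf Sh]]; split=> //.
- by move=> x' y' z' s' t' r' /hmin; ar.
- by rewrite eq_sym.
- by split=> //; apply: shortest_rev.
Qed.

(** Here [f k] is the last edge of its side that meets the base. Its end [w k.+1] is off the base,
    so by the bounded obstructions [f k] can meet only the first or the last base edge. The last is
    excluded by a cycle through [x]; on the first, the common vertex [p0] could replace [x] in a
    smaller triple unless it lies on the side from [y] to [z]. *)
Lemma conf_detour x y z s t r (xs : nat -> T) (g : nat -> {set T}) (w : nat -> T) (f : nat -> {set T}) (v : nat -> T) (h : nat -> {set T}) k p0 i0 : conf x y z s t r xs g w f v h ->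
  0 < k -> k < t -> i0 < s -> p0 \in f k -> p0 \in g i0 ->
  (forall j p i, k < j -> j < t -> i < s -> p \in f j -> p \in g i -> False) -> False.
Proof.
move=> [s1 [ts rs] hmin [n1 [n2 n3]] [Sg Sf Sh]] k0 kt i0s pf pg hk.
case: (Sg) => xs0 xss gR tpg spg; case: (Sf) => w0 wt fR tpf spf; case: (Sh) => v0 vr hR tph sph.
have gF i : i < s -> g i \in F by move=> /gR/avoidingF.
have fF i : i < t -> f i \in F by move=> /fR/avoidingF.
have hF i : i < r -> h i \in F by move=> /hR/avoidingF.
case: (tpg) => incg trg; case: (tpf) => incf trf; case: (tph) => inch trh.
have t0 : 0 < t by ar.
have r0 : 0 < r by case: (posnP r) => // r0; move: vr; rewrite r0 v0 => h0; rewrite h0 eqxx in n2.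
have zg i : i < s -> z \notin g i by move=> /gR/avoiding_notin.
have yf i : i < t -> y \notin f i by move=> /fR/avoiding_notin.
have xh i : i < r -> x \notin h i by move=> /hR/avoiding_notin.
have xfk : xs 0 \notin f k by rewrite xs0 -w0; apply/negP => /trf; ar.
have yfk : xs s \notin f k by rewrite xss; apply: yf.
have [wk wk1] := incf k kt.
have ug i : i < s -> w k.+1 \notin g i.
  move=> hi; have [h1|h1] := ltnP k.+1 t.
    by apply/negP => h2; apply: (hk k.+1 (w k.+1) i) => //; case: (incf _ h1).
  rewrite (_ : k.+1 = t) ?wt; [exact: zg | ar].
have A1 j : j <= s -> xs j \notin f k by exact: path_attach tpg gF (fF _ kt) wk1 ug xfk yfk.
have A2 := attach_meet tpg gF (fF _ kt) wk1 ug xfk yfk.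
have A3 := attach_middle tpg gF (fF _ kt) wk1 ug xfk yfk.
have x_g i : i < s -> 0 < i -> x \notin g i by move=> hi i0'; rewrite -xs0; apply/negP => /trg; ar.
have y_g i : i < s -> i.+1 < s -> y \notin g i by move=> hi i0'; rewrite -xss; apply/negP => /trg; ar.
have y_h i : i < r -> 0 < i -> y \notin h i by move=> hi i0'; rewrite -v0; apply/negP => /trh; ar.
have z_h i : i.+1 < r -> z \notin h i by move=> hi; rewrite -vr; apply/negP => /trh; ar.
have [g00 g01] := incg 0 ltac:(ar).
(* an edge of the path to z touching the last base edge closes a cycle through x *)
have Bs p : p \in f k -> p \in g s.-1 -> False.
  move=> pfk pgs.
  have B2 : forall i q, i.+1 < t -> q \in f i -> q \in f i.+1 -> q \in g s.-1 -> False.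
    apply: (attach_meet tpf fF (gF s.-1 _) (u := y)); rewrite ?w0 ?wt //.
    - by ar.
    - by rewrite -xss; have := incg s.-1 ltac:(ar); rewrite prednK; [case | ar].
    - by apply: x_g; ar.
    - by apply: zg; ar.
  pose R := [set e in map g (iota 0 s.-1) ++ map f (iota 0 k)].
  have memR e : e \in R -> (exists2 i, i < s.-1 & e = g i) \/ (exists2 i, i < k & e = f i).
    rewrite inE mem_cat => /orP[] /mapP[i]; rewrite mem_iota add0n => hi ->; [left|right]; by exists i.
  have gRR i : i < s.-1 -> g i \in R by move=> hi; rewrite inE mem_cat map_f // mem_iota.
  have fRR i : i < k -> f i \in R by move=> hi; rewrite inE mem_cat [X in _ || X]map_f ?orbT // mem_iota.
  have notR q e : q \in g s.-1 -> q \in f k -> e \in R -> q \notin e.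
    move=> qg qf /memR[] [i hi ->]; apply/negP => qe.
      have [i1|i1] := ltnP i.+1 s.-1; first by apply: (spg i s.-1 q) => //; ar.
      have E : i.+1 = s.-1 by ar.
      by apply: (A2 i q) => //; rewrite ?E //; ar.
    have [i1|i1] := ltnP i.+1 k; first by apply: (spf i k q) => //; ar.
    have E : i.+1 = k by ar.
    by apply: (B2 i q) => //; rewrite ?E //; ar.
  have [|||||||e' [q [q1 q2 q3 q4]]] := @closing (g s.-1) (f k) p R (xs s.-1) (w k) (gF _ _) (fF _ kt) pgs pfk _ _ _ _ wk.
  - by ar.
  - by apply/subsetP => e /memR[] [i hi ->]; [apply: gF | apply: fF]; ar.
  - by move=> e' e'R; apply: notR.
  - apply: (joined_trans (v := x)).
      rewrite -xs0; apply: joined_sym; apply: joined_incident incg _ _ _ => [//||i _]; [by ar | exact: gRR].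
    by rewrite -w0; apply: joined_incident incf _ _ _ => [//||i _]; [ar | exact: fRR].
  - by case: (incg s.-1 ltac:(ar)).
  - exists (g s.-2); first by apply: gRR; ar.
    have [_] := incg s.-2 ltac:(ar); by rewrite (_ : s.-2.+1 = s.-1) //; ar.
  - exists (f k.-1); first by apply: fRR; ar.
    have [_] := incf k.-1 ltac:(ar); by rewrite prednK.
  - by have := notR q e' q1 q2 q3; rewrite q4.
have {}pg : p0 \in g 0.
  case: i0 i0s pg => [//|i] hi pg; exfalso; have [h1|h1] := ltnP i.+2 s; first exact: (A3 i p0).
  by apply: (Bs p0) => //; have -> : s.-1 = i.+1 by ar.
have pgn i : 0 < i -> i < s -> p0 \notin g i.
  case: i => // i _ hi; apply/negP => h1; case: i hi h1 => [|i] hi h1; first exact: (A2 0 p0).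
  by apply: (spg 0 i.+2 p0).
have px : p0 != x by apply: contraNneq xfk => E; rewrite xs0 -E.
have py : p0 != y by apply: contraNneq yfk => E; rewrite xss -E.
have pz : p0 != z by apply: contraNneq (zg 0 ltac:(ar)) => <-.
have wpy : walk (avoiding z) s p0 y.
  have -> : s = 1 + (s - 1) by ar.
  apply: (walk_cat (v := xs 1)); first by apply: (walk1 (gR 0 _)) => //; ar.
  by rewrite -xss; apply: walk_incident incg _ _ _; [ar | ar | move=> i _; apply: gR].
have wpz : walk (avoiding y) (t - k) p0 z.
  have -> : t - k = 1 + (t - k.+1) by ar.
  apply: (walk_cat (v := w k.+1)); first exact: (walk1 (fR k kt)).
  by rewrite -wt; apply: walk_incident incf _ _ _ => // i _; apply: fR.
(* Otherwise [p0], [y], [z] is an asteroidal triple with one side shorter by [k]. *)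
have [j [jr pj]] : exists j, j < r /\ p0 \in h j.
  have [//|no] := classic (exists j, j < r /\ p0 \in h j); exfalso.
  have := hmin p0 y z s (t - k) r; rewrite leqNgt => /(_ _)/negP; apply; last by ar.
  split=> //; split=> //; rewrite -v0 -vr -{1}(subn0 r); apply: walk_incident inch _ _ _ => // i _ hi.
  rewrite inE hF //=; apply/negP => h1; apply: no; by exists i.
have v0g : v 0 \notin g 0 by rewrite v0; apply: y_g; ar.
have vrg : v r \notin g 0 by rewrite vr; apply: zg; ar.
have xg0 : x \in g 0 by rewrite -xs0.
have C2 := attach_meet tph hF (gF 0 ltac:(ar)) xg0 xh v0g vrg.
have C3 := attach_middle tph hF (gF 0 ltac:(ar)) xg0 xh v0g vrg.
(* If the side from [y] to [z] is the single edge [h 0], then this edge contains [p0] and [y], hence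
   all base vertices but [x]; with [z] and [p0] this gives [s + 2 <= d]. *)
have [r1|r2] := leqP r 1.
  have {r1 r0} er : r = 1 by ar.
  have {jr} ej : j = 0 by ar.
  subst r j; have [h00 h01] := inch 0 isT; rewrite v0 in h00; rewrite vr in h01.
  pose xp i := if i is i'.+1 then xs i else p0.
  have tpp : tpath s xp g.
    split; first by case=> [|i] hi; [split | apply: incg].
    move=> i [|j] hi hj h1; last exact: trg.
    left; case: i hi h1 => [//|i] hi h1; by move: (pgn i.+1 isT hi); rewrite h1.
  have hx j : 0 < j -> j <= s -> xs j \in h 0.
    move=> j0 js; have -> : xs j = xp j by case: j j0 js.
    apply: (trace_convex (a := 0) (b := s) tpp gF) => //; first exact: hF.
    by case: (s) s1 xss => //= s' _ ->.
  have cardh : s.+2 <= d.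
    apply: leq_trans (rankF (hF 0 isT)).
    have := @uniq_leq_card _ (h 0) (z :: map xp (iota 0 s.+1)).
    rewrite /= size_map size_iota (tpath_uniq (x := xp) tpp (a := 1) (k := s) s1) //.
    move=> h1; apply: h1.
      rewrite andbT in_cons negb_or eq_sym pz /=; apply/andP; split; last first.
        apply/negP => /mapP[i]; rewrite mem_iota => hi E.
        have := tpath_neq tpp s1 (i := 0) (j := i) ltac:(ar) ltac:(ar); by rewrite /= E eqxx.
      apply/negP => /mapP[i]; rewrite mem_iota => hi E.
      have := incg i.-1 ltac:(ar); rewrite (_ : i.-1.+1 = i); last by ar.
      case=> _; have -> : xs i = z by rewrite E; case: i hi {E}.
      by apply/negP; apply: zg; ar.
    move=> q; rewrite !in_cons => /or3P[/eqP->//|/eqP->//|/mapP[i]]; rewrite mem_iota => hi ->.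
    by rewrite /xp; case: i hi => // i hi; apply: hx.
  (* If [f k] ends at [z], then the base, [h 0] and [f k] are [s + 2] edges, hence an interval
     family. Otherwise [closing] yields a vertex [q] such that [x], [y], [q] is a smaller triple,
     with sides of lengths 2 and 1. *)
  have [kt1|kt1] := leqP t k.+1.
    have ek : k.+1 = t by ar.
    have zf : z \in f k by rewrite -wt -ek.
    have [r [ir cr inr]] : exists r, [/\ injective r, forall e, e \in [set e in h 0 :: f k :: map g (iota 0 s)] -> convex r e
      & increasing r s xs].
      apply: interval_tpath tpg _ _ => //; last first.
        by move=> i hi; rewrite !inE; apply/orP; right; apply/orP; right; apply: map_f; rewrite mem_iota.
      apply: small_interval.
        move=> e; rewrite !inE => /or3P[/eqP->|/eqP->|]; [exact: hF | exact: fF |].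
        by apply: sub_iota_map => i _; apply: gF.
      by rewrite /= size_map size_iota; ar.
    have ch : convex r (h 0) by apply: cr; rewrite !inE eqxx.
    have cf : convex r (f k) by apply: cr; rewrite !inE eqxx orbT.
    have cg i : i < s -> convex r (g i).
      by move=> hi; apply: cr; rewrite !inE; apply/orP; right; apply/orP; right; apply: map_f; rewrite mem_iota.
    have i01 := inr 0 ltac:(ar).
    have i0s' := increasing_lt inr (i := 0) (j := s) ltac:(ar) (leqnn _).
    have zs : r (xs s) < r z.
      have [|hz|//] := increasing_outside (u := z) ir incg inr cg zg _; first by ar.
      case/negP: (xh 0 isT); rewrite -xs0; apply: (ch z (xs 1)) => //; apply: hx; ar.
    have ps : r p0 < r (xs s).
      case: (ltngtP (r p0) (r (xs s))) => // [hp|/ir hp]; last by rewrite hp xss eqxx in py.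
      have := y_g 0 ltac:(ar) s1; rewrite -xss (cg 0 _ (xs 0) p0) //; ar.
    by case/negP: yfk; apply: (cf p0 z).
  pose R := [set e in map f (iota k.+1 (t - k.+1))].
  have memR e : e \in R -> exists2 i, k < i < t & e = f i.
    rewrite inE => /mapP[i]; rewrite mem_iota => hi ->; exists i => //; ar.
  have fRR i : k < i -> i < t -> f i \in R.
    by move=> h1 h2; rewrite inE map_f // mem_iota; ar.
  have [|||||e' [q [q1 q2 /memR[i hi ->] q4]]] := @closing (f k) (h 0) p0 R (w k.+1) z (fF _ kt) (hF 0 isT) pf pj _ _ _ wk1 h01.
  - by apply/subsetP => e /memR[i hi ->]; apply: fF; ar.
  - move=> e' /memR[i hi ->]; apply/negP => h1; apply: (hk i p0 0) => //; ar.
  - rewrite -wt; apply: joined_incident incf _ _ _ => // i h1 h2; exact: fRR.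
  - by exists (f k.+1); [apply: fRR | case: (incf k.+1 ltac:(ar))].
  - exists (f t.-1); first by apply: fRR; ar.
    by rewrite -wt; case: (incf t.-1 ltac:(ar)) => _; rewrite prednK.
  have qg l : l < s -> q \notin g l by move=> hl; apply/negP => h1; apply: (hk i q l) => //; ar.
  have := hmin x y q s 2 1; rewrite leqNgt => /(_ _)/negP; apply; last by ar.
  split; first by [].
  - apply: contraTneq q4 => <-; apply: yf; ar.
  - apply: contraTneq q2 => <-; exact: xh.
  split.
  - rewrite -xs0 -xss -{1}(subn0 s); apply: walk_incident incg _ _ _ => // l _ hl.
    by rewrite inE gF // qg.
  - apply: (walk_cat (k := 1) (v := p0)).
      by apply: (walk1 (e := g 0)) => //; rewrite inE gF ?y_g //; ar.
    by apply: (walk1 (fR k kt)).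
  - apply: (walk1 (hR 0 isT)) => //.
(* If [p0] is on [h 0], the detour over [p0] shows [s = 2], and [f 1] hangs at the path [g 0],
   [h 0]. Otherwise [p0] can only be on the last edge [h r.-1], and going round through [y] closes a
   cycle. *)
case: j jr pj => [|j] jr pj.
  have [h00 h01] := inch 0 r0; rewrite v0 in h00.
  have es : s = 2.
    have := hmin x y z 2 t r; rewrite !leq_add2r => h1; suff : s <= 2 by ar.
    apply: h1; split=> //; split.
    - apply: (walk_cat (k := 1) (v := p0)); first by apply: (walk1 (gR 0 _)) => //; ar.
      by apply: (walk1 (e := h 0)) => //; rewrite inE hF //= z_h.
    - by rewrite -w0 -wt -{1}(subn0 t); apply: walk_incident incf _ _ _ => // i _; apply: fR.
    - by rewrite -v0 -vr -{1}(subn0 r); apply: walk_incident inch _ _ _ => // i _; apply: hR.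
  have [et ek] : t = 2 /\ k = 1 by ar.
  subst s t k.
  have tp2 := tpath2 xg0 pg pj h00 (y_g 0 isT isT) (xh 0 r0).
  have := path_attach (j := 1) tp2 _ (fF 1 isT) (u := z); rewrite /= pf => h1; suff : false by []; apply: h1 => //.
  - by case=> [|[|]] // _; [apply: gF | apply: hF].
  - by rewrite -wt.
  - by case=> [|[|]] // _; [apply: zg | apply: z_h].
  - by rewrite -xs0.
  - exact: yf.
have {}ej : j.+2 = r.
  have [h1|] := ltnP j.+2 r; last by ar.
  by case: (C3 j p0).
have zhr : z \in h r.-1 by rewrite -vr; have := inch r.-1 ltac:(ar); rewrite prednK; [case|ar].
have hrr : r.-1 < r by ar.
have x0hr : xs 0 \notin h r.-1 by rewrite xs0; apply: xh.
have yhr : xs s \notin h r.-1 by rewrite xss; apply: y_h; ar.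
have D2 := attach_meet tpg gF (hF _ hrr) zhr zg x0hr yhr.
pose R := [set e in map g (iota 1 s.-1) ++ map h (iota 0 r.-1)].
have memR e : e \in R -> (exists2 i, 0 < i < s & e = g i) \/ (exists2 i, i < r.-1 & e = h i).
  rewrite inE mem_cat => /orP[] /mapP[i]; rewrite mem_iota => hi ->; [left|right]; exists i => //; ar.
have gRR i : 0 < i -> i < s -> g i \in R by move=> h1 h2; rewrite inE mem_cat map_f // mem_iota; ar.
have hRR i : i < r.-1 -> h i \in R by move=> hi; rewrite inE mem_cat [X in _ || X]map_f ?orbT // mem_iota.
have notR q e : q \in g 0 -> q \in h r.-1 -> e \in R -> q \notin e.
  move=> qg qh /memR[] [i hi ->]; apply/negP => qe.
    case: i hi qe => [|[|i]] hi qe; [ar | by apply: (D2 0 q) | by apply: (spg 0 i.+2 q) => //; ar].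
  have [i1|i1] := ltnP i.+1 r.-1; first by apply: (sph i r.-1 q) => //; ar.
  have E : i.+1 = r.-1 by ar.
  by apply: (C2 i q); rewrite ?E //; ar.
have pj' : p0 \in h r.-1 by rewrite -ej.
have [|||||||e' [q [q1 q2 q3 q4]]] := @closing (g 0) (h r.-1) p0 R (xs 1) (v r.-1) (gF 0 _) (hF _ hrr) pg pj' _ _ _ g01.
- by ar.
- by apply/subsetP => e /memR[] [i hi ->]; [apply: gF | apply: hF]; ar.
- by move=> e' e'R; apply: notR.
- apply: (joined_trans (v := y)).
    rewrite -xss; apply: joined_incident incg _ _ _; [ar | ar | by move=> i h1 h2; apply: gRR].
  by rewrite -v0; apply: joined_incident inch _ _ _ => [//||i _]; [ar | exact: hRR].
- by case: (inch _ hrr).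
- by exists (g 1); [apply: gRR | case: (incg 1 s1)].
- exists (h r.-2); first by apply: hRR; ar.
  have [_] := inch r.-2 ltac:(ar); by rewrite (_ : r.-2.+1 = r.-1) //; ar.
by have := notR q e' q1 q2 q3; rewrite q4.
Qed.

(** Among the later side edges that meet the base, the one nearest to [z] satisfies the hypotheses
    of [conf_detour]. *)
Lemma conf_far x y z s t r (xs : nat -> T) (g : nat -> {set T}) (w : nat -> T) (f : nat -> {set T})
    (v : nat -> T) (h : nat -> {set T}) j p i : conf x y z s t r xs g w f v h ->
  0 < j -> j < t -> i < s -> p \in f j -> p \in g i -> False.
Proof.
move=> C j0 jt hi pf pg.
pose P n := exists j p i, [/\ t - j = n, 0 < j < t, i < s, p \in f j & p \in g i].
have [n [[j1 [p1 [i1 [<- h1 hi1 q1 q2]]]] hmin]] : exists n, P n /\ forall k, k < n -> ~ P k.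
  by apply: classical_min; exists (t - j), j, p, i; rewrite j0.
have [h2 h3] := andP h1.
apply: (conf_detour C h2 h3 hi1 q1 q2) => j' p' i' k1 k2 k3 q3 q4.
by apply: (hmin (t - j')); [ar | exists j', p', i'; split=> //; ar].
Qed.

(** Only the first edges [f 0] and [h 0] of the sides can meet the base. They share a vertex [o] off
    the base, and [f 0] contains an initial, [h 0] a final stretch of the base vertices. If the
    stretches are disjoint, [o] closes a chordless cycle; if they overlap, the edges around the
    overlap form a small family in which [o] has no place. *)
Lemma conf_false x y z s t r (xs : nat -> T) (g : nat -> {set T}) (w : nat -> T) (f : nat -> {set T})
    (v : nat -> T) (h : nat -> {set T}) : conf x y z s t r xs g w f v h -> False.
Proof.
move=> C; have farf j p i := @conf_far _ _ _ _ _ _ _ _ _ _ _ _ j p i C.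
have farh j p i : 0 < j -> j < r -> i < s -> p \in h j -> p \in g i -> False.
  move=> j0 jr hi ph pg; apply: (conf_far (j := j) (p := p) (i := s - i.+1) (conf_sym C)) => //; first by ar.
  by rewrite (_ : s - (s - i.+1).+1 = i) //; ar.
case: C => s1 [ts rs] hmin [n1 [n2 n3]] [Sg Sf Sh].
case: (Sg) => xs0 xss gR tpg spg; case: (Sf) => w0 wt fR tpf spf; case: (Sh) => v0 vr hR tph sph.
have gF i : i < s -> g i \in F by move=> /gR/avoidingF.
have fF i : i < t -> f i \in F by move=> /fR/avoidingF.
have hF i : i < r -> h i \in F by move=> /hR/avoidingF.
case: (tpg) => incg trg; case: (tpf) => incf trf; case: (tph) => inch trh.
have t0 : 0 < t by case: (posnP t) => // t0; move: wt; rewrite t0 w0 => h0; rewrite h0 eqxx in n3.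
have r0 : 0 < r by case: (posnP r) => // r0; move: vr; rewrite r0 v0 => h0; rewrite h0 eqxx in n2.
have zg i : i < s -> z \notin g i by move=> /gR/avoiding_notin.
have yf i : i < t -> y \notin f i by move=> /fR/avoiding_notin.
have xh i : i < r -> x \notin h i by move=> /hR/avoiding_notin.
have [f00 f01] := incf 0 t0; have [h00 h01] := inch 0 r0; rewrite v0 in h00; rewrite w0 in f00.
have [g00 g01] := incg 0 ltac:(ar); rewrite xs0 in g00.
have zf : z \in f t.-1 by rewrite -wt; case: (incf t.-1 ltac:(ar)) => _; rewrite prednK.
have zh : z \in h r.-1 by rewrite -vr; case: (inch r.-1 ltac:(ar)) => _; rewrite prednK.
have yg : y \in g s.-1 by rewrite -xss; case: (incg s.-1 ltac:(ar)) => _; rewrite prednK //; ar.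
(* If [f 0], [h 0] and a base edge have no common vertex, then going round from the last base edge
   that meets [f 0], through [y] and [z], closes a cycle. *)
have [[c [i [hi cf ch cg]]]|noc] := classic (exists c i, [/\ i < s, c \in f 0, c \in h 0 & c \in g i]); last first.
  pose P n := exists i p, [/\ s - i = n, i < s, p \in f 0 & p \in g i].
  have [n [[i [p [<- hi pf pg]]] imax]] : exists n, P n /\ forall k, k < n -> ~ P k.
    by apply: classical_min; exists (s - 0), 0, x; split=> //; ar.
  have {}imax j q : i < j -> j < s -> q \in f 0 -> q \in g j -> False.
    by move=> ij js q1 q2; apply: (imax (s - j)); [ar | exists j, q].
  pose R := [set e in map g (iota i.+1 (s - i.+1)) ++ map h (iota 0 r) ++ map f (iota 1 t.-1)].
  have memR e : e \in R -> [\/ exists2 j, i < j < s & e = g j, exists2 j, j < r & e = h j | exists2 j, 0 < j < t & e = f j].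
    rewrite inE !mem_cat => /or3P[] /mapP[j]; rewrite mem_iota => hj ->.
    - by apply: Or31; exists j => //; ar.
    - by apply: Or32; exists j.
    - by apply: Or33; exists j => //; ar.
  have gRR j : i < j -> j < s -> g j \in R.
    by move=> h1 h2; rewrite inE !mem_cat map_f // mem_iota; ar.
  have hRR j : j < r -> h j \in R.
    by move=> h1; rewrite inE !mem_cat [X in _ || (X || _)]map_f ?orbT // mem_iota.
  have fRR j : 0 < j -> j < t -> f j \in R.
    by move=> h1 h2; rewrite inE !mem_cat [X in _ || (_ || X)]map_f ?orbT // mem_iota; ar.
  have notR q e : q \in g i -> q \in f 0 -> e \in R -> q \notin e.
    move=> qg qf /memR[] [j hj ->]; apply/negP => qe.
    - by apply: (imax j q) => //; ar.
    - by case: j hj qe => [|j] hj qe; [apply: noc; exists q, i | apply: (farh j.+1 q i)].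
    - by apply: (farf j q i) => //; ar.
  have gi1 : xs i.+1 \in g i by case: (incg i hi).
  have [|||||e' [q [q1 q2 q3 q4]]] := @closing (g i) (f 0) p R (xs i.+1) (w 1) (gF _ hi) (fF 0 t0) pg pf _ _ _ gi1 f01.
  - by apply/subsetP => e /memR[] [j hj ->]; [apply: gF | apply: hF | apply: fF]; ar.
  - by move=> e' e'R; apply: notR.
  - apply: (joined_trans (v := y)).
      rewrite -xss; apply: joined_incident incg _ _ _ => // j h1 h2; exact: gRR.
    apply: (joined_trans (v := z)).
      by rewrite -v0 -vr; apply: joined_incident inch _ _ _ => // j h1 h2; apply: hRR.
    rewrite -wt; apply: joined_sym; apply: joined_incident incf _ _ _ => // j h1 h2; exact: fRR.
  - have [i1|i1] := ltnP i.+1 s; first by exists (g i.+1); [apply: gRR | case: (incg _ i1)].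
    by exists (h 0); [apply: hRR | rewrite (_ : i.+1 = s) ?xss //; ar].
  - have [t1|t1] := ltnP 1 t; first by exists (f 1); [apply: fRR | case: (incf _ t1)].
    by exists (h r.-1); [apply: hRR; ar | rewrite (_ : 1 = t) ?wt //; ar].
  by have := notR q e' q1 q2 q3; rewrite q4.
(* If both sides are single edges, [z] serves. Otherwise closing the sides at [z] gives a common
   vertex on a later side edge, and such edges do not meet the base. *)
have [o [of0 oh og]] : exists o, [/\ o \in f 0, o \in h 0 & forall i, i < s -> o \notin g i].
  have [tr1|tr2] := leqP (t + r) 2.
    have et : t = 1 by ar.
    have er : r = 1 by ar.
    by exists z; split=> //; [move: zf; rewrite et | move: zh; rewrite er].
  pose R := [set e in map h (iota 1 r.-1) ++ map f (iota 1 t.-1)].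
  have memR e : e \in R -> (exists2 j, 0 < j < r & e = h j) \/ (exists2 j, 0 < j < t & e = f j).
    by rewrite inE !mem_cat => /orP[] /mapP[j]; rewrite mem_iota => hj ->; [left | right]; exists j => //; ar.
  have hRR j : 0 < j -> j < r -> h j \in R.
    by move=> h1 h2; rewrite inE !mem_cat map_f // mem_iota; ar.
  have fRR j : 0 < j -> j < t -> f j \in R.
    by move=> h1 h2; rewrite inE !mem_cat [X in (_ || X)]map_f ?orbT // mem_iota; ar.
  have far q e j : e \in R -> q \in e -> j < s -> q \notin g j.
    move=> /memR[] [l hl ->] qe js; apply/negP => qg; first by apply: (farh l q j) => //; ar.
    by apply: (farf l q j) => //; ar.
  have [|||||e' [q [q1 q2 q3 q4]]] := @closing (f 0) (h 0) c R (w 1) (v 1) (fF 0 t0) (hF 0 r0) cf ch _ _ _ f01 h01.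
  - by apply/subsetP => e /memR[] [j hj ->]; [apply: hF | apply: fF]; ar.
  - by move=> e' e'R; apply/negP => ce; have := far c e' i e'R ce hi; rewrite cg.
  - apply: (joined_trans (v := z)).
      by rewrite -wt; apply: joined_incident incf _ _ _ => // j h1 h2; apply: fRR.
    by rewrite -vr; apply: joined_sym; apply: joined_incident inch _ _ _ => // j h1 h2; apply: hRR.
  - have [t1|t1] := ltnP 1 t; first by exists (f 1); [apply: fRR | case: (incf _ t1)].
    by exists (h r.-1); [apply: hRR; ar | rewrite (_ : 1 = t) ?wt //; ar].
  - have [t1|t1] := ltnP 1 r; first by exists (h 1); [apply: hRR | case: (inch _ t1)].
    by exists (f t.-1); [apply: fRR; ar | rewrite (_ : 1 = r) ?vr //; ar].
  by exists q; split=> // j js; apply: far q3 q4 js.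
have xsf : xs s \notin f 0 by rewrite xss; apply: yf.
have x0h : xs 0 \notin h 0 by rewrite xs0; apply: xh.
have x0f : xs 0 \in f 0 by rewrite xs0.
have xsh : xs s \in h 0 by rewrite xss.
have [b [b0 bs bf hb]] := @first_false (fun j => xs j \in f 0) 0 s x0f xsf ltac:(ar).
have [a [as' ah ha]] := @last_false (fun j => xs j \in h 0) s x0h xsh.
have [ab|ab] := leqP b a.+1.
  have nf j : b <= j -> j <= s -> xs j \notin f 0.
    move=> bj js; apply: contra bf => xj.
    exact: (trace_convex (a := 0) (b := j) tpg gF (fF 0 t0) x0f xj).
  have nh j : j <= a -> xs j \notin h 0.
    move=> bj; apply: contra ah => xj.
    apply: (trace_convex (a := j) (b := s) tpg gF (hF 0 r0) xj xsh) => //; ar.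
  have tps := tpath_shift tpg (a := b.-1) (s' := a.+2 - b) ltac:(ar).
  apply: (nocyc (s := (a.+2 - b).+1) (x := fun j => if j is j'.+1 then xs (b.-1 + j') else o)
    (g := fun j => if j is j'.+1 then g (b.-1 + j') else f 0) _ _ _ (hF 0 r0)) => //.
  - by ar.
  - case: (tps) => incs trs; split.
      case=> [|j] hj /=; first by rewrite addn0; split=> //; apply: hb; ar.
      exact: incs.
    case=> [|l] [|j] //= hl hj q; try ar.
    + case: j hj q => [|j] hj q; first by right.
      by move: q; rewrite (negbTE (nf _ _ _)) //; ar.
    + by move: q; rewrite (negbTE (og _ _)) //; ar.
    + by have := trs l j; rewrite /= => h1; have := h1 ltac:(ar) ltac:(ar) q; ar.
  - by case=> [|j] hj; [apply: fF | apply: gF; ar].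
  - by apply: ha; ar.
  - by case=> [//|j] _ hj; apply: nh; ar.
have tps := tpath_shift tpg (a := a) (s' := b - a) ltac:(ar).
have [rr [ir cr inr]] : exists r, [/\ injective r, forall e, e \in [set e in h 0 :: f 0 :: map g (iota a (b - a))] -> convex r e
  & increasing r (b - a) (fun j => xs (a + j))].
  apply: interval_tpath tps _ _; last 2 first.
  - by ar.
  - by move=> j hj; rewrite !inE; apply/orP; right; apply/orP; right; apply: map_f; rewrite mem_iota; ar.
  apply: small_interval.
    move=> e; rewrite !inE => /or3P[/eqP->|/eqP->|]; [exact: hF | exact: fF |].
    by apply: sub_iota_map => j h1 h2; apply: gF; ar.
  rewrite /= size_map size_iota.
  (* [f 0] contains [o] and the [b - a] vertices from [x a] to [x b.-1], so [f 0], [h 0] and the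
     [b - a] base edges are at most [d + 1] edges. *)
  have := rankF (fF 0 t0); have := @uniq_leq_card _ (f 0) (o :: map xs (iota a (b - a))).
  rewrite /= size_map size_iota (tpath_uniq tpg) //; last by ar.
  rewrite andbT => h1 h2; suff : (b - a).+1 <= #|f 0| by ar.
  apply: h1.
    apply/negP => /mapP[j]; rewrite mem_iota => hj E.
    by have [h1 _] := incg j ltac:(ar); have := og j ltac:(ar); rewrite E h1.
  move=> q; rewrite inE => /orP[/eqP->//|/mapP[j]]; rewrite mem_iota => hj ->.
  by apply: hb; ar.
have chh : convex rr (h 0) by apply: cr; rewrite !inE eqxx.
have cff : convex rr (f 0) by apply: cr; rewrite !inE eqxx orbT.
have cgg j : j < b - a -> convex rr (g (a + j)).
  by move=> hj; apply: cr; rewrite !inE; apply/orP; right; apply/orP; right; apply: map_f; rewrite mem_iota; ar.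
have i1 := inr 0 ltac:(ar).
have i2 := inr (b - a).-1 ltac:(ar).
have := increasing_outside (u := o) ir (proj1 tps) inr cgg; rewrite /= addn0 subnKC; last by ar.
rewrite addn0 addn1 in i1; rewrite prednK in i2; last by ar.
rewrite subnKC in i2; last by ar.
case=> [j hj||k|k].
- by apply: og; ar.
- by ar.
- by case/negP: ah; apply: (chh o (xs a.+1)) => //; apply: ha; ar.
- by case/negP: bf; apply: (cff (xs (a + (b - a).-1)) o) => //; apply: hb; ar.
Qed.

(** A least triple, renamed so that its longest connection is the base, is a [conf], unless all
    connections are single edges; these then form a chordless cycle of three edges. *)
Lemma no_triple x y z s t r : triple x y z s t r -> False.
Proof.
move=> tr0; pose P n := exists x y z s t r, s + t + r = n /\ triple x y z s t r.
have [n [[{}x [{}y [{}z [{}s [{}t [{}r [<- {tr0}tr]]]]]]] hmin]] : exists n, P n /\ forall k, k < n -> ~ P k.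
  by apply: classical_min; exists (s + t + r), x, y, z, s, t, r.
have {}hmin x' y' z' s' t' r' : triple x' y' z' s' t' r' -> s + t + r <= s' + t' + r'.
  by move=> h; rewrite leqNgt; apply/negP => /hmin; apply; exists x', y', z', s', t', r'.
wlog [ts rs] : x y z s t r tr hmin / t <= s /\ r <= s.
  move=> W; case: (tr) => n1 n2 n3 [w1 w2 w3].
  have [ts|ts] := leqP t s; have [rs|rs] := leqP r s.
  - exact: (W _ _ _ _ _ _ tr).
  - apply: (W y z x r s t); [|by move=> x' y' z' s' t' r' /hmin; ar|by ar].
    split=> //; try by rewrite eq_sym.
    by split=> //; apply: walk_rev.
  - apply: (W x z y t s r); [|by move=> x' y' z' s' t' r' /hmin; ar|by ar].
    split=> //; try by rewrite eq_sym.
    by split=> //; apply: walk_rev.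
  - have [tr'|tr'] := leqP t r.
      apply: (W y z x r s t); [|by move=> x' y' z' s' t' r' /hmin; ar|by ar].
      split=> //; try by rewrite eq_sym.
      by split=> //; apply: walk_rev.
    apply: (W x z y t s r); [|by move=> x' y' z' s' t' r' /hmin; ar|by ar].
    split=> //; try by rewrite eq_sym.
    by split=> //; apply: walk_rev.
case: (tr) => n1 n2 n3 [w1 w2 w3].
have s0 : 0 < s by case: s w1 {tr hmin ts rs} => //= h; rewrite h eqxx in n1.
have t0 : 0 < t by case: t w2 {tr hmin ts} => //= h; rewrite h eqxx in n3.
have r0 : 0 < r by case: r w3 {tr hmin rs} => //= h; rewrite h eqxx in n2.
have [s1|s1] := leqP s 1.
  have {s1 s0} es : s = 1 by ar.
  have {ts t0} et : t = 1 by ar.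
  have {rs r0} er : r = 1 by ar.
  subst s t r; case: w1 => g [y' [gR xg yg ey]]; case: w2 => f [z' [fR xf zf ez]]; case: w3 => h [z'' [hR yh zh ez']].
  simpl in ey, ez, ez'; subst y' z' z''.
  move: gR fR hR; rewrite !inE => /andP[gF zg] /andP[fF yf] /andP[hF xh].
  apply: (nocyc _ (tpath2 xg yg yh zh zg xh) _ fF) => //; first by case=> [|[|]].
  by case=> [|[|]].
have [j hj|xs [g Sg]] := shortest_walk w1.
  by move=> wj; have := hmin x y z j t r; rewrite leqNgt => /(_ _)/negP; apply; [split | ar].
have [j hj|w [f Sf]] := shortest_walk w2.
  by move=> wj; have := hmin x y z s j r; rewrite leqNgt => /(_ _)/negP; apply; [split | ar].
have [j hj|v [h Sh]] := shortest_walk w3.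
  by move=> wj; have := hmin x y z s t j; rewrite leqNgt => /(_ _)/negP; apply; [split | ar].
by apply: (@conf_false x y z s t r xs g w f v h).
Qed.

Theorem no_cycle_interval : interval F.
Proof.
have [|r [ir cr]] := @AT_free_order T F setT; last first.
  by exists r; split=> [x y|e eF x y z xe ye]; [apply: ir | apply: (cr e x y z)].
have conn z x y : connect (link F setT z) x y -> exists k, walk (avoiding z) k x y.
  move=> c; apply: (conn_ind (P := fun y => exists k, walk (avoiding z) k x y) c).
    by exists 0.
  move=> u v _ [k wk] /linkP[e [[eF ue ve ze] _]]; exists (k + 1); apply: walk_cat wk _.
  by apply: (walk1 (e := e)) => //; rewrite inE eF.
move=> x y z _ _ _ n1 n2 n3 /conn[s w1] /conn[r w2] /conn[t w3].
by apply: (@no_triple x y z s t r).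
Qed.

End SmallObstructions.

(** * Components, balls and cuts *)

Section Components.
Variables (T : finType).
Implicit Types (F K R S : {set {set T}}) (e f : {set T}) (p q u v w : T).

Lemma interval_disjointU F F' (D : {set T}) : (forall e, e \in F -> e \subset D) ->
  (forall e, e \in F' -> [disjoint e & D]) -> interval F -> interval F' -> interval (F :|: F').
Proof.
move=> FD F'D [r [ir cr]] [r' [ir' cr']].
have [N hN] := bound_ex r.
exists (fun x => if x \in D then r x else N + r' x); split.
  move=> x y; case: ifP => xD; case: ifP => yD; first exact: ir.
  - by move=> h; have := hN x; ar.
  - by move=> h; have := hN y; ar.
  - by move=> /addnI/ir'.
move=> e; rewrite inE => /orP[] eF x y z xe ye.
  have inD w : w \in e -> w \in D by apply: (subsetP (FD e eF)).
  rewrite (inD x xe) (inD y ye); case: ifP => zD; first exact: (cr e eF x y z).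
  by move=> _ h; have := hN y; ar.
have ninD w : w \in e -> (w \in D) = false by move=> we; rewrite (disjointFr (F'D e eF)).
rewrite (ninD x xe) (ninD y ye); case: ifP => zD; first by move=> h _; have := hN z; ar.
by rewrite !ltn_add2l; apply: (cr' e eF x y z).
Qed.

Definition sharing R : rel T := fun u v => [exists e in R, (u \in e) && (v \in e)].

Definition component R u : {set T} := [set v | connect (sharing R) u v].

Lemma componentP R u v : reflect (joined R u v) (v \in component R u).
Proof.
rewrite inE; apply: (iffP idP) => [/connectP[p pp ->]|[k]].
  elim: p u pp => [|w p IH] u /=; first by move=> _; exists 0.
  move=> /andP[/exists_inP[e eR /andP[ue we]] /IH]; apply: joined_trans; exact: joined1 eR ue we.
elim: k u => [|k IH] u /=; first by move=> ->; apply: connect0.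
move=> [e [w [eR ue we /IH]]]; apply: connect_trans; apply: connect1; apply/exists_inP; exists e => //.
by rewrite ue.
Qed.

Lemma joined_closed R (D : {set T}) u v : (forall e, e \in R -> (e \subset D) || [disjoint e & D]) ->
  joined R u v -> u \in D -> v \in D.
Proof.
move=> cl [k]; elim: k u => [|k IH] u /=; first by move=> ->.
move=> [e [w [eR ue we wk]]] uD; apply: (IH w wk).
by case/orP: (cl e eR) => [/subsetP|h]; [apply | rewrite (disjointFr h ue) in uD].
Qed.

Lemma component_closed R u e : e \in R -> (e \subset component R u) || [disjoint e & component R u].
Proof.
move=> eR; have [//|] := boolP [disjoint e & component R u]; first by rewrite orbT.
rewrite -setI_eq0 => /set0Pn[w]; rewrite inE => /andP[we /componentP uw]; rewrite orbF.
apply/subsetP => v ve; apply/componentP; apply: joined_trans uw _; exact: joined1 eR we ve.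
Qed.

Lemma joined_sub R R' u v : R \subset R' -> joined R u v -> joined R' u v.
Proof.
move=> /subsetP s [k]; elim: k u => [|k IH] u; first by move=> ->; exists 0.
move=> [e [w [/s eR ue we wk]]]; apply: joined_trans (IH w wk); exact: joined1 eR ue we.
Qed.

Variable d : nat.

Lemma locally_interval_sub F F' : F \subset F' -> locally_interval F' d -> locally_interval F d.
Proof. by move=> s loc S sS; apply: loc; apply: subset_trans sS s. Qed.

(** The cycle is unrolled to all of [nat] with period [k], so that a path starting anywhere on it is
    a plain shift of indices. *)
Definition cycle_in F k (x : nat -> T) (g : nat -> {set T}) :=
  [/\ forall i, [/\ g i \in F, x i \in g i & x i.+1 \in g i],
      forall i, x (i + k) = x i /\ g (i + k) = g i & forall i j, x j \in g i -> j = i %[mod k] \/ j = i.+1 %[mod k]].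

Hypothesis d2 : 2 <= d.

(** A chordless cycle of at most [d + 1] edges would be an interval family; but an order that
    increases along the path puts its inner vertices into the closing edge. *)
Lemma cycle_exists F : (forall e, e \in F -> #|e| <= d) -> locally_interval F d ->
  ~ interval F -> exists k x g, d.+2 <= k /\ cycle_in F k x g.
Proof.
move=> rk loc nint.
have [[s [x [g [f [s1 [tp [gF [fF [x0 [xs mid]]]]]]]]]]|no] := classic (exists s x g f, 1 < s /\
  tpath s x g /\ (forall i, i < s -> g i \in F) /\ f \in F /\ x 0 \in f /\ x s \in f /\
  (forall j, 0 < j -> j < s -> x j \notin f)); last first.
  case: nint; apply: (no_cycle_interval d2 rk loc) => s x g f h1 h2 h3 h4 h5 h6 h7.
  by apply: no; exists s, x, g, f.
case: (tp) => inc tr; pose k := s.+1.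
have kd : d.+2 <= k.
  rewrite ltnNge; apply/negP => h.
  have [r [ir cr inr]] : exists r, [/\ injective r, forall e, e \in [set e in f :: map g (iota 0 s)] -> convex r e
      & increasing r s x].
    apply: interval_tpath tp _ _ => //; last first.
      by move=> i hi; rewrite !inE; apply/orP; right; apply: map_f; rewrite mem_iota.
    apply: (small_interval loc).
      move=> e; rewrite inE => /orP[/eqP->//|/mapP[i]]; rewrite mem_iota => hi ->; exact: gF.
    by rewrite /= size_map size_iota.
  have cf : convex r f by apply: cr; rewrite !inE eqxx.
  case/negP: (mid 1 isT s1); apply: (cf (x 0) (x s)) => //.
    by apply: inr; ar.
  by apply: increasing_lt inr _ _.
have k0 : 0 < k by [].
have modS i : i.+1 %% k = if i %% k < s then (i %% k).+1 else 0.
  have := ltn_pmod i k0; rewrite -[in i.+1 %% k]addn1 -modnDml addn1 ltnS leq_eqVlt => /orP[/eqP->|h].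
    by rewrite modnn ltnn.
  by rewrite h modn_small.
exists k, (fun i => x (i %% k)), (fun i => if i %% k < s then g (i %% k) else f); split=> //.
split.
- move=> i; rewrite modS; case: ifP => h; first by have [h1 h2] := inc _ h; split=> //; apply: gF.
  by split=> //; have := ltn_pmod i k0; rewrite ltnS leq_eqVlt h orbF => /eqP->.
- by move=> i; rewrite modnDr.
- move=> i j; have lj := ltn_pmod j k0; have li := ltn_pmod i k0; rewrite modS; case: ifP => h.
    by move=> /tr; apply.
  have ei : i %% k = s by move: li; rewrite ltnS leq_eqVlt h orbF => /eqP.
  move=> xj; rewrite ei; have [j0|j0] := posnP (j %% k); first by right.
  left; apply/eqP; rewrite eqn_leq -ltnS lj /= leqNgt; apply/negP => jl.
  by case/negP: (mid _ j0 jl).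
Qed.

(** * Edges near a long cycle *)

Section Cycle.
Variables (F : {set {set T}}) (k : nat) (x : nat -> T) (g : nat -> {set T}).
Hypotheses (rk : forall e, e \in F -> #|e| <= d) (loc : locally_interval F d)
  (kd : d.+2 <= k) (cyc : cycle_in F k x g).

Lemma cycle_tpath c : tpath k.-1 (fun i => x (c + i)) (fun i => g (c + i)).
Proof.
case: cyc => inc per tr; split.
  by move=> i hi; case: (inc (c + i)) => _; rewrite addnS.
move=> i j hi hj /tr; rewrite -addnS => -[] /eqP; rewrite eqn_modDl => /eqP.
  by rewrite !modn_small; ar.
by rewrite !modn_small; ar.
Qed.

(** Besides [x c] the cycle has [k - 1 > d] vertices. *)
Lemma cycle_missing e c : #|e| <= d -> exists i, 0 < i < k /\ x (c + i) \notin e.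
Proof.
move=> he; have [//|no] := classic (exists i, 0 < i < k /\ x (c + i) \notin e).
have := @uniq_leq_card _ e (map (fun i => x (c + i)) (iota 1 k.-1)).
rewrite size_map size_iota (tpath_uniq (cycle_tpath c)); try ar.
move=> h; suff : k.-1 <= #|e| by ar.
apply: h => // y /mapP[i]; rewrite mem_iota => hi ->.
by apply: contraT => ni; case: no; exists i; split=> //; ar.
Qed.

(** [e] misses two cycle vertices, which cut the cycle into two paths with ends outside [e]; by
    [path_attach] it contains no cycle vertex at all. Then [attach_middle] applies to every cycle
    edge. *)
Lemma cycle_avoid e u i : e \in F -> u \in e -> (forall i, u \notin g i) -> [disjoint e & g i].
Proof.
move=> eF ue ug; have [inc per tr] := cyc.
have gF j : g j \in F by case: (inc j).
have A j : x j \notin e.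
  apply/negP => xj.
  have [c0 [_ nc]] := cycle_missing 0 (rk eF).
  have [b [hb nb]] := cycle_missing c0 (rk eF).
  rewrite add0n in nc; set c := c0 in nc nb.
  have perm m l : x (l + m * k) = x l.
    elim: m => [|m IH]; first by rewrite mul0n addn0.
    by rewrite mulSn (addnC k) addnA (proj1 (per _)).
  have [l [hl xl]] : exists l, 0 < l < k /\ x (c + l) \in e.
    (* The distance from [c] forward to [j] on the cycle. *)
    pose l := (j + (k - c %% k)) %% k.
    have El : c + l = j %[mod k].
      rewrite /l modnDmr addnCA -modnDmr -(modnDml c) subnKC ?modnn ?addn0 //.
      by apply: ltnW; apply: ltn_pmod; ar.
    have xm (q0 : nat) : x (q0 %% k) = x q0 by rewrite [in RHS](divn_eq q0 k) addnC perm.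
    have E : x (c + l) = x j by rewrite -xm El xm.
    exists l; rewrite E; split=> //.
    rewrite ltn_pmod ?andbT; last by ar.
    rewrite lt0n; apply: contraNneq nc => l0; by rewrite -(addn0 c) -l0 E.
  have [lb|bl] := leqP l b.
    have := path_attach d2 rk loc (tpath_shift (cycle_tpath c) (a := 0) (s' := b) ltac:(ar)) _ eF ue (j := l).
    rewrite !add0n xl => h; suff : false by []; apply: h => //.
    by rewrite addn0.
  have := path_attach d2 rk loc (tpath_shift (cycle_tpath (c + b)) (a := 0) (s' := k - b) ltac:(ar)) _ eF ue (j := l - b).
  rewrite /= !add0n addn0 (_ : c + b + (l - b) = c + l) ?xl; last by ar.
  rewrite (_ : c + b + (k - b) = c + k) ?(proj1 (per _)); last by ar.
  by move=> h; suff : false by []; apply: h => //; ar.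
rewrite -setI_eq0; apply/eqP/setP => q; rewrite in_set0 inE; apply/negP => /andP[qe qg].
(* Modulo the period, [i + k.-1] is one step before [i]; starting there makes [g i] the second of at
   least three path edges. *)
apply: (attach_middle d2 rk loc (cycle_tpath (i + k.-1)) _ eF ue _ _ _ (i := 0) (p := q)) => //; first by ar.
by rewrite -addnA addn1 prednK ?(proj2 (per _)) //; ar.
Qed.

End Cycle.

(** * One component of a locally interval family *)

Section Component.
Variables (F : {set {set T}}) (v : T).
Hypotheses (rk : forall e, e \in F -> #|e| <= d) (loc : locally_interval F d).
Let C := component F v.
Definition component_edges := [set e in F | ~~ [disjoint e & C]].
Notation K := component_edges.

Lemma component_edges_sub : K \subset F.
Proof. by apply/subsetP => e; rewrite inE => /andP[]. Qed.

Lemma component_edges_subset e : e \in K -> e \subset C.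
Proof.
rewrite inE => /andP[eF]; have := component_closed v eF; rewrite -/C.
by case: [disjoint e & C]; rewrite ?orbF.
Qed.

Lemma component_edgesP e u : e \in F -> u \in e -> (e \in K) = (u \in C).
Proof.
move=> eF ue; apply/idP/idP => [/component_edges_subset/subsetP->//|uC].
by rewrite inE eF -setI_eq0; apply/set0Pn; exists u; rewrite inE ue.
Qed.

(** By [cycle_avoid], lying in no cycle edge is inherited by all vertices of a common edge, so it
    would spread to the cycle itself. *)
Lemma component_cycle k x g u : d.+2 <= k -> cycle_in K k x g -> u \in C -> exists i, u \in g i.
Proof.
move=> kd cyc uC; have [//|no] := classic (exists i, u \in g i).
have cycF : cycle_in F k x g.
  case: cyc => inc per tr; split=> // i; case: (inc i) => gK; split=> //; exact: (subsetP component_edges_sub).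
have [inc _ _] := cyc.
have x0C : x 0 \in C by case: (inc 0) => /component_edges_subset/subsetP h /h.
have [n wk] : joined F u (x 0).
  by apply: (joined_trans (v := v)); [apply: joined_sym|]; apply/componentP.
suff : forall n u, walk F n u (x 0) -> ~ (exists i, u \in g i) -> False by move=> h; case: (h n u).
elim=> [|m IH] w /=; first by move=> ->; case; exists 0; case: (inc 0).
move=> [e [w' [eF we we' wk']]] nw; apply: (IH w' wk') => -[i w'i].
have h : [disjoint e & g i].
  by apply: (cycle_avoid rk loc kd cycF i eF we) => j; apply/negP => wj; apply: nw; exists j.
by have := disjointFr h we'; rewrite w'i.
Qed.

Let rkK e : e \in K -> #|e| <= d.
Proof. by move=> eK; apply: rk; apply: (subsetP component_edges_sub). Qed.

Let locK : locally_interval K d.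
Proof. exact: locally_interval_sub component_edges_sub loc. Qed.

Lemma component_star u : u \in C -> interval (avoiding K u).
Proof.
move=> uC; have [//|nint] := classic (interval (avoiding K u)).
have sub : avoiding K u \subset K by apply/subsetP => e /avoidingF.
have [|||k [x [g [kd [inc per tr]]]]] := @cycle_exists (avoiding K u).
- by move=> e /(subsetP sub)/rkK.
- exact: locally_interval_sub sub locK.
- exact: nint.
have [||i] := @component_cycle k x g u kd.
- split=> // i; have [h1 h2 h3] := inc i; split=> //; exact: (subsetP sub).
- exact: uC.
- by have [/avoiding_notin/negbTE->] := inc i.
Qed.

(** Two consecutive cycle edges, their common cycle vertex [a] and their other ends; the rest of the
    cycle connects these ends and avoids [a]. The first edge can be taken at [v] because every
    vertex of the component is on a cycle edge. *)
Lemma component_detect : ~ interval K -> exists f1 f2 a x y,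
  [/\ f1 \in F, f2 \in F, v \in f1 & [/\ a \in f1, x \in f1, a \in f2, y \in f2 &
   [/\ x \notin f2, y \notin f1 & joined (avoiding F a) x y]]].
Proof.
move=> nint; have [k [x [g [kd cyc]]]] := cycle_exists rkK locK nint.
have vC : v \in C by apply/componentP; exists 0.
have [i vi] := component_cycle kd cyc vC.
have [inc per tr] := cyc; have KF := subsetP component_edges_sub.
have [g0 x0 x1] := inc i; have [g1 y0 y1] := inc i.+1.
have nxt (l m : nat) : l = m %[mod k] -> ~ (l < m < l + k).
  move=> E /andP[lm ml]; have : m - l = 0 %[mod k].
    by apply/eqP; rewrite -(eqn_modDl l) subnKC ?addn0 1?eq_sym; [apply/eqP | apply: ltnW].
  by rewrite mod0n modn_small; ar.
exists (g i), (g i.+1), (x i.+1), (x i), (x i.+2); split; try exact: KF; first exact: vi.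
split=> //; split.
- apply/negP => /tr[] h; [apply: (nxt i i.+1 h) | apply: (nxt i i.+2 h)]; ar.
- apply/negP => /tr[] h; [apply: (nxt i i.+2 (esym h)) | apply: (nxt i.+1 i.+2 (esym h))]; ar.
apply: joined_sym; rewrite -(proj1 (per i)).
have incd : incident (i + k) x g by move=> j _; case: (inc j).
apply: (joined_incident (s := i + k) (g := g)) => //; first by ar.
move=> j h1 h2; rewrite inE KF ?andTb; last by case: (inc j).
apply/negP => /tr[] h; [apply: (nxt i.+1 j h) | apply: (nxt i.+1 j.+1 h)]; ar.
Qed.

(** In an interval order [a] would lie between [x] and [y], and a walk avoiding [a] cannot jump over
    it. *)
Lemma component_sound f1 f2 a x y : f1 \in K -> f2 \in K ->
  a \in f1 -> x \in f1 -> a \in f2 -> y \in f2 -> x \notin f2 -> y \notin f1 ->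
  joined (avoiding F a) x y -> ~ interval K.
Proof.
move=> f1K f2K a1 x1 a2 y2 x2 y1 [n wk] [r [ir cr]].
have xC : x \in C by apply: (subsetP (component_edges_subset f1K)).
wlog xa : r ir cr / r x < r a.
  move=> W; case: (ltngtP (r x) (r a)) => [|h|/ir h]; [exact: W | | by rewrite h a2 in x2].
  have [|r0 [r' [_ ir' _ cr' E]]] := @interval_rev _ K; first by exists r.
  have [N hN] := bound_ex r.
  apply: (W (fun u => N - r u)).
  - by move=> u w h3; have := hN u; have := hN w => h1 h2; apply: ir; ar.
  - move=> e eK u w z ue we h1 h2; apply: (cr e eK w u) => //.
      by have := hN u; have := hN z; have := hN w; ar.
    by have := hN u; have := hN z; have := hN w; ar.
  - by have := hN x; have := hN a; ar.
have ay : r a < r y.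
  case: (ltngtP (r a) (r y)) => // [h|/ir h]; last by rewrite -h a1 in y1.
  case: (ltngtP (r x) (r y)) => [h'|h'|/ir h'].
  - by case/negP: y1; apply: (cr f1 f1K x a).
  - by case/negP: x2; apply: (cr f2 f2K y a).
  - by case/negP: x2; rewrite h'.
suff : r y < r a by rewrite ltnNge (ltnW ay).
elim: n x wk xC {x1 x2} xa => [|n IH] w /=; first by move=> ->.
move=> [e [w' [eA we we' wk]]] wC wa.
have eK : e \in K by rewrite (component_edgesP (avoidingF eA) we).
apply: (IH w' wk); first exact: (subsetP (component_edges_subset eK)).
case: (ltngtP (r w') (r a)) => // [h|/ir h].
  by have := avoiding_notin eA; rewrite (cr e eK w w').
by have := avoiding_notin eA; rewrite -h we'.
Qed.

Definition degree u := #|[set e in F | u \in e]|.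

(* In an interval order of [K :\: D] the edges at the leftmost vertex of the
   component are initial segments, so they have pairwise distinct sizes. *)
Lemma component_degree u (D : {set {set T}}) : u \in C -> (forall w, w \in C -> degree u <= degree w) ->
  ~ interval K -> interval (K :\: D) -> degree u <= d.+1 * #|D :&: K|.
Proof.
move=> uC umin nint [r [ir cr]].
have D0 : 0 < #|D :&: K|.
  rewrite card_gt0; apply/eqP => h; apply: nint.
  exists r; split=> // e eK; apply: cr; rewrite inE eK andbT; apply/negP => eD.
  by have /setP/(_ e) := h; rewrite in_set0 inE eD eK.
pose w := [arg min_(w < u in C) r w].
have [wC wmin] : w \in C /\ forall z, z \in C -> r w <= r z.
  by rewrite /w; case: arg_minnP.
apply: leq_trans (umin w wC) _.
pose S := [set e in K :\: D | w \in e].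
have inK e : e \in F -> w \in e -> e \in K by move=> eF we; rewrite (component_edgesP eF we).
have sub : [set e in F | w \in e] \subset (D :&: K) :|: S.
  apply/subsetP => e; rewrite inE => /andP[eF we]; rewrite in_setU in_setI (inK e eF we).
  by rewrite inE in_setD (inK e eF we) we !andbT orbN.
have dS : #|S| <= d.
  have H e e' : e \in S -> e' \in S -> #|e| = #|e'| -> e \subset e'.
    rewrite !in_set => /andP[/andP[eD /andP[eF eC]] we] /andP[/andP[e'D /andP[e'F e'C]] we'] E.
    have eK := inK e eF we; have eK' := inK e' e'F we'.
    apply/subsetP => z ze; apply: contraT => ze'.
    suff /proper_card : e' \proper e by rewrite E ltnn.
    apply/properP; split; last by exists z.
    apply/subsetP => q qe'.
    have zC := subsetP (component_edges_subset eK) z ze.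
    have qC := subsetP (component_edges_subset eK') q qe'.
    have K'e : e \in K :\: D by rewrite in_setD eD.
    have K'e' : e' \in K :\: D by rewrite in_setD e'D.
    have [->//|qw] := eqVneq q w.
    case: (ltngtP (r q) (r z)) => [h|h|/ir->//].
      apply: (cr e K'e w z) => //; rewrite ltn_neqAle wmin // andbT.
      by apply: contra qw => /eqP/ir->.
    case/negP: (ze'); apply: (cr e' K'e' w q) => //; rewrite ltn_neqAle wmin // andbT.
    by apply: contraNneq ze' => /ir<-.
  have := @uniq_leq_size _ (map (fun e : {set T} => #|e|) (enum S)) (iota 1 d).
  rewrite size_map size_iota -cardE; apply.
    rewrite map_inj_in_uniq ?enum_uniq // => e e'; rewrite !mem_enum => eS e'S E.
    by apply/eqP; rewrite eqEsubset !H.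
  move=> l /mapP[e]; rewrite mem_enum inE => /andP[eKD we] ->.
  have eK : e \in K by move: eKD; rewrite inE => /andP[].
  rewrite mem_iota add1n ltnS rkK // andbT card_gt0; apply/set0Pn; by exists w.
(* The degree is at most [#|D :&: K| + d], and [D] deletes at least one edge of a component that is
   not interval, which turns the summand [d] into a factor. *)
have := leq_trans (subset_leq_card sub) (leq_card_setU _ _) => h.
by rewrite /degree; nia.
Qed.

End Component.

(** * Bounded degree and balls of bounded size *)

Section Balls.
Variables (F : {set {set T}}).
Hypotheses (rk : forall e, e \in F -> #|e| <= d) (loc : locally_interval F d).

(** Take two edges at [v] with the largest union. A third edge leaving the union would give three
    edges at [v], each with a private vertex. In an interval order two of these vertices are on the
    same side of [v], and the edge of the farther one contains the nearer one. *)
Lemma star_union v : exists e1 e2, [/\ #|e1| <= d, #|e2| <= d & forall e, e \in F -> v \in e -> e \subset e1 :|: e2].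
Proof.
pose S := [set e in F | v \in e].
have [S0|[e0 e0S]] := set_0Vmem S; last first.
  pose p := [arg max_(p > (e0, e0) | (p.1 \in S) && (p.2 \in S)) #|p.1 :|: p.2| ].
  have [pS pmax] : (p.1 \in S) && (p.2 \in S) /\
      forall q : {set T} * {set T}, (q.1 \in S) && (q.2 \in S) -> #|q.1 :|: q.2| <= #|p.1 :|: p.2|.
    by rewrite /p; case: arg_maxnP => //=; rewrite e0S.
  case: p pS pmax => e1 e2 /= /andP[e1S e2S] pmax.
  have := e1S; rewrite inE => /andP[e1F v1]; have := e2S; rewrite inE => /andP[e2F v2].
  exists e1, e2; split; [exact: rk | exact: rk | move=> e eF ve].
  apply/subsetP => q qe; apply: contraT; rewrite inE negb_or => /andP[q1 q2].
  have eS : e \in S by rewrite inE eF.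
  have priv f f' : f \in S -> f' \in S -> (forall f'', f'' \in S -> #|f'' :|: f'| <= #|f :|: f'|) ->
      q \notin f -> q \notin f' -> exists p, [/\ p \in f, p \notin e & p \notin f'].
    move=> fS f'S mx qf qf'; have [/subsetP sub|/subsetPn[p pf]] := boolP (f \subset e :|: f'); last first.
      by rewrite inE negb_or => /andP[pe pf']; exists p.
    have : #|f :|: f'| < #|e :|: f'|.
      apply: proper_card; apply/properP; split; last first.
        by exists q; rewrite !inE ?qe // negb_or qf.
      by apply/subsetP => w; rewrite in_setU => /orP[/sub//|wf]; rewrite inE wf orbT.
    by rewrite ltnNge mx.
  have [p1 [p11 p1e p12]] : exists p, [/\ p \in e1, p \notin e & p \notin e2].
    by apply: priv => // f fS; apply: (pmax (f, e2)); rewrite /= fS.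
  have [p2 [p22 p2e p21]] : exists p, [/\ p \in e2, p \notin e & p \notin e1].
    by apply: priv => // f fS; rewrite [_ :|: e1]setUC [e2 :|: _]setUC; apply: (pmax (e1, f)); rewrite /= fS e1S.
  have [r [ir cr]] : interval [set f in [:: e1; e2; e]].
    apply: (small_interval loc); first by move=> f; rewrite !inE => /or3P[] /eqP->.
    by rewrite /= ltnS.
  have c1 : convex r e1 by apply: cr; rewrite !inE eqxx.
  have c2 : convex r e2 by apply: cr; rewrite !inE eqxx orbT.
  have c3 : convex r e by apply: cr; rewrite !inE eqxx !orbT.
  (* two of the three private vertices lie on the same side of [v] *)
  have side f f' w w' : convex r f -> convex r f' -> v \in f -> v \in f' -> w \in f -> w' \in f' ->
    w \notin f' -> w' \notin f -> (r v < r w) = ~~ (r v < r w').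
    move=> cf cf' vf vf' wf wf' nw nw'.
    have neq : r w != r w' by apply: contraNneq nw => /ir->.
    have vw : r v != r w by apply: contraNneq nw => /ir<-.
    have vw' : r v != r w' by apply: contraNneq nw' => /ir<-.
    case: (ltngtP (r v) (r w)) vw => // h1 _; case: (ltngtP (r v) (r w')) vw' => // h2 _.
      case: (ltngtP (r w) (r w')) neq => // h3 _.
        by case/negP: nw; apply: (cf' v w').
      by case/negP: nw'; apply: (cf v w).
    case: (ltngtP (r w) (r w')) neq => // h3 _.
      by case/negP: nw'; apply: (cf w v).
    by case/negP: nw; apply: (cf' w' v).
  have := side e1 e2 p1 p2 c1 c2 v1 v2 p11 p22 p12 p21.
  have := side e1 e p1 q c1 c3 v1 ve p11 qe p1e q1.
  have := side e2 e p2 q c2 c3 v2 ve p22 qe p2e q2.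
  by case: (r v < r p1); case: (r v < r p2); case: (r v < r q).
exists set0, set0; rewrite cards0; split=> // e eF ve.
by have /setP/(_ e) := S0; rewrite in_set0 inE eF ve.
Qed.

(** All edges at [v] are subsets of one set of at most [2 * d] vertices. *)
Lemma star_card v : #|[set e in F | v \in e]| <= 2 ^ (2 * d).
Proof.
have [e1 [e2 [h1 h2 sub]]] := star_union v.
have : [set e in F | v \in e] \subset powerset (e1 :|: e2).
  by apply/subsetP => e; rewrite inE powersetE => /andP[]; apply: sub.
move=> /subset_leq_card h; apply: leq_trans h _; rewrite card_powerset leq_exp2l //.
by apply: leq_trans (leq_card_setU _ _) _; ar.
Qed.

Fixpoint ball e0 r := if r is r'.+1 then
  ball e0 r' :|: [set f in F | ~~ [disjoint f & cover (ball e0 r')]] else [set e0].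

Lemma ball_sub e0 r : ball e0 r \subset e0 |: F.
Proof.
elim: r => [|r IH] /=; first exact: subsetUl.
rewrite subUset IH /=; apply/subsetP => f; rewrite inE => /andP[fF _]; by rewrite inE fF orbT.
Qed.

Lemma ball_center e0 r : e0 \in ball e0 r.
Proof. by elim: r => [|r IH] /=; rewrite inE ?IH. Qed.

Lemma ball_card e0 r : #|e0| <= d -> #|ball e0 r| <= (1 + d * 2 ^ (2 * d)) ^ r.
Proof.
move=> he0; elim: r => [|r IH] /=; first by rewrite cards1.
set B := ball e0 r in IH *.
have cB : #|cover B| <= #|B| * d.
  apply: leq_trans (leq_card_cover _) _; rewrite -sum_nat_const; apply: leq_sum => e eB.
  by have := subsetP (ball_sub e0 r) e eB; rewrite in_setU1 => /orP[/eqP->|/rk].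
have : #|[set f in F | ~~ [disjoint f & cover B]]| <= #|cover B| * 2 ^ (2 * d).
  have sub : [set f in F | ~~ [disjoint f & cover B]] \subset cover [set [set e in F | v \in e] | v in cover B].
    apply/subsetP => f; rewrite inE => /andP[fF]; rewrite -setI_eq0 => /set0Pn[v]; rewrite inE => /andP[vf vB].
    by rewrite cover_imset; apply/bigcupP; exists v => //; rewrite inE fF.
  apply: leq_trans (subset_leq_card sub) _; apply: leq_trans (leq_card_cover _) _.
  apply: (leq_trans (n := \sum_(A in [set [set e in F | v \in e] | v in cover B]) 2 ^ (2 * d))).
    by apply: leq_sum => A /imsetP[v _ ->]; apply: star_card.
  by rewrite sum_nat_const leq_mul2r leq_imset_card orbT.
move=> h; apply: leq_trans (leq_card_setU _ _) _; rewrite expnS mulnDl mul1n leq_add //.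
apply: leq_trans h _; apply: leq_trans (leq_mul cB (leqnn _)) _.
by rewrite -mulnA mulnC leq_mul2l IH orbT.
Qed.

(* A connected set of at most [d + 1] edges containing [e0] lies in the ball of radius [d]. *)
Lemma ball_locally_interval e0 : (forall S, S \subset ball e0 d -> #|S| <= d.+1 -> interval S) ->
  locally_interval (e0 |: F) d.
Proof.
move=> hb S sS cS.
have [e0S|e0S] := boolP (e0 \in S); last first.
  apply: loc => //; apply/subsetP => e eS; have := subsetP sS e eS.
  by rewrite in_setU1 => /orP[/eqP E|//]; rewrite E (negbTE e0S) in eS.
(* If [S] gains no edge from radius [r] to [r + 1], its part in the ball is disjoint from the rest,
   and both parts are interval. Otherwise each of the [d] steps gains an edge, and all of [S] lies
   in the ball. *)
have [[r [rd st]]|grow] := classic (exists r, r < d /\ S :&: ball e0 r.+1 \subset ball e0 r).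
  have E : S = (S :&: ball e0 r) :|: (S :\: ball e0 r) by rewrite setID.
  have mono a : a <= d -> ball e0 a \subset ball e0 d.
    move=> ad; rewrite -(subnKC ad); elim: (d - a) => [|m IH]; first by rewrite addn0.
    by rewrite addnS /=; apply: subset_trans IH (subsetUl _ _).
  rewrite E; apply: (interval_disjointU (D := cover (ball e0 r))).
  - move=> e; rewrite inE => /andP[_ eB]; apply/subsetP => x xe; apply/bigcupP; by exists e.
  - move=> e; rewrite inE => /andP[eB eS]; apply: contraT => nd.
    case/negP: (eB); apply: (subsetP st); rewrite inE eS /=  inE; apply/orP; right; rewrite inE nd andbT.
    have := subsetP sS e eS; rewrite in_setU1 => /orP[/eqP ee|//].
    by rewrite ee ball_center in eB.
  - apply: hb; first by apply: subset_trans (subsetIr _ _) (mono _ (ltnW rd)).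
    by apply: leq_trans cS; apply: subset_leq_card; apply: subsetIl.
  - apply: loc; last by apply: leq_trans cS; apply: subset_leq_card; apply: subsetDl.
    apply/subsetP => e; rewrite inE => /andP[eB eS]; have := subsetP sS e eS.
    by rewrite in_setU1 => /orP[/eqP ee|//]; rewrite ee ball_center in eB.
have card r : r <= d -> r < #|S :&: ball e0 r|.
  elim: r => [|r IH] hr; first by apply/card_gt0P; exists e0; rewrite inE e0S ball_center.
  apply: leq_ltn_trans (IH (ltnW hr)) _; apply: proper_card; apply/properP; split.
    by apply: setIS; apply: subsetUl.
  have : ~~ (S :&: ball e0 r.+1 \subset ball e0 r) by apply/negP => h; apply: grow; exists r.
  by case/subsetPn => e eB ne; exists e => //; rewrite inE (negbTE ne) andbF.
apply: hb => //; have /eqP <- : S :&: ball e0 d == S; last exact: subsetIr.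
by rewrite eqEcard subsetIl (leq_trans cS) // card.
Qed.

End Balls.
End Components.

(** Counting the vertices of smaller rank turns an injective rank into a permutation. *)
Lemma interval_hypergraphP n (E : {set {set 'I_n}}) : interval_hypergraph E <-> interval E.
Proof.
split=> [[p cp]|[r [ir cr]]].
  exists (fun x => val (p x)); split; first by move=> x y /val_inj/perm_inj.
  move=> e eE x y z xe ye h1 h2; apply: (cp e eE x y z) => //; exact: ltnW.
pose q x := #|[set y | r y < r x]|.
have mono x y : r x < r y -> q x < q y.
  move=> h; apply: proper_card; apply/properP; split; last by exists x; rewrite inE ?ltnn.
  by apply/subsetP => z; rewrite !inE => h'; apply: ltn_trans h' h.
have qn x : q x < n.
  rewrite -[X in _ < X]card_ord -cardsT; apply: proper_card; apply/properP; split; first exact: subsetT.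
  by exists x; rewrite inE ?ltnn.
have iq : injective (fun x => Ordinal (qn x)).
  move=> x y /(congr1 val) /= E'; apply: ir; apply/eqP; case: ltngtP => // /mono; by rewrite E' ltnn.
exists (perm iq) => e eE x y z xe ye; rewrite !permE /=.
have le a b : q a <= q b -> r a <= r b by move=> h; rewrite leqNgt; apply: contraL h => /mono; rewrite -ltnNge.
move=> /le; rewrite leq_eqVlt => /orP[/eqP/ir <- //|h1].
move=> /le; rewrite leq_eqVlt => /orP[/eqP/ir -> //|h2].
exact: (cr e eE x y).
Qed.

(** * A while language compiled to the machine *)

(* A state consists of infinitely many arrays [arr k], all of them stored
   interleaved in the memory, and of a bounded block of raw memory cells. *)
Inductive expr := Cst of nat | Arr of nat & expr | Raw of expr
  | Add of expr & expr | Sub of expr & expr.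

(** [For k e c] evaluates [e] once and shows the counter to its body in entry 0 of array [k]. There
    is no other loop, so every command terminates. *)
Inductive cmd := Skip | SetA of nat & expr & expr | SetRaw of expr & expr
  | Seq of cmd & cmd | If of expr & cmd & cmd | For of nat & expr & cmd.

Record state := State { arr : nat -> nat -> nat; raw : nat -> nat }.

Definition set_arr s k i v :=
  State (fun k' i' => if (k' == k) && (i' == i) then v else arr s k' i') (raw s).

Definition set_raw s i v := State (arr s) (fun j => if j == i then v else raw s j).

Section Semantics.
Variables (W D : nat).

(** Indices into the raw block are clamped to [D], so no access can leave the block. *)
Fixpoint eval (s : state) (e : expr) : nat :=
  match e with
  | Cst n => n
  | Arr k e => arr s k (eval s e)
  | Raw e => raw s (minn (eval s e) D)
  | Add a b => eval s a + eval s b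
  | Sub a b => eval s a - eval s b
  end.

Fixpoint esize e := match e with
  | Cst _ => 1
  | Arr _ e => esize e + (W + 4) + 1
  | Raw e => esize e + 3
  | Add a b | Sub a b => esize a + esize b + 1
  end.

(** The 8 extra steps are the loop test, three instructions that publish the counter, and four that
    update the registers and jump back. *)
Definition iterate (f : state -> state * nat) (k : nat) (i : nat) (p : state * nat) :=
  let q := f (set_arr p.1 k 0 i) in (q.1, p.2 + q.2 + 8).

(** The second component is the exact number of machine steps of the compiled code. *)
Fixpoint exec c (s : state) : state * nat :=
  match c with
  | Skip => (s, 0)
  | SetA k a b => (set_arr s k (eval s a) (eval s b), esize a + (W + 4) + esize b + 1)
  | SetRaw a b => (set_raw s (minn (eval s a) D) (eval s b), esize a + 2 + esize b + 1)
  | Seq c1 c2 => let p := exec c1 s in let q := exec c2 p.1 in (q.1, p.2 + q.2)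
  | If e c1 c2 => if eval s e == 0 then let q := exec c2 s in (q.1, esize e + 1 + q.2)
                  else let q := exec c1 s in (q.1, esize e + 1 + q.2 + 1)
  | For k e c => let q := iteri (eval s e) (iterate (exec c) k) (s, 0) in (q.1, esize e + 1 + q.2 + 1)
  end.

End Semantics.

(** * Translation to machine code and its correctness *)

Section Compiler.
Variables (W : nat).

(** Turns the index in register [s] into a memory address; [W] additions replace the multiplication
    that the machine does not have. *)
Definition address k s := IConst s.+1 0 :: nseq W (IAdd s.+1 s.+1 s) ++
  [:: IConst s k; IAdd s s s.+1; IAdd s s 0].

(** For [Raw], the cells 1 and 2 hold [D] and [Z + D]; the truncated difference [Z + D - (D - i)] is
    [Z + minn i D], which is the clamping in [eval]. *)
Fixpoint ecode e s := match e with
  | Cst n => [:: IConst s n]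
  | Arr k e => ecode e s ++ address k s ++ [:: ILoad s s]
  | Raw e => ecode e s ++ [:: ISub s 1 s; ISub s 2 s; ILoad s s]
  | Add a b => ecode a s ++ ecode b s.+1 ++ [:: IAdd s s s.+1]
  | Sub a b => ecode a s ++ ecode b s.+1 ++ [:: ISub s s s.+1]
  end.

Fixpoint csize c := match c with
  | Skip => 0
  | SetA k a b => esize W a + (W + 4) + esize W b + 1
  | SetRaw a b => esize W a + 2 + esize W b + 1
  | Seq c1 c2 => csize c1 + csize c2
  | If e c1 c2 => esize W e + 1 + csize c1 + 1 + csize c2
  | For _ e c => esize W e + 1 + 4 + csize c + 4
  end.

(** Jump targets are absolute, hence the argument [pc]. Registers from [s] on are free; a loop keeps
    the number of remaining iterations in [s] and its counter in [s.+1], out of reach of the body,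
    which starts at [s.+2]. *)
Fixpoint ccode c pc s := match c with
  | Skip => [::]
  | SetA k a b => ecode a s ++ address k s ++ ecode b s.+1 ++ [:: IStore s s.+1]
  | SetRaw a b => ecode a s ++ [:: ISub s 1 s; ISub s 2 s] ++ ecode b s.+1 ++ [:: IStore s s.+1]
  | Seq c1 c2 => ccode c1 pc s ++ ccode c2 (pc + csize c1) s
  | If e c1 c2 => ecode e s ++ [:: IJz s (pc + (esize W e + 1 + csize c1 + 1))] ++
      ccode c1 (pc + (esize W e + 1)) s ++ [:: IJmp (pc + csize (If e c1 c2))] ++
      ccode c2 (pc + (esize W e + 1 + csize c1 + 1)) s
  | For k e c => let l := pc + (esize W e + 1) in
      ecode e s ++ [:: IConst s.+1 0] ++
      [:: IJz s (pc + csize (For k e c)); IConst s.+2 k; IAdd s.+2 s.+2 0; IStore s.+2 s.+1] ++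
      ccode c (l + 4) s.+2 ++
      [:: IConst s.+2 1; IAdd s.+1 s.+1 s.+2; ISub s s s.+2; IJmp l]
  end.

Lemma size_ecode e s : size (ecode e s) = esize W e.
Proof.
elim: e s => [n|k e IH|e IH|a IHa b IHb|a IHa b IHb] s //=; rewrite !size_cat ?IH ?IHa ?IHb //= ?addnA //.
by rewrite ?size_cat ?size_nseq /=; lia.
Qed.

Lemma size_ccode c pc s : size (ccode c pc s) = csize c.
Proof.
elim: c pc s => [|k a b|a b|c1 IH1 c2 IH2|e c1 IH1 c2 IH2|k e c IH] pc s //=.
- by do !rewrite ?size_cat ?size_ecode ?size_nseq /=; lia.
- by do !rewrite ?size_cat ?size_ecode /=; lia.
- by rewrite size_cat IH1 IH2.
- by do !rewrite ?size_cat ?size_ecode ?IH1 ?IH2 /=; lia.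
- by do !rewrite ?size_cat ?size_ecode ?IH /=; lia.
Qed.

(** The number of registers, counted from [s], that the code may overwrite. *)
Fixpoint eneed e := match e with
  | Cst _ => 1
  | Arr _ e => maxn 2 (eneed e)
  | Raw e => eneed e
  | Add a b | Sub a b => maxn (eneed a) (eneed b).+1
  end.

Fixpoint cneed c := match c with
  | Skip => 0
  | SetA _ a b | SetRaw a b => maxn (maxn 2 (eneed a)) (eneed b).+1
  | Seq c1 c2 => maxn (cneed c1) (cneed c2)
  | If e c1 c2 => maxn (eneed e) (maxn (cneed c1) (cneed c2))
  | For _ e c => maxn (eneed e) (maxn 3 (cneed c).+2)
  end.

Fixpoint ewf e := match e with
  | Cst _ => true
  | Arr k e => (k < W) && ewf e
  | Raw e => ewf e
  | Add a b | Sub a b => ewf a && ewf b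
  end.

Fixpoint cwf c := match c with
  | Skip => true
  | SetA k a b => [&& k < W, ewf a & ewf b]
  | SetRaw a b => ewf a && ewf b
  | Seq c1 c2 => cwf c1 && cwf c2
  | If e c1 c2 => [&& ewf e, cwf c1 & cwf c2]
  | For k e c => [&& k < W, ewf e & cwf c]
  end.

Definition step_line (M : memory) i := match i with
  | IConst i c => upd M i c
  | IAdd i j k => upd M i (M j + M k)
  | ISub i j k => upd M i (M j - M k)
  | ILoad i j => upd M i (M (M j))
  | IStore i j => upd M (M i) (M j)
  | _ => M
  end.

Definition is_line i := match i with IJz _ _ | IJmp _ | IHalt => false | _ => true end.

Definition embedded (P : program) pc (code : seq instr) :=
  forall i, i < size code -> nth IHalt P (pc + i) = nth IHalt code i.

(** Stated for all remaining fuel, so that the step counts of consecutive pieces of code add up. *)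
Definition reaches P t pc M pc' M' := forall fuel, run P (t + fuel) pc M = run P fuel pc' M'.

Lemma reaches_trans P t t' pc M pc' M' pc'' M'' : reaches P t pc M pc' M' ->
  reaches P t' pc' M' pc'' M'' -> reaches P (t + t') pc M pc'' M''.
Proof. by move=> h1 h2 fuel; rewrite -addnA h1 h2. Qed.

Lemma embedded_cat P pc c1 c2 : embedded P pc (c1 ++ c2) ->
  embedded P pc c1 /\ embedded P (pc + size c1) c2.
Proof.
move=> h; split=> i hi.
  by rewrite h ?nth_cat ?hi // size_cat; lia.
by rewrite -addnA h ?size_cat ?ltn_add2l // nth_cat ltnNge leq_addr /= addKn.
Qed.

Lemma reaches_line P pc M code : all is_line code -> embedded P pc code ->
  reaches P (size code) pc M (pc + size code) (foldl step_line M code).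
Proof.
elim: code pc M => [|i code IH] pc M /=; first by move=> _ _ fuel; rewrite addn0.
move=> /andP[li lc] em fuel.
have := em 0 isT; rewrite addn0 /= => ei.
have em' : embedded P pc.+1 code by move=> j hj; have := em j.+1; rewrite addnS -addSn => ->.
by rewrite addnS -addSn -(IH pc.+1 (step_line M i) lc em') /= ei; case: i li {em ei}.
Qed.

Lemma lines_ecode e s : all is_line (ecode e s).
Proof.
have ha k : all is_line (address k s) by rewrite /= all_cat all_nseq orbT.
elim: e s ha => [n|k e IH|e IH|a IHa b IHb|a IHa b IHb] s ha //=.
- rewrite all_cat IH //= all_cat all_cat all_nseq orbT //.
- by rewrite all_cat IH.
- rewrite all_cat IHa //= all_cat IHb // => k; by rewrite /= all_cat all_nseq orbT.
- rewrite all_cat IHa //= all_cat IHb // => k; by rewrite /= all_cat all_nseq orbT.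
Qed.

Section Simulation.
Variables (Z D : nat).
Let R := Z + D.+1.

(** Memory layout: registers below [Z], the raw block from [Z] to [Z + D], then the [W] arrays
    interleaved from [R] on. Cells 0, 1, 2 hold the constants needed to form addresses. *)
Definition simulates (M : memory) (s : state) :=
  [/\ 3 <= Z, M 0 = R, M 1 = D, M 2 = Z + D &
   (forall k i, k < W -> M (R + i * W + k) = arr s k i) /\
   (forall i, i <= D -> M (Z + i) = raw s i)].

Definition agree_off (a b : nat) (M M' : memory) := forall j, ~~ (a <= j < b) -> M' j = M j.

Lemma agree_trans a a' b M M' M'' : a <= a' -> agree_off a b M M' -> agree_off a' b M' M'' -> agree_off a b M M''.
Proof. by move=> aa h1 h2 j hj; rewrite h2 ?h1 //; apply: contra hj => /andP[h ->]; rewrite (leq_trans aa h). Qed.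

Lemma simulates_off a M M' s : 3 <= a -> agree_off a Z M M' -> simulates M s -> simulates M' s.
Proof.
move=> ha ag [Z3 h0 h1 h2 [h3 h4]].
have agl j : j < 3 -> M' j = M j by move=> hj; apply: ag; lia.
have agh j : Z <= j -> M' j = M j by move=> hj; apply: ag; lia.
split=> //; try by rewrite agl.
split=> [k i kW|i iD]; rewrite agh ?h3 ?h4 // /R; lia.
Qed.

Lemma agree_upd a b M j v : a <= j -> j < b -> agree_off a b M (upd M j v).
Proof. by move=> h1 h2 l; rewrite /upd; case: eqP => // ->; rewrite h1 h2. Qed.

Lemma address_correct k s M : 3 <= s -> s.+1 < Z -> M 0 = R ->
  let M' := foldl step_line M (address k s) in
  M' s = R + M s * W + k /\ agree_off s Z M M'.
Proof.
move=> s3 sZ M0 /=; rewrite foldl_cat.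
set M1 := foldl _ _ (nseq W _).
have [h1 h2 h3] : [/\ M1 s.+1 = W * M s, M1 s = M s & forall j, j != s.+1 -> M1 j = M j].
  have H N n : N s = M s -> (forall j, j != s.+1 -> N j = M j) ->
      let N' := foldl step_line N (nseq n (IAdd s.+1 s.+1 s)) in
      [/\ N' s.+1 = N s.+1 + n * M s, N' s = M s & forall j, j != s.+1 -> N' j = M j].
    elim: n N => [|n IH] N Ns Nj /=; first by rewrite mul0n addn0.
    have [||a b c] := IH (upd N s.+1 (N s.+1 + N s)).
    - by rewrite /upd ifF //; lia.
    - by move=> j /[dup] h /negbTE hj; rewrite /upd hj; apply: Nj.
    by split=> //; rewrite a /upd eqxx Ns mulSn addnA.
  have [||a b c] := H (upd M s.+1 0) W.
  - by rewrite /upd ifF //; lia.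
  - by move=> j /negbTE hj; rewrite /upd hj.
  by split=> //; rewrite /M1 a /upd eqxx.
have e01 : (0 == s) = false by lia.
have e02 : (s.+1 == s) = false by lia.
rewrite /= /upd !eqxx e01 e02 h1 h3 ?M0; last by lia.
split; first by lia.
move=> j hj; have -> : (j == s) = false by apply: contraNF hj => /eqP->; lia.
by rewrite h3 //; apply: contraNneq hj => ->; lia.
Qed.

Lemma ecode_correct e s M st : 3 <= s -> s + eneed e <= Z -> ewf e -> simulates M st ->
  let M' := foldl step_line M (ecode e s) in
  M' s = eval D st e /\ agree_off s Z M M'.
Proof.
elim: e s M => [n|k e IH|e IH|a IHa b IHb|a IHa b IHb] s M s3.
- move=> /= hs _ sim; rewrite /upd eqxx; split=> //; apply: agree_upd; lia.
- move=> /= hs /andP[kW we] sim; rewrite foldl_cat.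
  have [h1 h2] := IH s M s3 ltac:(lia) we sim; set M1 := foldl _ M _ in h1 h2 *.
  have [Z3 M0 _ _ [har _]] := simulates_off s3 h2 sim.
  rewrite -cat_cons foldl_cat -/(address k s).
  have [h3 h4] := address_correct k s3 (M := M1) ltac:(lia) M0; set M2 := foldl _ M1 _ in h3 h4 *.
  rewrite /= /upd eqxx h3 h1; split.
    rewrite h4 ?har // /R; lia.
  move=> j hj; have -> : (j == s) = false by apply: contraNF hj => /eqP->; lia.
  by rewrite h4 // h2.
- move=> /= hs we sim; rewrite foldl_cat.
  have [h1 h2] := IH s M s3 hs we sim; set M1 := foldl _ M _ in h1 h2 *.
  have [Z3 _ M11 M12 [_ hraw]] := simulates_off s3 h2 sim.
  have en : 0 < eneed e by elim: (e) => //= *; lia.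
  have e2 : (2 == s) = false by lia.
  rewrite /= /upd !eqxx e2 h1 M11 M12; split.
    rewrite -hraw ?geq_minr // ifF; last by lia.
    rewrite ifF; last by lia.
    congr M1; lia.
  by move=> j hj; have -> : (j == s) = false; [apply: contraNF hj => /eqP->; lia | exact: h2].
- move=> /= hs /andP[wa wb] sim; rewrite foldl_cat.
  have [h1 h2] := IHa s M s3 ltac:(lia) wa sim; set M1 := foldl _ M _ in h1 h2 *.
  have sim1 := simulates_off s3 h2 sim.
  rewrite foldl_cat.
  have [h3 h4] := IHb s.+1 M1 ltac:(lia) ltac:(lia) wb sim1; set M2 := foldl _ M1 _ in h3 h4 *.
  rewrite /= /upd eqxx h3 (h4 s) ?h1; last by lia.
  split=> // j hj; have -> : (j == s) = false by apply: contraNF hj => /eqP->; lia.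
  by rewrite h4 ?h2 //; lia.
- move=> /= hs /andP[wa wb] sim; rewrite foldl_cat.
  have [h1 h2] := IHa s M s3 ltac:(lia) wa sim; set M1 := foldl _ M _ in h1 h2 *.
  have sim1 := simulates_off s3 h2 sim.
  rewrite foldl_cat.
  have [h3 h4] := IHb s.+1 M1 ltac:(lia) ltac:(lia) wb sim1; set M2 := foldl _ M1 _ in h3 h4 *.
  rewrite /= /upd eqxx h3 (h4 s) ?h1; last by lia.
  split=> // j hj; have -> : (j == s) = false by apply: contraNF hj => /eqP->; lia.
  by rewrite h4 ?h2 //; lia.
Qed.

Lemma cell_inj i k i' k' : k < W -> k' < W -> R + i * W + k = R + i' * W + k' -> i = i' /\ k = k'.
Proof.
move=> kW kW' h0; have h : i * W + k = i' * W + k' by lia.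
have E : i = i'.
  have W0 : 0 < W by lia.
  by have := congr1 (divn^~ W) h; rewrite !divnMDl // !divn_small // !addn0.
by split=> //; move: h; rewrite E; lia.
Qed.

Lemma simulates_set M s k i v : simulates M s -> k < W ->
  simulates (upd M (R + i * W + k) v) (set_arr s k i v).
Proof.
move=> [Z3 h0 h1 h2 [h3 h4]] kW; rewrite /upd; split=> //; try by rewrite ifF // /R; lia.
split=> [k' i' kW'|j jD] /=; last by rewrite ifF ?h4 // /R; lia.
case: eqP => [/(cell_inj kW' kW)[-> ->]|n]; first by rewrite !eqxx.
rewrite h3 // ifF //; apply/negP => /andP[/eqP ek /eqP ei]; by apply: n; rewrite ek ei.
Qed.

Lemma simulates_set_raw M s i v : simulates M s -> i <= D ->
  simulates (upd M (Z + i) v) (set_raw s i v).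
Proof.
move=> [Z3 h0 h1 h2 [h3 h4]] iD; rewrite /upd; split=> //; try by rewrite ifF // /R; lia.
split=> [k' i' kW'|j jD] /=; first by rewrite ifF ?h3 // /R; lia.
by rewrite eqn_add2l h4.
Qed.

Lemma run_jump P pc M i l : nth IHalt P pc = IJz i l -> reaches P 1 pc M (if M i == 0 then l else pc.+1) M.
Proof. by move=> h fuel; rewrite /= h. Qed.

Lemma run_goto P pc M l : nth IHalt P pc = IJmp l -> reaches P 1 pc M l M.
Proof. by move=> h fuel; rewrite /= h. Qed.

Lemma embedded_head P pc i code : embedded P pc (i :: code) -> nth IHalt P pc = i.
Proof. by move=> /(_ 0 isT); rewrite addn0. Qed.

(** The last clause protects the registers below [s], where the enclosing loops keep their
    counters. *)
Lemma ccode_correct P c pc s M st : 3 <= s -> s + cneed c <= Z -> cwf c -> simulates M st ->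
  embedded P pc (ccode c pc s) ->
  exists M', [/\ reaches P (exec W D c st).2 pc M (pc + csize c) M', simulates M' (exec W D c st).1 &
    forall j, 3 <= j < s -> M' j = M j].
Proof.
elim: c pc s M st => [|k a b|a b|c1 IH1 c2 IH2|e c1 IH1 c2 IH2|k e c IH] pc s M st s3.
- by move=> _ _ sim _; exists M; split=> // fuel; rewrite /= addn0.
- move=> /= hs /and3P[kW wa wb] sim em.
  set code := _ ++ _ in em.
  have line : all is_line code.
    by rewrite /code all_cat lines_ecode /= !all_cat all_nseq orbT lines_ecode.
  exists (foldl step_line M code).
  have sz : size code = esize W a + (W + 4) + esize W b + 1.
    by have := size_ccode (SetA k a b) pc s.
  rewrite -sz; split; first exact: reaches_line.
    rewrite /code foldl_cat -cat_cons foldl_cat -/(address k s) foldl_cat.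
    have [h1 h2] := ecode_correct s3 (e := a) ltac:(lia) wa sim; set M1 := foldl _ M _ in h1 h2 *.
    have sim1 := simulates_off s3 h2 sim; case: (sim1) => _ M10 _ _ _.
    have [h3 h4] := address_correct k s3 (M := M1) ltac:(lia) M10; set M2 := foldl _ M1 _ in h3 h4 *.
    have sim2 := simulates_off s3 h4 sim1.
    have [h5 h6] := @ecode_correct b s.+1 M2 st ltac:(lia) ltac:(lia) wb sim2; set M3 := foldl _ M2 _ in h5 h6 *.
    have sim3 := simulates_off (a := s.+1) ltac:(lia) h6 sim2.
    rewrite /= h5 (h6 s); last by lia.
    by rewrite h3 h1; apply: simulates_set.
  move=> j hj; rewrite /code foldl_cat -cat_cons foldl_cat -/(address k s) foldl_cat.
  have [h1 h2] := ecode_correct s3 (e := a) ltac:(lia) wa sim; set M1 := foldl _ M _ in h1 h2 *.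
  have sim1 := simulates_off s3 h2 sim; case: (sim1) => _ M10 _ _ _.
  have [h3 h4] := address_correct k s3 (M := M1) ltac:(lia) M10; set M2 := foldl _ M1 _ in h3 h4 *.
  have sim2 := simulates_off s3 h4 sim1.
  have [h5 h6] := @ecode_correct b s.+1 M2 st ltac:(lia) ltac:(lia) wb sim2; set M3 := foldl _ M2 _ in h5 h6 *.
  rewrite /= (h6 s); last by lia.
  rewrite h3 /upd ifF; last by rewrite /R; lia.
  by rewrite h6 ?h4 ?h2 //; lia.
- move=> /= hs /andP[wa wb] sim em.
  set code := _ ++ _ in em.
  have line : all is_line code.
    by rewrite /code all_cat lines_ecode /= all_cat lines_ecode.
  exists (foldl step_line M code).
  have sz : size code = esize W a + 2 + esize W b + 1.
    by have := size_ccode (SetRaw a b) pc s.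
  rewrite -sz.
  have [h1 h2] := ecode_correct s3 (e := a) ltac:(lia) wa sim.
  have E : foldl step_line M code = foldl step_line (foldl step_line (foldl step_line M (ecode a s))
      [:: ISub s 1 s; ISub s 2 s]) (ecode b s.+1 ++ [:: IStore s s.+1]) by rewrite /code foldl_cat.
  rewrite E; set M1 := foldl _ M _ in h1 h2 *.
  have sim1 := simulates_off s3 h2 sim; case: (sim1) => _ _ M11 M12 _.
  set M2 := foldl _ M1 _.
  have h3 : M2 s = Z + minn (eval D st a) D.
    have e2 : (2 == s) = false by lia.
    rewrite /M2 /= /upd !eqxx e2 h1 M11 M12; lia.
  have h4 : agree_off s Z M1 M2.
    by apply: (@agree_trans s s Z M1 (upd M1 s (M1 1 - M1 s))) => //; apply: agree_upd; lia.
  have sim2 := simulates_off s3 h4 sim1.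
  rewrite foldl_cat.
  have [h5 h6] := @ecode_correct b s.+1 M2 st ltac:(lia) ltac:(lia) wb sim2; set M3 := foldl _ M2 _ in h5 h6 *.
  have sim3 := simulates_off (a := s.+1) ltac:(lia) h6 sim2.
  have E3 : foldl step_line M3 [:: IStore s s.+1] = upd M3 (Z + minn (eval D st a) D) (eval D st b).
    by rewrite /= h5 (h6 s) ?h3 //; lia.
  split.
  + have := reaches_line M line em; rewrite E foldl_cat; exact.
  + rewrite E3; apply: simulates_set_raw => //; exact: geq_minr.
  + move=> j hj; rewrite E3 /upd ifF; last by lia.
    by rewrite h6 ?h4 ?h2 //; lia.
- move=> /= hs /andP[w1 w2] sim /embedded_cat[em1]; rewrite size_ccode => em2.
  have [M1 [r1 sim1 k1]] := IH1 pc s M st s3 ltac:(lia) w1 sim em1.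
  have [M2 [r2 sim2 k2]] := IH2 _ s M1 _ s3 ltac:(lia) w2 sim1 em2.
  exists M2; split=> //; first by rewrite addnA; apply: reaches_trans r1 r2.
  by move=> j hj; rewrite k2 // k1.
- rewrite [cneed _]/= [cwf _]/= => hs /and3P[we w1 w2] sim em.
  have {em} : embedded P pc (ecode e s ++ [:: IJz s (pc + (esize W e + 1 + csize c1 + 1))] ++
      ccode c1 (pc + (esize W e + 1)) s ++ [:: IJmp (pc + csize (If e c1 c2))] ++
      ccode c2 (pc + (esize W e + 1 + csize c1 + 1)) s) := em.
  move=> /embedded_cat[em0 /embedded_cat[em1 /embedded_cat[em2 /embedded_cat[em3 em4]]]].
  rewrite !size_ecode ?size_ccode [size [:: _]]/= in em1 em2 em3 em4.
  have [h1 h2] := ecode_correct s3 (e := e) ltac:(lia) we sim.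
  have r0 := reaches_line M (lines_ecode e s) em0.
  rewrite size_ecode in r0; set M1 := foldl _ M _ in h1 h2 r0.
  have sim1 := simulates_off s3 h2 sim.
  have r1 := run_jump M1 (embedded_head em1).
  have low j : 3 <= j < s -> M1 j = M j by move=> hj; apply: h2; lia.
  rewrite h1 in r1; rewrite [exec _ _ _ _]/=; case: eqP r1 => ev r1.
    rewrite -!addnA in em4 r1.
    have [M2 [r2 sim2 k2]] := IH2 (pc + (esize W e + 1 + csize c1 + 1)) s M1 st s3 ltac:(lia) w2 sim1
      ltac:(by move: em4; rewrite -!addnA).
    exists M2; split=> //; last by move=> j hj; rewrite k2 // low.
    apply: reaches_trans; first exact: reaches_trans r0 r1.
    by move: r2; rewrite /= -!addnA.
  rewrite -addnS -addn1 in r1.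
  have [M2 [r2 sim2 k2]] := IH1 (pc + (esize W e + 1)) s M1 st s3 ltac:(lia) w1 sim1
      ltac:(by move: em2; rewrite -!addnA).
  have r3 := run_goto M2 (embedded_head em3).
  exists M2; split=> //; last by move=> j hj; rewrite k2 // low.
  apply: reaches_trans; last exact: r3.
  apply: reaches_trans; first exact: reaches_trans r0 r1.
  by move: r2; rewrite -!addnA addn1.
- rewrite [cneed _]/= [cwf _]/= => hs /and3P[kW we wc] sim em.
  have {em} : embedded P pc (ecode e s ++ [:: IConst s.+1 0] ++
      [:: IJz s (pc + csize (For k e c)); IConst s.+2 k; IAdd s.+2 s.+2 0; IStore s.+2 s.+1] ++
      ccode c (pc + (esize W e + 1) + 4) s.+2 ++
      [:: IConst s.+2 1; IAdd s.+1 s.+1 s.+2; ISub s s s.+2; IJmp (pc + (esize W e + 1))]) := em.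
  move=> /embedded_cat[em0 /embedded_cat[em1 /embedded_cat[em2 /embedded_cat[em3 em4]]]].
  rewrite !size_ecode ?size_ccode [size [:: _]]/= in em1 em2 em3 em4.
  have [h1 h2] := ecode_correct s3 (e := e) ltac:(lia) we sim.
  have r0 := reaches_line M (lines_ecode e s) em0.
  rewrite size_ecode in r0; set M1 := foldl _ M _ in h1 h2 r0.
  have sim1 := simulates_off s3 h2 sim.
  have low j : 3 <= j < s -> M1 j = M j by move=> hj; apply: h2; lia.
  have r1 := reaches_line M1 (code := [:: IConst s.+1 0]) isT em1.
  set M2 := foldl _ _ _ in r1.
  have M2s : M2 s = eval D st e by rewrite /M2 /= /upd ifF ?h1 //; lia.
  have M2s1 : M2 s.+1 = 0 by rewrite /M2 /= /upd eqxx.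
  have ag2 : agree_off s Z M1 M2 by apply: agree_upd; lia.
  have sim2 := simulates_off s3 ag2 sim1.
  set l := pc + (esize W e + 1) in em3 em4 *.
  have el : pc + esize W e + 1 = l by rewrite /l addnA.
  rewrite el in em2 em3 em4; rewrite /= el in r1.
  (* after [i] iterations the cell [s] counts the remaining ones *)
  have loop i : i <= eval D st e -> let q := iteri i (iterate (exec W D c) k) (st, 0) in
    exists N, [/\ reaches P q.2 l M2 l N, simulates N q.1, N s = eval D st e - i, N s.+1 = i &
      forall j, 3 <= j < s -> N j = M2 j].
    elim: i => [|i IHi] hi; first by exists M2; rewrite subn0.
    have [N [rN simN Ns Ns1 lowN]] := IHi (ltnW hi).
    set q := iteri i _ _ in rN simN; rewrite [iteri _ _ _]/= -/q /iterate /=.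
    have j1 := run_jump N (embedded_head em2); rewrite Ns subn_eq0 leqNgt hi /= in j1.
    have em2' : embedded P l.+1 [:: IConst s.+2 k; IAdd s.+2 s.+2 0; IStore s.+2 s.+1].
      by move=> a ha; have := em2 a.+1; rewrite addnS -addSn => ->.
    have j2 := reaches_line N (code := [:: IConst s.+2 k; IAdd s.+2 s.+2 0; IStore s.+2 s.+1]) isT em2'.
    case: (simN) => _ N0 _ _ _.
    set N1 := foldl _ _ _ in j2.
    have EN1 : N1 = upd (upd (upd N s.+2 k) s.+2 (k + R)) (R + 0 * W + k) i.
      rewrite /N1 /= /upd !eqxx N0 /= (_ : (s.+1 == s.+2) = false) ?Ns1; last by lia.
      by rewrite addn0 addnC.
    have agN : agree_off s.+2 Z N (upd (upd N s.+2 k) s.+2 (k + R)).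
      by apply: (@agree_trans s.+2 s.+2 Z N (upd N s.+2 k)) => //; apply: agree_upd; lia.
    have sim' := simulates_off (a := s.+2) ltac:(lia) agN simN.
    have simN1 : simulates N1 (set_arr q.1 k 0 i) by rewrite EN1; apply: simulates_set.
    have [N2 [j3 simN2 lowN2]] := IH (l + 4) s.+2 N1 _ ltac:(lia) ltac:(lia) wc simN1 em3.
    set p := exec W D c _ in j3 simN2 *.
    have j4 := reaches_line N2 (code := [:: IConst s.+2 1; IAdd s.+1 s.+1 s.+2; ISub s s s.+2]) isT
      (proj1 (@embedded_cat P (l + 4 + csize c) [:: IConst s.+2 1; IAdd s.+1 s.+1 s.+2; ISub s s s.+2] [:: IJmp l] em4)).
    set N3 := foldl _ _ _ in j4.
    have := proj2 (@embedded_cat P (l + 4 + csize c) [:: IConst s.+2 1; IAdd s.+1 s.+1 s.+2; ISub s s s.+2] [:: IJmp l] em4).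
    move=> /embedded_head/(run_goto N3) j5.
    have n2 a : 3 <= a < s.+2 -> N2 a = N a.
      move=> ha; rewrite lowN2 // EN1 /upd ifF; last by rewrite /R; lia.
      by do 2 (rewrite ifF; last by lia).
    have ag3 : agree_off s Z N2 N3.
      move=> a ha; rewrite /N3 /= /upd; do 3 (rewrite ifF; last by apply: contraNF ha => /eqP->; lia); by [].
    exists N3; split.
    + have -> : q.2 + p.2 + 8 = q.2 + (1 + (3 + (p.2 + (3 + 1)))) by lia.
      apply: reaches_trans rN _; apply: reaches_trans j1 _; apply: reaches_trans j2 _.
      by rewrite (_ : l.+1 + _ = l + 4) /=; [apply: reaches_trans j3 _; apply: reaches_trans j4 j5 | lia].
    + exact: simulates_off s3 ag3 simN2.
    + rewrite /N3 /= /upd !eqxx; do ?(rewrite ifF; last by lia).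
      rewrite n2 ?Ns; last by lia. by rewrite subn1 subnS.
    + rewrite /N3 /= /upd !eqxx; do ?(rewrite ifF; last by lia).
      rewrite n2 ?Ns1; last by lia. by rewrite addn1.
    + move=> a ha; rewrite ag3; last by lia. by rewrite n2 ?lowN //; lia.
  have [N [rN simN Ns Ns1 lowN]] := loop _ (leqnn _).
  have j1 := run_jump N (embedded_head em2); rewrite Ns subnn /= in j1.
  exists N; split.
  + rewrite [exec _ _ _ _]/=; set q := iteri _ _ _ in rN *; rewrite [_.2]/=.
    apply: reaches_trans; last exact: j1.
    apply: reaches_trans; last exact: rN.
    exact: reaches_trans r0 r1.
  + by [].
  + move=> j hj; rewrite lowN // /M2 /= /upd ifF ?low //; lia.
Qed.

End Simulation.
End Compiler.

Lemma run_halt P f pc M : nth IHalt P pc = IHalt -> run P f.+1 pc M = Some M.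
Proof. by move=> /= ->. Qed.

(** * Saving the input and restoring the output around compiled code *)

Section Program.
Variables (W Z q : nat).
Hypotheses (W1 : 1 < W) (Z3 : 3 <= Z).

(* Cells below [Z] are the machine's registers; their input contents are first
   saved in array 1, and array 0 is finally copied back to them. *)
Definition prologue := IConst 0 (Z + 3 + W + 1) :: nseq q (IAdd 0 0 1) ++
  [:: IStore 0 1; IConst 1 W] ++ flatten [seq [:: IAdd 0 0 1; IStore 0 j] | j <- iota 2 (Z - 2)] ++
  [:: IConst 1 ((Z - 1) * W + 1); ISub 0 0 1; IConst 2 1; ISub 2 0 2; IConst 1 Z; ISub 1 2 1].

Definition epilogue := flatten [seq [:: IConst j (j * W); IAdd j j 0; ILoad j j] | j <- iota 1 (Z - 1)] ++
  [:: ILoad 0 0].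

Definition compile c := prologue ++ ccode W c (size prologue) 3 ++ epilogue ++ [:: IHalt].

(** Array 1 holds the saved input cells below [Z]; the rest of the input stays in place and becomes
    the raw block. *)
Definition initial (I : memory) :=
  State (fun k i => if (k == 1) && (0 < i < Z) then I i else 0) (fun e => I (Z + e)).

(** [Z + 3 + W + 1] plus [q * m] is [R + W + 1], the address of entry 1 of array 1. From the last
    address used, subtracting [(Z - 1) * W + 1] recovers [R]; then [R - 1] is [Z + D], and
    subtracting [Z] gives [D]. *)
Lemma prologue_correct (I : memory) m : I 1 = m -> (forall a, Z + q * m + 3 <= a -> I a = 0) ->
  simulates W Z (q * m + 2) (foldl step_line I prologue) (initial I).
Proof.
move=> I1 I0; set D := q * m + 2; pose R := Z + D.+1.
rewrite /prologue -cat1s !foldl_cat.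
set M1 := foldl _ _ (nseq q _).
have [h0 h1] : M1 0 = R + W + 1 /\ forall j, 0 < j -> M1 j = I j.
  have H n N : (forall j, 0 < j -> N j = I j) ->
     let N' := foldl step_line N (nseq n (IAdd 0 0 1)) in N' 0 = N 0 + n * m /\ forall j, 0 < j -> N' j = I j.
    elim: n N => [|n IH] N hN /=; first by rewrite mul0n addn0.
    have [|a b] := IH (upd N 0 (N 0 + N 1)).
      by move=> j j0; rewrite /upd ifF ?hN //; lia.
    by split=> //; rewrite a /upd eqxx (hN 1) // I1 mulSn addnA.
  have [|a b] := H q (upd I 0 (Z + 3 + W + 1)).
    by move=> j j0; rewrite /upd ifF //; lia.
  by split=> //; rewrite [M1 0]a /upd eqxx /R /D; lia.
set M2 := foldl step_line M1 [:: IStore 0 1; IConst 1 W].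
pose inv t (N : memory) := [/\ N 0 = R + (t - 1) * W + 1, N 1 = W,
  forall i, 0 < i < t -> N (R + i * W + 1) = I i &
  forall c, 1 < c -> (forall i, 0 < i < t -> c != R + i * W + 1) -> N c = I c].
have inv2 : inv 2 M2.
  split; rewrite /M2 /= /upd /=.
  - by rewrite h0 ifF; lia.
  - by [].
  - move=> i hi; have -> : i = 1 by lia.
    by rewrite h0 ifF ?ifT ?h1 //; lia.
  - move=> c c1 hc; rewrite ifF; last by lia.
    by rewrite h0 ifF ?h1 //; have := hc 1 isT; lia.
have invZ : inv Z (foldl step_line M2 (flatten [seq [:: IAdd 0 0 1; IStore 0 j] | j <- iota 2 (Z - 2)])).
  have H n : 2 + n <= Z -> inv (2 + n) (foldl step_line M2 (flatten [seq [:: IAdd 0 0 1; IStore 0 j] | j <- iota 2 n])).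
    elim: n => [|n IH] hn; first exact: inv2.
    have {IH} := IH ltac:(lia).
    rewrite -(addn1 n) iotaD map_cat flatten_cat foldl_cat.
    set N := foldl _ M2 _ => -[n0 n1 n2 n3].
    have Nt : N (2 + n) = I (2 + n) by apply: n3 => // i hi; rewrite /R; lia.
    have E : foldl step_line N [:: IAdd 0 0 1; IStore 0 (2 + n)] = upd (upd N 0 (R + (2 + n) * W + 1)) (R + (2 + n) * W + 1) (I (2 + n)).
      have e0 : N 0 + N 1 = R + (2 + n) * W + 1 by rewrite n0 n1 (_ : 2 + n - 1 = n.+1); lia.
      rewrite [LHS]/= e0; set a := R + _ + 1.
      have -> : upd N 0 a 0 = a by [].
      by have -> : upd N 0 a (2 + n) = I (2 + n) by rewrite -Nt.
    rewrite [foldl _ N _]E /inv /upd; split.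
    - rewrite ifF; last by rewrite /R; lia. by rewrite /=; congr (_ + _ * _ + _); lia.
    - rewrite ifF; last by rewrite /R; lia. exact: n1.
    - move=> i hi; case: eqP => [h|h].
        have [->//] : i = 2 + n by nia.
      rewrite ifF; last by rewrite /R; lia.
      rewrite n2 //; have : i != 2 + n by apply: contra_not_neq h => ->. lia.
    - move=> c c1 hc; rewrite ifF; last by have := hc (2 + n) ltac:(lia); lia.
      rewrite ifF; last by lia.
      by rewrite n3 // => i hi; apply: hc; lia.
  by have := H (Z - 2) ltac:(lia); rewrite (_ : 2 + (Z - 2) = Z) //; lia.
set N := foldl _ M2 _ in invZ *; case: invZ => n0 n1 n2 n3.
have n0' : N 0 = (Z - 1) * W + 1 + R by rewrite n0; lia.
rewrite /= /upd /= n0' addKn.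
split=> [//|//|||]; [by rewrite /= /R; lia | by rewrite /= /R; lia | ].
split=> [k i kW|i iD] /=.
  rewrite ifF; last by lia. rewrite ifF; last by lia. rewrite ifF; last by lia.
  rewrite ifF; last by lia. rewrite ifF; last by lia. rewrite ifF; last by lia.
  have [/andP[/eqP-> hi]|hk] := boolP ((k == 1) && (0 < i < Z)); first by rewrite n2.
  rewrite n3; [|by lia|].
    by apply: I0; rewrite /D; lia.
  move=> i' hi'; apply: contra hk => /eqP/(cell_inj kW W1)[ei ->]; by rewrite ei eqxx.
do 6 (rewrite ifF; last by lia).
rewrite n3; [by []|by lia|]; move=> i' hi'; rewrite /R; lia.
Qed.

Lemma lines_flatten (f : nat -> seq instr) l : (forall j, all is_line (f j)) ->
  all is_line (flatten (map f l)).
Proof. by move=> h; elim: l => //= j l IH; rewrite all_cat h. Qed.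

Lemma prologue_line : all is_line prologue.
Proof.
rewrite /prologue -cat1s !all_cat all_nseq orbT [all _ (flatten _)](_ : _ = true) //.
exact: lines_flatten.
Qed.

Lemma epilogue_line : all is_line epilogue.
Proof.
by rewrite all_cat andbT lines_flatten.
Qed.

(** Cell 0 holds the base address [R] and so is restored last; [ILoad 0 0] then reads entry 0 of
    array 0, which is stored exactly at [R]. *)
Lemma epilogue_correct D M s : simulates W Z D M s -> let M' := foldl step_line M epilogue in
  (forall j, j < Z -> M' j = arr s 0 j) /\ (forall e, e <= D -> M' (Z + e) = raw s e).
Proof.
move=> [_ h0 _ _ [har hraw]]; pose R := Z + D.+1.
rewrite /= /epilogue foldl_cat; set N := foldl _ _ (flatten _).
have [n0 n1 n2] : [/\ N 0 = R, forall j, 0 < j < Z -> N j = arr s 0 j & forall c, Z <= c -> N c = M c].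
  have H n : 1 + n <= Z -> let N := foldl step_line M (flatten [seq [:: IConst j (j * W); IAdd j j 0; ILoad j j] | j <- iota 1 n]) in
    [/\ N 0 = R, forall j, 0 < j < 1 + n -> N j = arr s 0 j & forall c, Z <= c -> N c = M c].
    elim: n => [|n IH] hn; first by split=> //= j; lia.
    have {IH} := IH ltac:(lia).
    rewrite -(addn1 n) iotaD map_cat flatten_cat foldl_cat.
    set N' := foldl _ M _ => -[m0 m1 m2].
    have E : foldl step_line N' [:: IConst (1 + n) ((1 + n) * W); IAdd (1 + n) (1 + n) 0; ILoad (1 + n) (1 + n)] =
       upd (upd (upd N' (1 + n) ((1 + n) * W)) (1 + n) ((1 + n) * W + R)) (1 + n) (arr s 0 (1 + n)).
      have e : upd N' (1 + n) ((1 + n) * W) 0 = R by rewrite /upd /= m0.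
      have a1 v : upd N' (1 + n) v (1 + n) = v by rewrite /upd eqxx.
      have a2 v w : upd (upd N' (1 + n) v) (1 + n) w (1 + n) = w by rewrite /upd eqxx.
      have a3 v w : upd (upd N' (1 + n) v) (1 + n) w ((1 + n) * W + R) = arr s 0 (1 + n).
        rewrite /upd; do 2 (rewrite ifF; last by rewrite /R; lia).
        rewrite m2; last by rewrite /R; lia.
        by rewrite -har; [congr M; rewrite /R; lia | lia].
      by rewrite [LHS]/= e a1 a2 a3.
    rewrite [foldl _ N' _]E /upd; split.
    - by [].
    - move=> j hj; case: eqP => [->//|h]; rewrite m1 //; lia.
    - move=> c hc; do 3 (rewrite ifF; last by lia). exact: m2.
  have [a b c] := H (Z - 1) ltac:(lia); split=> // j hj; apply: b; lia.
split=> [j hj|e he]; rewrite /= /upd.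
  case: eqP => [->|j0]; last by rewrite n1 //; lia.
  by rewrite n0 n2 -?har /R; [congr M; lia | lia | lia].
by rewrite ifF ?n2 ?hraw //; lia.
Qed.

(** The input vanishes from [Z + q * m + 3], which is [R], on; hence all array entries not filled by
    the prologue start as 0. *)
Lemma compile_correct c (I : memory) m : cwf W c -> 3 + cneed c <= Z ->
  I 1 = m -> (forall a, Z + q * m + 3 <= a -> I a = 0) ->
  let D := q * m + 2 in let p := exec W D c (initial I) in
  exists M, (forall fuel, size prologue + p.2 + size epilogue < fuel -> run (compile c) fuel 0 I = Some M) /\
    (forall j, j < Z -> M j = arr p.1 0 j) /\ (forall e, e <= D -> M (Z + e) = raw p.1 e).
Proof.
move=> wc nc I1 I0 D p.
have em : embedded (compile c) 0 (compile c) by [].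
move: (em) => /embedded_cat[em1 /embedded_cat[em2 /embedded_cat[em3 em4]]].
rewrite size_ccode !add0n in em2 em3 em4.
have r1 := reaches_line I prologue_line em1.
have sim1 := prologue_correct I1 I0.
have [M2 [r2 sim2 _]] := ccode_correct (P := compile c) (leqnn 3) nc wc sim1 em2.
have r3 := reaches_line M2 epilogue_line em3.
have [h1 h2] := epilogue_correct sim2.
exists (foldl step_line M2 epilogue); split=> // fuel hf.
have r := reaches_trans (reaches_trans r1 r2) r3.
rewrite -/D -/p in r; rewrite -(subnKC (ltnW hf)) r.
have : 0 < fuel - (size prologue + p.2 + size epilogue) by rewrite subn_gt0.
by case: (fuel - _) => // f _; apply: run_halt; apply: embedded_head em4.
Qed.

End Program.

(** * Reasoning about programs *)

Section Logic.
Variables (W D : nat).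
Notation eval := (eval D).
Notation exec := (exec W D).
Notation esize := (esize W).
Implicit Types (c : cmd) (e : expr) (s : state).

Definition Var k := Arr k (Cst 0).
(** With truncated subtraction, the sum of both differences is 0 exactly for equal values. *)
Definition Eq a b := Sub (Cst 1) (Add (Sub a b) (Sub b a)).
Definition Not a := Sub (Cst 1) a.
Definition Any n (f : nat -> expr) := foldr (fun k e => Add (f k) e) (Cst 0) (iota 0 n).
Definition When e c := If e c Skip.
(** Expanded when the program is written; [n] will always be a constant depending on [d] only. *)
Definition Unroll n (f : nat -> cmd) := foldr (fun k c => Seq (f k) c) Skip (iota 0 n).
Definition Let k e := SetA k (Cst 0) e.

Lemma eval_eq s a b : eval s (Eq a b) = (eval s a == eval s b).
Proof. by rewrite /Eq /=; case: eqP => /= h; lia. Qed.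

Lemma eval_not s a : eval s (Not a) = (eval s a == 0).
Proof. by rewrite /Not /=; case: eqP => /= h; lia. Qed.

Lemma test_eq s a b : (eval s (Eq a b) != 0) = (eval s a == eval s b).
Proof. by rewrite eval_eq eqb0 negbK. Qed.

Lemma test_not s a : (eval s (Not a) != 0) = (eval s a == 0).
Proof. by rewrite eval_not eqb0 negbK. Qed.

Lemma eval_any s n f : (eval s (Any n f) != 0) = has (fun k => eval s (f k) != 0) (iota 0 n).
Proof.
by rewrite /Any; elim: (iota 0 n) => //= k l <-; rewrite addn_eq0 negb_and.
Qed.

(** A syntactic frame condition, so that unchanged arrays are recognised by computation. *)
Fixpoint nowrite (k : nat) c := match c with
  | Skip | SetRaw _ _ => true
  | SetA k' _ _ => k != k'
  | Seq c1 c2 | If _ c1 c2 => nowrite k c1 && nowrite k c2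
  | For k' _ c => (k != k') && nowrite k c
  end.

Definition same c s s' := forall k i, nowrite k c -> arr s' k i = arr s k i.

Lemma exec_same c s : same c s (exec c s).1.
Proof.
move=> k i; elim: c s => [|k' a b|a b|c1 IH1 c2 IH2|e c1 IH1 c2 IH2|k' e c IH] s //=.
- by move=> /negbTE->.
- by move=> /andP[h1 h2]; rewrite IH2 // IH1.
- by move=> /andP[h1 h2]; case: eqP => _ /=; [apply: IH2 | apply: IH1].
- move=> /andP[hk hc]; elim: (eval s e) => [|j IHj] //=.
  by rewrite IH //= (negbTE hk).
Qed.

Lemma nowrite_unroll k n f : (forall i, nowrite k (f i)) -> nowrite k (Unroll n f).
Proof. by move=> h; rewrite /Unroll; elim: (iota 0 n) => //= i l ->; rewrite h. Qed.

Fixpoint loopfree c := match c with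
  | Skip | SetA _ _ _ | SetRaw _ _ => true
  | Seq c1 c2 | If _ c1 c2 => loopfree c1 && loopfree c2
  | For _ _ _ => false
  end.

Lemma loopfree_unroll n f : (forall i, loopfree (f i)) -> loopfree (Unroll n f).
Proof. by move=> h; rewrite /Unroll; elim: (iota 0 n) => //= i l ->; rewrite h. Qed.

(* Only meaningful for loop-free code: a loop gets the junk value 0. *)
Fixpoint bound c := match c with
  | Skip => 0
  | SetA _ a b => esize a + (W + 4) + esize b + 1
  | SetRaw a b => esize a + 2 + esize b + 1
  | Seq c1 c2 => bound c1 + bound c2
  | If e c1 c2 => esize e + 2 + maxn (bound c1) (bound c2)
  | For _ _ _ => 0
  end.

Lemma exec_bound c s : loopfree c -> (exec c s).2 <= bound c.
Proof.
elim: c s => [|k' a b|a b|c1 IH1 c2 IH2|e c1 IH1 c2 IH2|k' e c IH] s //=.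
- by move=> /andP[h1 h2]; apply: leq_add; [apply: IH1 | apply: IH2].
- by move=> /andP[h1 h2]; case: eqP => _ /=; [have := IH2 s h2 | have := IH1 s h1]; lia.
Qed.

Lemma exec_set k a b s : (exec (SetA k a b) s).1 = set_arr s k (eval s a) (eval s b).
Proof. by []. Qed.

Lemma exec_seq c1 c2 s : (exec (Seq c1 c2) s).1 = (exec c2 (exec c1 s).1).1.
Proof. by []. Qed.

Lemma cost_seq c1 c2 s : (exec (Seq c1 c2) s).2 = (exec c1 s).2 + (exec c2 (exec c1 s).1).2.
Proof. by []. Qed.

Lemma exec_if e c1 c2 s : (exec (If e c1 c2) s).1 = if eval s e != 0 then (exec c1 s).1 else (exec c2 s).1.
Proof. by rewrite /=; case: eqP. Qed.

Lemma exec_when e c s : (exec (When e c) s).1 = if eval s e != 0 then (exec c s).1 else s.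
Proof. by rewrite /When /=; case: eqP. Qed.

Lemma cost_when e c s : (exec (When e c) s).2 <= esize e + 2 + (if eval s e != 0 then (exec c s).2 else 0).
Proof. by rewrite /When /=; case: eqP => _ /=; lia. Qed.

Lemma arr_set s k i v k' i' : arr (set_arr s k i v) k' i' = if (k' == k) && (i' == i) then v else arr s k' i'.
Proof. by []. Qed.

(** The invariant also speaks of the time used so far. Its step may assume that every array which
    the loop does not write is as it was at the start. *)
Lemma for_rule j e c s (I : nat -> state -> nat -> Prop) : I 0 s 0 ->
  (forall i s' t, i < eval s e -> same (For j e c) s s' -> I i s' t ->
     I i.+1 (exec c (set_arr s' j 0 i)).1 (t + (exec c (set_arr s' j 0 i)).2 + 8)) ->
  exists2 t, I (eval s e) (exec (For j e c) s).1 t & (exec (For j e c) s).2 = t + (esize e + 2).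
Proof.
move=> I0 step /=; set q := iteri _ _ _.
have H i : i <= eval s e -> let p := iteri i (iterate (exec c) j) (s, 0) in I i p.1 p.2 /\ same (For j e c) s p.1.
  elim: i => [|i IH] hi //=; have {IH} [h1 h2] := IH (ltnW hi).
  split; first exact: step.
  move=> k l /= /andP[kj kc]; rewrite exec_same //= (negbTE kj) /=; apply: h2; by rewrite /= kj.
have [h1 h2] := H _ (leqnn _); exists q.2 => //; lia.
Qed.

Lemma unroll_rule n f s (I : nat -> state -> nat -> Prop) : I 0 s 0 ->
  (forall k s' t, k < n -> same (Unroll n f) s s' -> I k s' t -> I k.+1 (exec (f k) s').1 (t + (exec (f k) s').2)) ->
  I n (exec (Unroll n f) s).1 (exec (Unroll n f) s).2.
Proof.
move=> I0 step.
have H m a s' t : m + a = n -> same (Unroll n f) s s' -> I a s' t ->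
    let c := foldr (fun k c => Seq (f k) c) Skip (iota a m) in I n (exec c s').1 (t + (exec c s').2).
  elim: m a s' t => [|m IH] a s' t /= e sm Ia; first by rewrite addn0 -e.
  have h := IH a.+1 _ _ ltac:(lia) _ (step a s' t ltac:(lia) sm Ia).
  rewrite addnA; apply: h => k i hk; rewrite exec_same ?sm //.
  move: hk; rewrite /Unroll -e addnC iotaD foldr_cat add0n.
  by elim: (iota 0 a) => [|b l IHl] /= /andP[].
by have := H n 0 s 0 (addn0 n) (fun _ _ _ => erefl) I0.
Qed.

(** For loops whose iteration [i] changes at most entry [i] of array [k]: the step may then assume
    that this entry still has its initial value. *)
Lemma for_update j e c s k (P : pred nat) v B : k != j ->
  (forall i s', i < eval s e -> same (For j e c) s s' -> arr s' k i = arr s k i ->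
     let q := exec c (set_arr s' j 0 i) in
     (forall l, arr q.1 k l = if (l == i) && P i then v else arr s' k l) /\ q.2 <= B) ->
  (forall l, arr (exec (For j e c) s).1 k l = if (l < eval s e) && P l then v else arr s k l) /\
  (exec (For j e c) s).2 <= eval s e * (B + 8) + (esize e + 2).
Proof.
move=> kj step.
have [||t h1 ->] := @for_rule j e c s (fun i s' t =>
   (forall l, arr s' k l = if (l < i) && P l then v else arr s k l) /\ t <= i * (B + 8)).
- by [].
- move=> i s' t hi sm [h1 h2].
  have [|g1 g2] := step i s' hi sm; first by rewrite h1 ltnn.
  split=> [l|]; last by rewrite mulSn; lia.
  rewrite g1 h1 ltnS (leq_eqVlt l i); case: eqP => [->|] //=; by rewrite ltnn; case: (P i).
by split; [case: h1 | case: h1 => _; lia].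
Qed.

End Logic.

Arguments Eq : simpl never.
Arguments Not : simpl never.
Arguments Any : simpl never.
Arguments When : simpl never.
Arguments Unroll : simpl never.

(** * Phase 1: deleting small obstructions *)

Section DecisionTree.
Variables (W D d b : nat).

(** The outcomes of all tests are known at a leaf when the program is written, so each leaf can
    carry its own command. *)
Fixpoint tree (qs : seq (expr * expr)) (acc : seq bool) (leaf : seq bool -> cmd) := match qs with
  | [::] => leaf acc
  | q :: qs => If (Eq q.1 q.2) (tree qs (rcons acc true) leaf) (tree qs (rcons acc false) leaf)
  end.

Lemma exec_tree qs acc leaf s : (exec W D (tree qs acc leaf) s).1 =
  (exec W D (leaf (acc ++ [seq eval D s q.1 == eval D s q.2 | q <- qs])) s).1.
Proof.
elim: qs acc => [|q qs IH] acc; first by rewrite /= cats0.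
rewrite [tree _ _ _]/= exec_if test_eq [map _ _]/=.
by case: (eval D s q.1 == eval D s q.2); rewrite IH cat_rcons.
Qed.

Lemma loopfree_tree qs acc leaf : (forall l, loopfree (leaf l)) -> loopfree (tree qs acc leaf).
Proof. by move=> h; elim: qs acc => //= q qs IH acc; rewrite !IH. Qed.

Lemma nowrite_tree k qs acc leaf : (forall l, nowrite k (leaf l)) -> nowrite k (tree qs acc leaf).
Proof. by move=> h; elim: qs acc => //= q qs IH acc; rewrite !IH. Qed.

(* [w p k] is the [k]-th slot of the [p]-th of [b] listed edges: a vertex code, or 0 if unused. *)
Implicit Types (w : nat -> nat -> nat) (T : seq nat).

(** The interval property in terms of codes alone, so that it makes sense for arbitrary contents of
    the cells. *)
Definition orderable w T := exists r : nat -> nat,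
  (forall p p' k k', p \in T -> p' \in T -> k < d -> k' < d -> w p k != 0 -> w p' k' != 0 ->
     r (w p k) = r (w p' k') -> w p k = w p' k') /\
  (forall p p' k1 k2 k3, p \in T -> p' \in T -> k1 < d -> k2 < d -> k3 < d ->
     w p k1 != 0 -> w p k2 != 0 -> w p' k3 != 0 ->
     r (w p k1) < r (w p' k3) -> r (w p' k3) < r (w p k2) -> exists2 k, k < d & w p k = w p' k3).

Definition obstruction w T := [/\ uniq T, size T <= d.+1,
  forall p, p \in T -> p < b /\ exists2 k, k < d & w p k != 0 & ~ orderable w T].

Definition cells := [seq (p, k) | p <- iota 0 b, k <- iota 0 d].

(** The outcomes of all comparisons of two slots or of a slot with 0, for which [None] stands. *)
Definition pattern w := [seq (if q.1 is Some c then w c.1 c.2 else 0) == (if q.2 is Some c then w c.1 c.2 else 0)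
  | q <- [seq (x, y) | x <- None :: map Some cells, y <- None :: map Some cells]].

Lemma pattern_eq w w' p k p' k' : pattern w = pattern w' -> p < b -> k < d -> p' < b -> k' < d ->
  (w p k == w p' k') = (w' p k == w' p' k') /\ (w p k == 0) = (w' p k == 0).
Proof.
move=> /eq_in_map h pb kd pb' kd'.
have inc q c : q < b -> c < d -> Some (q, c) \in None :: map Some cells.
  move=> hq hc; rewrite inE /= mem_map; last by move=> x y [].
  by apply/allpairsP; exists (q, c); rewrite !mem_iota.
split.
  by apply: (h (Some (p, k), Some (p', k'))); apply: allpairs_f; apply: inc.
by apply: (h (Some (p, k), None)); apply: allpairs_f; [apply: inc | rewrite inE].
Qed.

(** Tables with equal patterns differ by a renaming of codes: [r'] finds the first cell of [w'] with
    the given code and ranks the code that [w] has in this cell. *)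
Lemma orderable_pattern w w' T : pattern w = pattern w' -> (forall p, p \in T -> p < b) ->
  orderable w T -> orderable w' T.
Proof.
move=> pw Tb [r [r1 r2]].
pose r' c := let q := nth (0, 0) cells (find (fun q => w' q.1 q.2 == c) cells) in r (w q.1 q.2).
have E p k : p \in T -> k < d -> r' (w' p k) = r (w p k).
  move=> pT kd; rewrite /r'; set q := nth _ _ _.
  have hs : has (fun q => w' q.1 q.2 == w' p k) cells.
    apply/hasP; exists (p, k) => //; apply/allpairsP; exists (p, k); rewrite !mem_iota /=; by have := Tb p pT.
  have := mem_nth (0, 0) (s := cells) (n := find (fun q => w' q.1 q.2 == w' p k) cells).
  rewrite -has_find => /(_ hs); rewrite -/q => /allpairsP[[q1 q2] /= [h1 h2 eq]].
  move: h1 h2; rewrite !mem_iota !add0n /= => h1 h2.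
  have /eqP := nth_find (0, 0) hs; rewrite -/q eq /= => Eq'.
  by have [/esym] := pattern_eq pw h1 h2 (Tb p pT) kd; rewrite Eq' eqxx => /esym/eqP->.
exists r'; split.
- move=> p p' k k' pT pT' kd kd' n0 n0'; rewrite !E // => h.
  have [e1 z1] := pattern_eq pw (Tb p pT) kd (Tb p' pT') kd'.
  have [_ z2] := pattern_eq pw (Tb p' pT') kd' (Tb p' pT') kd'.
  by apply/eqP; rewrite -e1; apply/eqP; apply: r1 => //; rewrite ?z1 ?z2.
- move=> p p' k1 k2 k3 pT pT' kd1 kd2 kd3 n1 n2 n3; rewrite !E // => h1 h2.
  have [_ z1] := pattern_eq pw (Tb p pT) kd1 (Tb p pT) kd1.
  have [_ z2] := pattern_eq pw (Tb p pT) kd2 (Tb p pT) kd2.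
  have [_ z3] := pattern_eq pw (Tb p' pT') kd3 (Tb p' pT') kd3.
  have [|||k kd e] := r2 p p' k1 k2 k3 pT pT' kd1 kd2 kd3 _ _ _ h1 h2; rewrite ?z1 ?z2 ?z3 //.
  exists k => //; apply/eqP; have [<- _] := pattern_eq pw (Tb p pT) kd (Tb p' pT') kd3; by rewrite e.
Qed.

Lemma obstruction_pattern w w' T : pattern w = pattern w' -> obstruction w T -> obstruction w' T.
Proof.
move=> pw [uT sT hT no]; split=> //.
  move=> p pT; have [pb [k kd n0]] := hT p pT; split=> //; exists k => //.
  by have [_ <-] := pattern_eq pw pb kd pb kd.
by move=> h; apply: no; apply: (orderable_pattern (esym pw)) h => p /hT[].
Qed.

(* The choice is not computed by the machine: the decision tree below hard-wires
   it for each of the finitely many equality patterns. *)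
Definition choose_obstruction (bits : seq bool) : seq nat :=
  let Q T := exists2 w, pattern w = bits & obstruction w T in
  if excluded_middle_informative (exists T, Q T) then epsilon (inhabits [::]) Q else [::].

Lemma choose_obstructionP w : let T := choose_obstruction (pattern w) in
  (T = [::] /\ forall T', ~ obstruction w T') \/ obstruction w T.
Proof.
rewrite /choose_obstruction; case: excluded_middle_informative => [ex|no]; [right|left].
  have [w' e h] := epsilon_spec (inhabits [::]) _ ex.
  exact: obstruction_pattern e h.
by split=> // T' h; apply: no; exists T', w.
Qed.

End DecisionTree.

(** Vertices in no edge are placed after all others. *)
Lemma interval_cover (T : finType) (F : {set {set T}}) (r : T -> nat) :
  {in cover F &, injective r} ->
  (forall e x y z, e \in F -> z \in cover F -> x \in e -> y \in e -> r x < r z -> r z < r y -> z \in e) ->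
  interval F.
Proof.
move=> ir cr; have [N hN] := bound_ex r.
exists (fun x => if x \in cover F then r x else N + enum_rank x); split.
  move=> x y; case: ifP => xc; case: ifP => yc.
  - exact: ir.
  - by have := hN x; ar.
  - by have := hN y; ar.
  - by move=> /addnI/ord_inj/enum_rank_inj.
move=> e eF x y z xe ye.
have ec u : u \in e -> u \in cover F by move=> ue; apply/bigcupP; exists e.
rewrite (ec x xe) (ec y ye); case: ifP => zc; first exact: cr.
by have := hN y; ar.
Qed.

(* Scalars are kept in entry 0 of an array.  The arrays are:
   0 deletion flags, 1 the encoded input (entry 1 is [m]), 2 time stamps of vertices,
   3 time stamps of edges, 4 component labels of edges, 5 degrees of vertices,
   6, 7, 8, 19 loop counters, 9 input pointer, 10 current time stamp, 11 size of the
   ball, 12 and 16 flags, 13 start of a component, 14 forbidden vertex, 15 start of a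
   flood, 17 and 18 minimum degree and its vertex, 20 indices of the edges of the ball,
   21 size of the edge being read, [SL k] and [BS k] the [k]-th slots of all edges and
   of the edges of the ball.  Vertex [u] is coded by [u + 2]; 0 marks an empty slot, and
   no vertex has code 1. *)
Definition SL k := 30 + k.*2.
Definition BS k := 31 + k.*2.

Section Programs.
Variables (d b : nat).

Definition Slot k j := Arr (SL k) j.
Definition Contains j x := Any d (fun k => Eq (Slot k j) x).
Definition Touch j := Any d (fun k => Eq (Arr 2 (Slot k j)) (Var 10)).
Definition Mark j := Seq (Unroll d (fun k => SetA 2 (Slot k j) (Var 10))) (SetA 2 (Cst 0) (Cst 0)).

Definition tag_body := When (Not (Arr 0 (Var 7))) (When (Touch (Var 7)) (SetA 3 (Var 7) (Var 10))).
Definition tag_loop := For 7 (Var 6) tag_body.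
Definition mark_body := When (Eq (Arr 3 (Var 7)) (Var 10)) (Mark (Var 7)).
Definition mark_loop := For 7 (Var 6) mark_body.
Definition clear_ball := Seq (Unroll b (fun p => Unroll d (fun k => SetA (BS k) (Cst p) (Cst 0))))
  (Seq (Unroll d (fun k => SetA (BS k) (Cst 0) (Slot k (Var 6)))) (Seq (Let 20 (Var 6)) (Let 11 (Cst 1)))).
Definition append_ball := Seq (Unroll d (fun k => SetA (BS k) (Var 11) (Slot k (Var 7))))
  (Seq (SetA 20 (Var 11) (Var 7)) (Let 11 (Add (Var 11) (Cst 1)))).
Definition gather_body := When (Eq (Arr 3 (Var 7)) (Var 10)) append_ball.
Definition gather_loop := For 7 (Var 6) gather_body.
Definition delete_listed (T : seq nat) := foldr (fun p c => Seq (SetA 0 (Arr 20 (Cst p)) (Cst 1)) c) Skip T.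
Definition decide := tree [seq ((if q.1 is Some c then Arr (BS c.2) (Cst c.1) else Cst 0),
    (if q.2 is Some c then Arr (BS c.2) (Cst c.1) else Cst 0))
  | q <- [seq (x, y) | x <- None :: map Some (cells d b), y <- None :: map Some (cells d b)]] [::]
  (fun bits => delete_listed (choose_obstruction d b bits)).
(** The stamp [i + 1] is new for each edge [i], so nothing needs to be cleared. Each of the [d]
    rounds enlarges the ball around edge [i] among the kept earlier edges by one. *)
Definition phase1_body := Seq (Let 10 (Add (Var 6) (Cst 1))) (Seq (Mark (Var 6))
  (Seq (Unroll d (fun _ => Seq tag_loop mark_loop)) (Seq clear_ball (Seq gather_loop decide)))).

End Programs.

Ltac nw := rewrite /SL /BS; cbn -[tree Unroll nowrite_unroll addn double];
  repeat first [ apply/andP; split | apply: nowrite_unroll => ?; cbn -[tree Unroll addn double]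
    | apply: loopfree_unroll => ?; cbn -[tree Unroll addn double] | done | lia | rewrite /SL /BS; lia ].

Lemma has_iotaS (f : pred nat) k : has f (iota 0 k.+1) = has f (iota 0 k) || f k.
Proof. by rewrite -(addn1 k) iotaD has_cat /= orbF add0n. Qed.

Section Phase1.
Variables (d b W D n : nat) (es : seq {set 'I_n}).
Hypotheses (ues : uniq es) (rk : forall e, e \in es -> #|e| <= d).
Notation eval := (eval D).
Notation exec := (exec W D).
Notation m := (size es).
Notation edge := (nth set0 es).

Definition codes j := [seq val x + 2 | x <- enum (edge j)].
Definition slots s := forall j k, j < m -> k < d -> arr s (SL k) j = nth 0 (codes j) k.

Lemma mem_codes j (u : 'I_n) : (val u + 2 \in codes j) = (u \in edge j).
Proof. by rewrite (mem_map (f := fun x : 'I_n => val x + 2)) ?mem_enum // => x y /addIn/val_inj. Qed.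

Lemma codesP j c : reflect (exists2 u, u \in edge j & c = val u + 2) (c \in codes j).
Proof.
apply: (iffP mapP) => -[u]; rewrite ?mem_enum => h ->; exists u => //; by rewrite mem_enum.
Qed.

Lemma size_codes j : j < m -> size (codes j) <= d.
Proof. by move=> hj; rewrite size_map -cardE rk // mem_nth. Qed.

Lemma has_slot s j (f : pred nat) : slots s -> j < m -> f 0 = false ->
  has (fun k => f (arr s (SL k) j)) (iota 0 d) = has f (codes j).
Proof.
move=> sl hj f0; apply/hasP/hasP => [[k]|[c]].
  rewrite mem_iota => hk; rewrite sl // => h.
  have [hs|hs] := ltnP k (size (codes j)); first by exists (nth 0 (codes j) k) => //; apply: mem_nth.
  by rewrite nth_default // f0 in h.
move=> /(nthP 0)[k hk <-] h; exists k; rewrite ?mem_iota; last rewrite sl //.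
  exact: leq_trans hk (size_codes hj).
exact: leq_trans hk (size_codes hj).
Qed.

Lemma slots_same c s s' : slots s -> same c s s' -> (forall k, nowrite (SL k) c) -> slots s'.
Proof. by move=> sl sm nwr j k hj hk; rewrite sm // sl. Qed.

Lemma eval_contains s je x : slots s -> eval s je < m -> eval s x != 0 ->
  (eval s (Contains d je x) != 0) = (eval s x \in codes (eval s je)).
Proof.
move=> sl hj x0; rewrite eval_any.
rewrite (@eq_has _ _ (fun k => arr s (SL k) (eval s je) == eval s x)).
  by rewrite (has_slot (f := fun c => c == eval s x)) // ?has_pred1 // eq_sym (negbTE x0).
by move=> k; rewrite test_eq.
Qed.

Lemma eval_touch s je : slots s -> eval s je < m -> arr s 2 0 != arr s 10 0 ->
  (eval s (Touch d je) != 0) = has (fun c => arr s 2 c == arr s 10 0) (codes (eval s je)).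
Proof.
move=> sl hj x0; rewrite eval_any.
rewrite (@eq_has _ _ (fun k => arr s 2 (arr s (SL k) (eval s je)) == arr s 10 0)).
  by rewrite (has_slot (f := fun c => arr s 2 c == arr s 10 0)) //; apply/negbTE.
by move=> k; rewrite test_eq.
Qed.

Lemma codes_gt1 j c : c \in codes j -> 1 < c.
Proof. by move=> /codesP[u _ ->]; rewrite addn2. Qed.

Lemma exec_mark s v j : slots s -> arr s v 0 = j -> j < m -> v != 2 ->
  forall l, arr (exec (Mark d (Var v)) s).1 2 l =
   if l == 0 then 0 else if l \in codes j then arr s 10 0 else arr s 2 l.
Proof.
move=> sl ej hj v2 l; rewrite exec_seq exec_set arr_set /= .
case: eqP => //= /eqP l0.
have [] := @unroll_rule W D d (fun k => SetA 2 (Slot k (Var v)) (Var 10)) s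
  (fun k s' _ => arr s' 10 0 = arr s 10 0 /\ forall l, arr s' 2 l = if has (fun k' => arr s (SL k') j == l) (iota 0 k) then arr s 10 0 else arr s 2 l).
- by [].
- move=> k s' _ hk sm [h1 h2]; rewrite exec_set; split; first by rewrite arr_set.
  move=> l'; rewrite arr_set has_iotaS eqxx [eval s' _]/= (sm v 0) ?ej; last by nw.
  rewrite (sm (SL k)); last by nw.
  rewrite [eval s' _]/= h2 h1 [l' == _]eq_sym.
  by case: (arr s (SL k) j == l'); rewrite ?orbT ?orbF.
move=> _ ->; rewrite (has_slot (f := fun c => c == l)) ?has_pred1 //.
by rewrite eq_sym; apply/negbTE.
Qed.

Definition loop_cost e c := bound W c + 8 + (esize W e + 2).

Lemma loop_cost_le i e c : i <= m -> i * (bound W c + 8) + (esize W e + 2) <= loop_cost e c * m.+1.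
Proof.
move=> h; rewrite /loop_cost mulnDl leq_add //; last by rewrite mulnS leq_addr.
by rewrite mulnC leq_mul2l (leq_trans h) ?orbT.
Qed.

Lemma exec_tag_loop s i : slots s -> arr s 6 0 = i -> i <= m -> arr s 2 0 != arr s 10 0 ->
  let p := exec (tag_loop d) s in
  (forall l, arr p.1 3 l = if (l < i) && ((arr s 0 l == 0) && has (fun c => arr s 2 c == arr s 10 0) (codes l))
     then arr s 10 0 else arr s 3 l) /\ p.2 <= loop_cost (Var 6) (tag_body d) * m.+1.
Proof.
move=> sl ei im z0 p.
have lf : loopfree (tag_body d) by nw.
have [] := @for_update W D 7 (Var 6) (tag_body d) s 3
  (fun l => (arr s 0 l == 0) && has (fun c => arr s 2 c == arr s 10 0) (codes l)) (arr s 10 0)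
  (bound W (tag_body d)).
- by [].
- move=> j s' hj sm h3; split; last exact: exec_bound.
  have sl' : slots (set_arr s' 7 0 j).
    by apply: (slots_same (c := tag_loop d) sl) => [k l h|k]; [rewrite -(sm k l h) arr_set; case: eqP => // ek; move: h; rewrite ek | nw].
  have e0 l : arr s' 0 l = arr s 0 l by apply: sm; nw.
  have e2 l : arr s' 2 l = arr s 2 l by apply: sm; nw.
  have e10 l : arr s' 10 l = arr s 10 l by apply: sm; nw.
  have jm : j < m by move: hj; rewrite /= ei => /leq_trans; apply.
  move=> l; rewrite /tag_body exec_when test_not [eval _ _]/= e0.
  case: (arr s 0 j == 0); last by rewrite andbF.
  rewrite exec_when eval_touch ?[eval _ _]/= //; last by rewrite !arr_set /= e2 e10.
  rewrite (@eq_has _ _ (fun c => arr s 2 c == arr s 10 0)); last by move=> c /=; rewrite e2 e10.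
  by case: has; rewrite ?andbF //= andbT e10.
rewrite [eval _ _]/= ei => h1 h2; split=> //; exact: leq_trans h2 (loop_cost_le _ _ im).
Qed.

Lemma exec_mark_loop s i : slots s -> arr s 6 0 = i -> i <= m -> arr s 2 0 = 0 ->
  let p := exec (mark_loop d) s in
  (forall l, arr p.1 2 l = if has (fun j => (arr s 3 j == arr s 10 0) && (l \in codes j)) (iota 0 i)
     then arr s 10 0 else arr s 2 l) /\ p.2 <= loop_cost (Var 6) (mark_body d) * m.+1.
Proof.
move=> sl ei im z0 p.
have lf : loopfree (mark_body d) by nw.
have [||t [h1 ht] h2] := @for_rule W D 7 (Var 6) (mark_body d) s (fun a s' t =>
  (forall l, arr s' 2 l = if has (fun j => (arr s 3 j == arr s 10 0) && (l \in codes j)) (iota 0 a)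
     then arr s 10 0 else arr s 2 l) /\ t <= a * (bound W (mark_body d) + 8)).
- by [].
- move=> j s' t hj sm [h1 ht]; split; last first.
    by have := exec_bound W D (set_arr s' 7 0 j) lf; rewrite mulSn; lia.
  have sl' : slots (set_arr s' 7 0 j).
    by apply: (slots_same (c := mark_loop d) sl) => [k l h|k]; [rewrite -(sm k l h) arr_set; case: eqP => // ek; move: h; rewrite ek | nw].
  have e3 l : arr s' 3 l = arr s 3 l by apply: sm; nw.
  have e10 l : arr s' 10 l = arr s 10 l by apply: sm; nw.
  have jm : j < m by move: hj; rewrite /= ei => /leq_trans; apply.
  move=> l; rewrite has_iotaS /mark_body exec_when test_eq [eval _ _]/= [eval _ (Var 10)]/= e3 e10.
  case: (arr s 3 j == arr s 10 0); last by rewrite orbF /= h1.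
  rewrite (@exec_mark _ 7 j) // !arr_set /= h1 e10.
  have no0 : has (fun j => (arr s 3 j == arr s 10 0) && (0 \in codes j)) (iota 0 j) = false.
    by apply/hasPn => j' _; rewrite negb_and; apply/orP; right; apply/negP => /codes_gt1.
  case: eqP => [->|_]; last by case: (l \in codes j); rewrite ?orbT ?orbF.
  by rewrite no0 z0; case: ifP => // /codes_gt1.
rewrite [eval _ _]/= ei in h1; split=> //.
rewrite /p h2; move: ht; rewrite [eval _ _]/= ei => ht.
by apply: leq_trans (loop_cost_le (Var 6) (mark_body d) im); rewrite leq_add2r.
Qed.

(** The bound [a] hides edges not yet inserted in phase 1; later [a] is the number of all edges. *)
Definition kept s a := [set f in es | (index f es < a) && (arr s 0 (index f es) == 0)].

Lemma mem_kept s a j : j < m -> (edge j \in kept s a) = (j < a) && (arr s 0 j == 0).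
Proof. by move=> hj; rewrite inE mem_nth // index_uniq. Qed.

Lemma keptP s a f : f \in kept s a -> exists j, [/\ j < m, j < a, arr s 0 j = 0 & f = edge j].
Proof.
rewrite inE => /and3P[fe h1 /eqP h2]; exists (index f es); split=> //; first by rewrite index_mem.
by rewrite nth_index.
Qed.

Lemma has_codes j (P : pred nat) : has P (codes j) = [exists u in edge j, P (val u + 2)].
Proof.
apply/hasP/exists_inP => [[c /codesP[u ue ->] h]|[u ue h]]; first by exists u.
by exists (val u + 2) => //; rewrite mem_codes.
Qed.

(** The stamped vertices and edges describe the ball of radius [r]; the last clause guarantees that
    the next stamp will be new. *)
Definition round_inv s0 i r s := [/\
  forall u : 'I_n, (arr s 2 (val u + 2) == i.+1) = (u \in cover (ball (kept s0 i) (edge i) r)),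
  arr s 2 0 = 0, (forall j, j < i -> (arr s 3 j == i.+1) = (edge j \in ball (kept s0 i) (edge i) r)) &
  forall l, arr s 2 l <= i.+1 /\ arr s 3 l <= i.+1].

Definition round := Seq (tag_loop d) (mark_loop d).

Lemma exec_round s0 i r s : slots s -> i < m -> arr s 6 0 = i -> arr s 10 0 = i.+1 ->
  (forall l, arr s 0 l = arr s0 0 l) -> round_inv s0 i r s ->
  let p := exec round s in round_inv s0 i r.+1 p.1 /\
  p.2 <= (loop_cost (Var 6) (tag_body d) + loop_cost (Var 6) (mark_body d)) * m.+1.
Proof.
move=> sl im ei e10 e0 [v2 v0 t3 le] p.
have [tg tc] := @exec_tag_loop s i sl ei (ltnW im) ltac:(by rewrite v0 e10).
rewrite /p /round exec_seq cost_seq; set s1 := (exec (tag_loop d) s).1 in tg *.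
have sm : same (tag_loop d) s s1 := exec_same _ _ _.
have sl1 : slots s1 by apply: slots_same sl sm _ => k; nw.
have s12 l : arr s1 2 l = arr s 2 l by apply: sm; nw.
have s110 : arr s1 10 0 = i.+1 by rewrite sm ?e10 //; nw.
have [mk mc] := @exec_mark_loop s1 i sl1 ltac:(by rewrite sm ?ei) (ltnW im) ltac:(by rewrite s12 v0).
set F := kept s0 i in v2 t3 *; set e := edge i in v2 t3 *; set s2 := (exec (mark_loop d) s1).1 in mk *.
have sm2 : same (mark_loop d) s1 s2 := exec_same _ _ _.
have tg' j : j < i -> (arr s1 3 j == i.+1) = (edge j \in ball F e r.+1).
  move=> ji; have jm : j < m by apply: ltn_trans im.
  rewrite tg ji /= e10 e0 inE inE mem_kept // ji /= -t3 //.
  rewrite has_codes (_ : [exists u in _, _] = ~~ [disjoint edge j & cover (ball F e r)]).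
    by case: ifP => h; rewrite ?eqxx ?orbT ?orbF.
  apply/exists_inP/idP => [[u ue h]|].
    by apply/negP => dj; have := disjointFr dj ue; rewrite -v2 h.
  by rewrite -setI_eq0 => /set0Pn[u]; rewrite inE => /andP[ue uc]; exists u; rewrite ?v2.
split; last by rewrite mulnDl leq_add.
have ballE f : f \in ball F e r.+1 -> f = e \/ exists2 j, j < i & f = edge j.
  by move=> /(subsetP (ball_sub F e r.+1)); rewrite in_setU1 => /orP[/eqP->|/keptP[j [_ ji _ ->]]]; [left | right; exists j].
split.
- move=> u; rewrite mk s110.
  have -> : (if has (fun j => (arr s1 3 j == i.+1) && (val u + 2 \in codes j)) (iota 0 i) then i.+1 else arr s1 2 (val u + 2)) == i.+1 =
      has (fun j => (arr s1 3 j == i.+1) && (val u + 2 \in codes j)) (iota 0 i) || (u \in cover (ball F e r)).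
    by case: has; rewrite ?eqxx // s12 v2.
  apply/orP/bigcupP => [[/hasP[j]|]|[f fB uf]].
  + rewrite mem_iota => ji /andP[h1 h2]; exists (edge j); last by rewrite -mem_codes.
    by rewrite -tg'.
  + by move=> /bigcupP[f fB uf]; exists f => //; rewrite inE fB.
  + have [fe|[j ji fj]] := ballE f fB.
      right; apply/bigcupP; exists e; first exact: ball_center. by rewrite -fe.
    by left; apply/hasP; exists j; rewrite ?mem_iota // mem_codes tg' // -fj fB.
- rewrite mk s12 v0; case: hasP => // -[j _ /andP[_ /codes_gt1]] //.
- by move=> j ji; rewrite sm2 ?tg' //; nw.
- move=> l; rewrite mk s110 s12 sm2; last by nw.
  rewrite tg e10; have [h1 h2] := le l; split; first by case: ifP.
  by case: ifP.
Qed.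

Lemma slot_of j (u : 'I_n) : j < m -> u \in edge j -> exists2 k, k < d & nth 0 (codes j) k = val u + 2.
Proof.
move=> jm; rewrite -mem_codes => /(nthP 0)[k hk <-]; exists k => //; exact: leq_trans hk (size_codes jm).
Qed.

Lemma of_slot j k : nth 0 (codes j) k != 0 -> exists2 u : 'I_n, u \in edge j & nth 0 (codes j) k = val u + 2.
Proof.
have [hk|hk] := ltnP k (size (codes j)); last by rewrite nth_default.
by move=> _; apply/codesP/mem_nth.
Qed.

(** Links the tables seen by the decision tree with families of edges; [f] sends a position of the
    list to the index of its edge. *)
Lemma orderableP w T f : (forall p, p \in T -> f p < m) ->
  (forall p k, p \in T -> k < d -> w p k = nth 0 (codes (f p)) k) ->
  orderable d w T <-> interval [set e in map (fun p => edge (f p)) T].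
Proof.
move=> fm hw; split.
  move=> [r [r1 r2]].
  have inT e : e \in [set e in map (fun p => edge (f p)) T] -> exists2 p, p \in T & e = edge (f p).
    by rewrite inE => /mapP.
  have slot e u : e \in [set e in map (fun p => edge (f p)) T] -> u \in e ->
      exists p k, [/\ p \in T, k < d, e = edge (f p) & w p k = val u + 2].
    move=> /inT[p pT ->] ue; have [k kd e1] := slot_of (fm p pT) ue; exists p, k; split=> //; by rewrite hw.
  apply: (interval_cover (r := fun u => r (val u + 2))).
    move=> u v /bigcupP[e eS ue] /bigcupP[e' eS' ve'].
    have [p [k [pT kd _ e1]]] := slot e u eS ue; have [p' [k' [pT' kd' _ e1']]] := slot e' v eS' ve'.
    rewrite -e1 -e1' => h; have := r1 p p' k k' pT pT' kd kd' _ _ h; rewrite e1 e1' => h'.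
    by apply: val_inj; apply: (@addIn 2); apply: h'; rewrite addn2.
  move=> e x y z eS /bigcupP[e' eS' ze'] xe ye.
  have [p pT ee] := inT e eS; have [k1 kd1 w1] := slot_of (fm p pT) (u := x) ltac:(by rewrite -ee).
  have [k2 kd2 w2] := slot_of (fm p pT) (u := y) ltac:(by rewrite -ee).
  have [p' [k3 [pT' kd3 _ w3]]] := slot e' z eS' ze'.
  rewrite -hw // in w1; rewrite -hw // in w2; rewrite -w1 -w2 -w3 => h1 h2.
  have [|||k kd] := r2 p p' k1 k2 k3 pT pT' kd1 kd2 kd3 _ _ _ h1 h2; rewrite ?w1 ?w2 ?w3 ?addn2 // => h.
  rewrite hw // in h; have [u ue h'] := of_slot (j := f p) (k := k) ltac:(by rewrite h).
  by rewrite ee; suff -> : z = u by []; apply: val_inj; move: h'; rewrite h !addn2 => -[].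
move=> [r [ir cr]].
pose r' c := if insub (c - 2) is Some u then r (u : 'I_n) else 0.
have r'E (u : 'I_n) : r' (val u + 2) = r u by rewrite /r' addnK valK.
exists r'; split.
  move=> p p' k k' pT pT' kd kd'; rewrite !hw // => /of_slot[u ue ->] /of_slot[v ve ->].
  by rewrite !r'E => /ir->.
move=> p p' k1 k2 k3 pT pT' kd1 kd2 kd3; rewrite !hw // => /of_slot[x xe ->] /of_slot[y ye ->] /of_slot[z ze ->].
rewrite !r'E => h1 h2; have zp : z \in edge (f p).
  by apply: (cr (edge (f p)) _ x y) => //; rewrite inE; apply: map_f.
by have [k kd <-] := slot_of (fm p pT) zp; exists k; rewrite ?hw.
Qed.

Lemma eq_BS k k' : (BS k == BS k') = (k == k').
Proof. by rewrite /BS; lia. Qed.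

Lemma BS_neq k c : c < 30 -> (BS k == c) = false.
Proof. by rewrite /BS => h; apply/negP => /eqP e; move: h; rewrite -e; lia. Qed.

Lemma exec_clear s i : slots s -> i < m -> arr s 6 0 = i -> 0 < b ->
  let s' := (exec (clear_ball d b) s).1 in
  [/\ forall p k, p < b -> k < d -> arr s' (BS k) p = if p == 0 then nth 0 (codes i) k else 0,
    arr s' 20 0 = i & arr s' 11 0 = 1].
Proof.
move=> sl im ei b0; rewrite /clear_ball !exec_seq.
set c0 := Unroll b _; set s0 := (exec c0 s).1.
set c1 := Unroll d _; set s1 := (exec c1 s0).1.
have z0 p k : p < b -> k < d -> arr s0 (BS k) p = 0.
  have := @unroll_rule W D b _ s (fun a s' _ => forall p k, p < a -> k < d -> arr s' (BS k) p = 0) _ _ p k; apply=> //.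
  move=> a s' _ ab sm h q k' qa kd'.
  have [] := @unroll_rule W D d (fun k => SetA (BS k) (Cst a) (Cst 0)) s'
    (fun l s'' _ => (forall k, k < l -> arr s'' (BS k) a = 0) /\ forall q k, q < a -> k < d -> arr s'' (BS k) q = 0).
  - by [].
  - move=> l s'' _ ld _ [h1 h2]; rewrite exec_set; split.
      move=> k0 hk0; rewrite arr_set eq_BS /= eqxx andbT; case: eqP => // /eqP ne.
      by apply: h1; rewrite ltn_neqAle ne.
    move=> q0 k0 hq0 hk0; rewrite arr_set /= (ltn_eqF hq0) andbF; exact: h2.
  - by move=> h1 h2; move: qa; rewrite ltnS leq_eqVlt => /orP[/eqP->|qa]; [apply: h1 | apply: h2].
have e6 : arr s0 6 0 = i by rewrite exec_same ?ei //; nw.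
have sl0 : slots s0 by apply: (slots_same sl (exec_same W D s)) => k; rewrite /c0; nw.
have z1 k p : k < d -> arr s1 (BS k) p = if p == 0 then nth 0 (codes i) k else arr s0 (BS k) p.
  have := @unroll_rule W D d (fun k => SetA (BS k) (Cst 0) (Slot k (Var 6))) s0
    (fun a s' _ => forall k p, k < d -> arr s' (BS k) p = if (k < a) && (p == 0) then nth 0 (codes i) k else arr s0 (BS k) p).
  move=> H kd; have := H _ _ k p kd; rewrite kd; apply=> //.
  move=> a s' _ ad sm h k0 p0 kd0; rewrite exec_set arr_set eq_BS [eval _ _]/= [eval _ (Slot _ _)]/=.
  rewrite (sm 6) ?e6; last by nw.
  rewrite (sm (SL a)); last by nw.
  rewrite sl0 // h // [k0 < a.+1]ltnS [k0 <= a]leq_eqVlt; case: (eqVneq k0 a) => [->|_] //=; rewrite ?ltnn //=; by case: eqP.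
split.
- move=> p k pb kd; by rewrite /Let !exec_set !arr_set !BS_neq //= z1 // z0.
- rewrite /Let !exec_set !arr_set /= exec_same ?e6 //; nw.
- by rewrite /Let !exec_set !arr_set.
Qed.

Definition tagged s a := [seq j <- iota 0 a | arr s 3 j == arr s 10 0].

Lemma exec_gather s i : slots s -> i < m -> arr s 6 0 = i -> arr s 11 0 = 1 ->
  let p := exec (gather_loop d) s in
  [/\ forall q k, k < d -> arr p.1 (BS k) q = if 0 < q <= size (tagged s i)
         then nth 0 (codes (nth 0 (tagged s i) q.-1)) k else arr s (BS k) q,
      forall q, arr p.1 20 q = if 0 < q <= size (tagged s i) then nth 0 (tagged s i) q.-1 else arr s 20 q &
      p.2 <= loop_cost (Var 6) (gather_body d) * m.+1].
Proof.
move=> sl im ei e11 p.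
have lf : loopfree (gather_body d) by nw.
have [||t [h1 h2 _ ht] hp] := @for_rule W D 7 (Var 6) (gather_body d) s (fun a s' t =>
  [/\ forall q k, k < d -> arr s' (BS k) q = if 0 < q <= size (tagged s a)
         then nth 0 (codes (nth 0 (tagged s a) q.-1)) k else arr s (BS k) q,
      forall q, arr s' 20 q = if 0 < q <= size (tagged s a) then nth 0 (tagged s a) q.-1 else arr s 20 q,
      arr s' 11 0 = (size (tagged s a)).+1 & t <= a * (bound W (gather_body d) + 8)]).
- by split=> // [q k _|q]; case: q.
- move=> j s' t hj sm [h1 h2 h3 ht].
  have jm : j < m by move: hj; rewrite /= ei => /ltn_trans; apply.
  have tS : tagged s j.+1 = if arr s 3 j == arr s 10 0 then rcons (tagged s j) j else tagged s j.
    by rewrite /tagged -(addn1 j) iotaD filter_cat /= add0n; case: eqP => _; rewrite ?cats1 ?cats0.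
  have e3 l : arr s' 3 l = arr s 3 l by apply: sm; nw.
  have e10 l : arr s' 10 l = arr s 10 l by apply: sm; nw.
  have cst : t + (exec (gather_body d) (set_arr s' 7 0 j)).2 + 8 <= j.+1 * (bound W (gather_body d) + 8).
    by have := exec_bound W D (set_arr s' 7 0 j) lf; rewrite mulSn; lia.
  have e7 k q : arr (set_arr s' 7 0 j) (BS k) q = arr s' (BS k) q by rewrite arr_set BS_neq.
  move: cst; set r := exec (gather_body d) _ => cst.
  have -> : r.1 = if arr s 3 j == arr s 10 0 then (exec (append_ball d) (set_arr s' 7 0 j)).1 else set_arr s' 7 0 j.
    by rewrite /r /gather_body exec_when test_eq [eval _ _]/= [eval _ (Var 10)]/= e3 e10.
  rewrite tS.
  case: (arr s 3 j == arr s 10 0); last first.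
    by split=> // [q k kd|q]; rewrite ?e7 ?h1 // arr_set /= h2.
  rewrite /append_ball !exec_seq; set c1 := Unroll d _; set s1 := (exec c1 _).1.
  have sl' : slots (set_arr s' 7 0 j).
    by apply: (slots_same (c := gather_loop d) sl) => [k l h|k]; [rewrite -(sm k l h) arr_set; case: eqP => // ek; move: h; rewrite ek | nw].
  have z1 k q : k < d -> arr s1 (BS k) q = if q == (size (tagged s j)).+1 then nth 0 (codes j) k else arr s' (BS k) q.
    have := @unroll_rule W D d (fun k => SetA (BS k) (Var 11) (Slot k (Var 7))) (set_arr s' 7 0 j)
      (fun a s'' _ => forall k q, k < d -> arr s'' (BS k) q = if (k < a) && (q == (size (tagged s j)).+1) then nth 0 (codes j) k else arr s' (BS k) q).
    move=> H kd; have := H _ _ k q kd; rewrite kd; apply=> //.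
    move=> a s'' _ ad sm' h k0 q0 kd0; rewrite exec_set arr_set eq_BS [eval _ _]/= [eval _ (Slot _ _)]/=.
    rewrite (sm' 11); last by nw.
    rewrite (sm' 7); last by nw.
    rewrite (sm' (SL a)); last by nw.
    rewrite [arr _ 11 0]/= [arr _ 7 0]/= h3 sl' // h // [k0 < a.+1]ltnS [k0 <= a]leq_eqVlt; case: (eqVneq k0 a) => [->|_] //=; rewrite ?ltnn //=; by case: eqP.
  have e11' : arr s1 11 0 = (size (tagged s j)).+1 by rewrite exec_same ?h3 //; nw.
  have e7' : arr s1 7 0 = j by rewrite exec_same //; nw.
  have e20 q : arr s1 20 q = arr s' 20 q by rewrite exec_same //; nw.
  split=> [q k kd|q||//].
  + rewrite /Let !exec_set !arr_set !BS_neq //= z1 // h1 // size_rcons nth_rcons.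
    case: eqP => [->|ne] /=; first by rewrite leqnn ltnn eqxx.
    case: q ne => //= q ne; rewrite ltnS; case: (ltngtP q (size (tagged s j))) => //= h.
    by rewrite h in ne.
  + rewrite /Let !exec_set !arr_set /= e11' e7' e20 h2 size_rcons nth_rcons.
    case: eqP => [->|ne] /=; first by rewrite leqnn ltnn eqxx.
    case: q ne => //= q ne; rewrite ltnS; case: (ltngtP q (size (tagged s j))) => //= h.
    by rewrite h in ne.
  + by rewrite /Let !exec_set !arr_set /= e11' size_rcons addn1.
rewrite [eval _ _]/= ei in h1 h2 ht; split=> //.
rewrite /p hp; apply: leq_trans (loop_cost_le (Var 6) (gather_body d) (ltnW im)); by rewrite leq_add2r.
Qed.

Lemma exec_delete T s l : arr (exec (delete_listed T) s).1 0 l =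
  if has (fun p => arr s 20 p == l) T then 1 else arr s 0 l.
Proof.
elim: T s => //= p T IH s; rewrite IH !arr_set /= [l == _]eq_sym.
by case: (arr s 20 p == l) => //=; case: has.
Qed.

Lemma loopfree_decide : loopfree (decide d b).
Proof. by apply: loopfree_tree => bits; elim: choose_obstruction. Qed.

Lemma exec_decide s : (exec (decide d b) s).1 =
  (exec (delete_listed (choose_obstruction d b (pattern d b (fun p k => arr s (BS k) p)))) s).1.
Proof.
rewrite /decide exec_tree cat0s -map_comp; congr (exec (delete_listed (choose_obstruction _ _ _)) s).1.
by apply: eq_map => -[[[p k]|] [[p' k']|]].
Qed.

End Phase1.

Section Phase1Step.
Variables (d b W D n : nat) (es : seq {set 'I_n}).
Hypotheses (d2 : 2 <= d) (ues : uniq es) (rk : forall e, e \in es -> #|e| <= d)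
  (hb : (1 + d * 2 ^ (2 * d)) ^ d <= b).
Notation eval := (eval D).
Notation exec := (exec W D).
Notation m := (size es).
Notation edge := (nth set0 es).
Notation slots := (slots d es).
Notation codes := (codes es).
Notation kept := (kept es).

Definition edges := [set e in es].
Definition deleted s := [set f in es | arr s 0 (index f es) != 0].

Lemma edge_inj j j' : j < m -> j' < m -> edge j = edge j' -> j = j'.
Proof. by move=> h h' e; apply/eqP; rewrite -(nth_uniq set0 h h' ues) e. Qed.

Lemma mem_deleted s j : j < m -> (edge j \in deleted s) = (arr s 0 j != 0).
Proof. by move=> h; rewrite inE mem_nth // index_uniq. Qed.

Lemma kept_eq s s' a : (forall l, arr s' 0 l = arr s 0 l) -> kept s' a = kept s a.
Proof. by move=> h; apply/setP => f; rewrite !inE h. Qed.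

Lemma edgeP f : f \in es -> exists2 j, j < m & f = edge j.
Proof. by move=> fe; exists (index f es); rewrite ?index_mem ?nth_index. Qed.

Lemma kept_sub s a : kept s a \subset edges.
Proof. by apply/subsetP => f; rewrite !inE => /and3P[->]. Qed.

Lemma rk_kept s a e : e \in kept s a -> #|e| <= d.
Proof. by rewrite inE => /and3P[/rk]. Qed.

(* The deleted obstructions are disjoint, and every solution meets each of them. *)
Definition inv1 i s := [/\ slots s, forall j, i <= j -> arr s 0 j = 0,
  forall l, arr s 2 l <= i /\ arr s 3 l <= i, locally_interval (kept s i) d &
  forall D', interval (edges :\: D') -> #|deleted s| <= d.+1 * #|D' :&: deleted s| ].

(** Empty edges need this separate argument because obstructions list nonempty edges only. *)
Lemma interval_set0U (F : {set {set 'I_n}}) : interval (F :\ set0) -> interval F.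
Proof.
move=> [r [ir cr]]; exists r; split=> // e eF.
have [->|e0] := eqVneq e set0; first by move=> x y z; rewrite in_set0.
by apply: cr; rewrite !inE e0.
Qed.

Lemma exec_rounds s0 i s : slots s -> i < m -> arr s 6 0 = i -> arr s 10 0 = i.+1 ->
  (forall l, arr s 0 l = arr s0 0 l) -> round_inv es s0 i 0 s ->
  let p := exec (Unroll d (fun _ => round d)) s in round_inv es s0 i d p.1 /\
  p.2 <= d * ((loop_cost W (Var 6) (tag_body d) + loop_cost W (Var 6) (mark_body d)) * m.+1).
Proof.
move=> sl im e6 e10 e0 r0.
apply: (@unroll_rule W D d (fun _ => round d) s (fun r s' t => round_inv es s0 i r s' /\
  t <= r * ((loop_cost W (Var 6) (tag_body d) + loop_cost W (Var 6) (mark_body d)) * m.+1))).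
  by [].
move=> r s' t rd sm [h1 h2].
have [|||||g1 g2] := @exec_round d W D n es ues rk s0 i r s' _ im.
- by apply: slots_same sl sm _ => k; nw.
- by rewrite sm ?e6 //; nw.
- by rewrite sm ?e10 //; nw.
- by move=> l; rewrite sm ?e0 //; nw.
- exact: h1.
- by split=> //; rewrite mulSn; lia.
Qed.

Lemma round_inv0 s0 i s : slots s -> i < m -> arr s 6 0 = i -> arr s 10 0 = i.+1 ->
  (forall l, arr s 2 l <= i /\ arr s 3 l <= i) ->
  round_inv es s0 i 0 (exec (Mark d (Var 6)) s).1.
Proof.
move=> sl im e6 e10 le.
have mk := @exec_mark d W D n es rk s 6 i sl e6 im isT.
have e3 l : arr (exec (Mark d (Var 6)) s).1 3 l = arr s 3 l by apply: exec_same; nw.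
split.
- move=> u; rewrite mk ifF; last by rewrite addn2.
  rewrite e10 mem_codes [ball _ _ _]/= /cover big_set1.
  case: (u \in edge i); first by rewrite eqxx.
  by have [h _] := le (val u + 2); apply/negbTE; lia.
- by rewrite mk.
- move=> j ji; rewrite e3 [ball _ _ _]/= inE nth_uniq //; last by apply: ltn_trans im.
  rewrite (ltn_eqF ji); have [_ h] := le j; apply/negbTE; lia.
- move=> l; rewrite mk e3 e10; have [h1 h2] := le l; split; last by lia.
  by case: ifP => // _; case: ifP => // _; lia.
Qed.

Definition cost1 := bound W (Let 10 (Add (Var 6) (Cst 1))) + bound W (Mark d (Var 6)) +
  d * (loop_cost W (Var 6) (tag_body d) + loop_cost W (Var 6) (mark_body d)) +
  bound W (clear_ball d b) + loop_cost W (Var 6) (gather_body d) + bound W (decide d b).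

Lemma leq_add6 A1 A2 A3 A4 A5 A6 M x1 x2 x3 x4 x5 x6 : x1 <= A1 * M -> x2 <= A2 * M -> x3 <= A3 * M ->
  x4 <= A4 * M -> x5 <= A5 * M -> x6 <= A6 * M ->
  x1 + (x2 + (x3 + (x4 + (x5 + x6)))) <= (A1 + A2 + A3 + A4 + A5 + A6) * M.
Proof. by rewrite !mulnDl; lia. Qed.

(* the listed edges: the current one, then the tagged ones *)
Lemma phase1_list s i : inv1 i s -> i < m -> arr s 6 0 = i ->
  exists L s5, let p := exec (phase1_body d b) s in
  let w := fun p k => arr s5 (BS k) p in
  let T := choose_obstruction d b (pattern d b w) in
  [/\ [/\ size L <= b, uniq L, forall j, j \in L -> j < m & forall f, f \in ball (kept s i) (edge i) d <-> exists2 j, j \in L & f = edge j],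
   forall q k, q < b -> k < d -> w q k = if q < size L then nth 0 (codes (nth 0 L q)) k else 0,
   forall l, arr p.1 0 l = if has (fun q => arr s5 20 q == l) T then 1 else arr s 0 l,
   (forall q, q < size L -> arr s5 20 q = nth 0 L q) &
   [/\ p.2 <= cost1 * m.+1, slots p.1 & forall l, arr p.1 2 l <= i.+1 /\ arr p.1 3 l <= i.+1]].
Proof.
move=> [sl out le loc bd] im e6.
have eb : edge i \in es by apply: mem_nth.
have b0 : 0 < b by apply: leq_trans hb; rewrite expn_gt0.
pose s1 := (exec (Let 10 (Add (Var 6) (Cst 1))) s).1.
have E1 k l : k != 10 -> arr s1 k l = arr s k l by move=> h; rewrite /s1 /Let exec_set arr_set (negbTE h).
have e10 : arr s1 10 0 = i.+1 by rewrite /s1 /Let exec_set arr_set /= e6 addn1.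
have sl1 : slots s1 by move=> j k hj hk; rewrite E1 ?sl // /SL; lia.
have e61 : arr s1 6 0 = i by rewrite E1.
have le1 l : arr s1 2 l <= i /\ arr s1 3 l <= i by rewrite !E1.
have := round_inv0 s sl1 im e61 e10 le1; set s2 := (exec (Mark d (Var 6)) s1).1 => r2.
have sm2 : same (Mark d (Var 6)) s1 s2 := exec_same W D s1.
have sl2 : slots s2 by apply: (slots_same sl1 sm2) => k; nw.
have e62 : arr s2 6 0 = i by rewrite sm2 //; nw.
have e102 : arr s2 10 0 = i.+1 by rewrite sm2 //; nw.
have out2 l : arr s2 0 l = arr s 0 l by rewrite sm2 ?E1 //; nw.
have := exec_rounds sl2 im e62 e102 out2 r2.
set c3 := Unroll d _; set s3 := (exec c3 s2).1 => -[r3 cost3].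
have sm3 : same c3 s2 s3 := exec_same W D s2.
have sl3 : slots s3 by apply: (slots_same sl2 sm3) => k; rewrite /c3; nw.
have e63 : arr s3 6 0 = i by rewrite sm3 // /c3; nw.
have e103 : arr s3 10 0 = i.+1 by rewrite sm3 // /c3; nw.
have := @exec_clear d b W D n es ues s3 i sl3 im e63 b0; set s4 := (exec _ s3).1 => -[w4 i4 cnt4].
have sm4 : same (clear_ball d b) s3 s4 := exec_same W D s3.
have sl4 : slots s4 by apply: (slots_same sl3 sm4) => k; nw.
have e64 : arr s4 6 0 = i by rewrite sm4 //; nw.
have [] := @exec_gather d W D n es ues s4 i sl4 im e64 cnt4; set s5 := (exec _ s4).1 => w5 i5 cost5.
have sm5 : same (gather_loop d) s4 s5 := exec_same W D s4.
have sl5 : slots s5 by apply: (slots_same sl4 sm5) => k; nw.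
case: r3 => v3 z3 t3 le3; set F := kept s i in t3 *.
have tg j : j < i -> (j \in tagged s4 i) = (edge j \in ball F (edge i) d).
  move=> ji; rewrite mem_filter mem_iota ji andbT -t3 // sm4; last by nw.
  rewrite sm4 ?e103 //; [by rewrite andbT|by nw].
pose L := i :: tagged s4 i.
have Lm j : j \in L -> j < m.
  by rewrite inE => /orP[/eqP->//|]; rewrite mem_filter mem_iota => /andP[_ h]; apply: ltn_trans im.
have uL : uniq L by rewrite cons_uniq filter_uniq ?iota_uniq // andbT mem_filter mem_iota add0n ltnn !andbF.
have LP f : f \in ball F (edge i) d <-> exists2 j, j \in L & f = edge j.
  split=> [fB|[j]].
    have := subsetP (ball_sub F (edge i) d) f fB; rewrite in_setU1 => /orP[/eqP->|/keptP[j [jm ji _ fj]]].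
      by exists i; rewrite ?inE ?eqxx.
    by exists j => //; rewrite inE tg // -fj fB orbT.
  rewrite inE => /orP[/eqP-> ->|]; first exact: ball_center.
  move=> jt ->; have ji : j < i by move: jt; rewrite mem_filter mem_iota => /andP[].
  by rewrite -tg.
have sL : size L <= b.
  rewrite -(size_map edge); apply: leq_trans (uniq_leq_card (A := ball F (edge i) d) _ _) _.
  - by rewrite map_inj_in_uniq // => j j' /Lm h /Lm h'; apply: edge_inj.
  - by move=> f /mapP[j jL ->]; apply/LP; exists j.
  - apply: leq_trans hb; apply: ball_card => //; [exact: rk_kept | exact: rk].
have Ew q k : q < b -> k < d -> arr s5 (BS k) q = if q < size L then nth 0 (codes (nth 0 L q)) k else 0.
  move=> qb kd; rewrite w5 // w4 // /L /=; case: q qb => [|q] qb //=.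
have exE : (exec (phase1_body d b) s).1 = (exec (decide d b) s5).1 by [].
exists L, s5; split=> //.
- by move=> l; rewrite exE exec_decide exec_delete; case: has => //; rewrite sm5 ?sm4 ?sm3 ?out2 //; rewrite /c3; nw.
- by move=> q; rewrite /L /= ltnS i5; case: q => [|q] //= hq; rewrite hq.
- have nwl k : k != 0 -> nowrite k (decide d b).
    by move=> h; apply: nowrite_tree => l; elim: choose_obstruction => //= p T ->; rewrite h.
  split.
  + have -> : (exec (phase1_body d b) s).2 = (exec (Let 10 (Add (Var 6) (Cst 1))) s).2 + ((exec (Mark d (Var 6)) s1).2 +
      ((exec c3 s2).2 + ((exec (clear_ball d b) s3).2 + ((exec (gather_loop d) s4).2 + (exec (decide d b) s5).2)))) by [].
    have g x y : x <= y -> x <= y * m.+1 by move=> h; rewrite mulnS; apply: leq_trans h (leq_addr _ _).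
    have k1 := g _ _ (exec_bound W D s (c := Let 10 (Add (Var 6) (Cst 1))) isT).
    have k2 := g _ _ (exec_bound W D s1 (c := Mark d (Var 6)) ltac:(nw)).
    have k4 := g _ _ (exec_bound W D s3 (c := clear_ball d b) ltac:(nw)).
    have k6 := g _ _ (exec_bound W D s5 (loopfree_decide d b)).
    rewrite mulnA in cost3; exact: (leq_add6 k1 k2 cost3 k4 cost5 k6).
  + move=> j k hj hk; rewrite exE exec_same ?sl5 //; apply: nwl; rewrite /SL; lia.
  + have e k l : (k == 2) || (k == 3) -> arr (exec (phase1_body d b) s).1 k l = arr s3 k l.
      move=> hk; have k3 : k < 4 by case/orP: hk => /eqP->.
      rewrite exE (exec_same W D s5 (c := decide d b)) ?nwl //; last by lia.
      rewrite sm5; last by case/orP: hk => /eqP->; nw.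
      by rewrite sm4 //; case/orP: hk => /eqP->; nw.
    by move=> l; rewrite !e.
Qed.

(** If the list has no obstruction, [ball_locally_interval] allows edge [i] to be kept. An
    obstruction must contain edge [i], since the edges kept before are locally interval. It is
    disjoint from earlier deletions and has at most [d + 1] edges, one of which every solution
    deletes. *)
Lemma phase1_step s i : inv1 i s -> i < m -> arr s 6 0 = i ->
  let p := exec (phase1_body d b) s in inv1 i.+1 p.1 /\ p.2 <= cost1 * m.+1.
Proof.
move=> I1 im e6; have [L [s5 [[sL uL Lm LP] Ew out6 i5 [cst sl6 le6]]]] := phase1_list I1 im e6.
set p := exec _ s in out6 cst sl6 le6 *; set w := fun p k => _ in out6 Ew.
set T := choose_obstruction _ _ _ in out6; split=> //.
case: (I1) => sl out le loc bd; set F := kept s i in loc LP.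
have iF : edge i \notin F by rewrite mem_kept // ltnn.
have rkF e : e \in F -> #|e| <= d := rk_kept (s := s) (a := i) (e := e).
have wT q k : q < size L -> k < d -> w q k = nth 0 (codes (nth 0 L q)) k.
  by move=> hq hk; rewrite /w Ew ?hq //; apply: leq_trans sL.
have posL T' : obstruction d b w T' -> forall q, q \in T' -> q < size L.
  move=> [_ _ hT _] q qT; have [qb [k kd nz]] := hT q qT.
  by move: nz; rewrite /w Ew //; case: ifP.
have inj q q' : q < size L -> q' < size L -> edge (nth 0 L q) = edge (nth 0 L q') -> q = q'.
  move=> hq hq' /edge_inj h; apply/eqP; rewrite -(nth_uniq 0 hq hq' uL); apply/eqP; apply: h; apply: Lm; exact: mem_nth.
have [[T0 none]|obs] := choose_obstructionP d b w.
  have out' l : arr p.1 0 l = arr s 0 l by rewrite out6 /T T0.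
  have kE : kept p.1 i.+1 = edge i |: F.
    apply/setP => f; rewrite in_setU1; have [fe|fe] := boolP (f \in es); last first.
      by rewrite !inE (negbTE fe) orbF; apply/esym/eqP => h; rewrite h mem_nth in fe.
    have [j jm ->] := edgeP fe; rewrite !mem_kept // nth_uniq // ltnS leq_eqVlt out'.
    by case: eqP => [->|_] //=; rewrite out.
  split=> //.
  - by move=> j ij; rewrite out' out // ltnW.
  - rewrite kE; apply: ball_locally_interval => // S SB Sd.
    have [//|nint] := classic (interval S); exfalso.
    (* The positions of the nonempty edges of [S]; if [S] were not interval, they would be an
       obstruction. *)
    pose T' := [seq q <- iota 0 (size L) | edge (nth 0 L q) \in S :\ set0].
    have T'L q : q \in T' -> q < size L by rewrite mem_filter mem_iota => /andP[].
    apply: (none T'); split.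
    + by rewrite filter_uniq ?iota_uniq.
    + rewrite -(size_map (fun q => edge (nth 0 L q))); apply: leq_trans Sd; apply: uniq_leq_card.
        rewrite map_inj_in_uniq ?filter_uniq ?iota_uniq // => q q' /T'L h /T'L h'; exact: inj.
      by move=> f /mapP[q]; rewrite mem_filter => /andP[h _] ->; move: h; rewrite inE => /andP[].
    + move=> q qT; have qL := T'L q qT; split; first exact: leq_trans sL.
      move: qT; rewrite mem_filter => /andP[]; rewrite !inE => /andP[ne _] _.
      have [u ue] := set0Pn _ ne; have [k kd h] := slot_of rk (Lm _ (mem_nth 0 qL)) ue.
      by exists k => //; rewrite wT // h addn2.
    + rewrite (orderableP (f := fun q => nth 0 L q) rk); last first.
      * by move=> q k /T'L hq hk; apply: wT.
      * by move=> q /T'L hq; apply: Lm; apply: mem_nth.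
      move=> h; apply: nint; apply: interval_set0U; apply: interval_sub h.
      apply/subsetP => f fS; rewrite inE; have := fS; rewrite !inE => /andP[_ /(subsetP SB)/LP[j jL fj]].
      apply/mapP; exists (index j L); last by rewrite nth_index.
      by rewrite mem_filter mem_iota index_mem jL nth_index // -fj fS.
  - have dE : deleted p.1 = deleted s by apply/setP => f; rewrite !inE out'.
    by rewrite dE.
have TL := posL _ obs; case: (obs) => uT sT hT no; rewrite -/T in uT sT hT no TL.
pose S := [set e in map (fun q => edge (nth 0 L q)) T].
have nS : ~ interval S.
  move=> h; apply: no; rewrite (orderableP (f := fun q => nth 0 L q) rk) //.
  - by move=> q /TL hq; apply: Lm; apply: mem_nth.
  - by move=> q k /TL hq hk; apply: wT.
have Sd : #|S| <= d.+1 by apply: leq_trans sT; rewrite -(size_map (fun q => edge (nth 0 L q))) cardsE card_size.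
have SB : S \subset edge i |: F.
  apply/subsetP => f; rewrite inE => /mapP[q qT ->]; apply: (subsetP (ball_sub F (edge i) d)).
  by apply/LP; exists (nth 0 L q) => //; apply: mem_nth; apply: TL.
have iS : edge i \in S.
  apply: contraT => iS; case: nS; apply: loc => //; apply/subsetP => f fS.
  have := subsetP SB f fS; rewrite in_setU1 => /orP[/eqP fe|//]; by rewrite fe (negbTE iS) in fS.
have out' j : j < m -> arr p.1 0 j = if edge j \in S then 1 else arr s 0 j.
  move=> jm; rewrite out6; congr (if _ then _ else _); rewrite inE; apply/hasP/mapP.
    by move=> [q qT /eqP h]; exists q => //; rewrite -i5 ?h //; apply: TL.
  move=> [q qT h]; exists q => //; rewrite i5; last exact: TL.
  by apply/eqP; apply: edge_inj => //; apply: Lm; apply: mem_nth; apply: TL.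
have kE : kept p.1 i.+1 \subset F.
  apply/subsetP => f /keptP[j [jm ji h ->]]; move: h; rewrite out' // mem_kept //.
  case: ifP => // jS h; rewrite h eqxx andbT ltn_neqAle -ltnS ji andbT.
  by apply: contraFneq jS => ->.
have dE : deleted p.1 = deleted s :|: S.
  apply/setP => f; rewrite in_setU; have [fe|fe] := boolP (f \in es); last first.
    rewrite !inE (negbTE fe) /=; apply/esym/negP => /mapP[q qT h].
    by rewrite h mem_nth // in fe; apply: Lm; apply: mem_nth; apply: TL.
  have [j jm ->] := edgeP fe; rewrite !mem_deleted // out'; by case: (edge j \in S); rewrite ?orbT ?orbF.
have disj : [disjoint deleted s & S].
  rewrite -setI_eq0; apply/eqP/setP => f; rewrite in_set0 in_setI; apply/negP => /andP[fd fS].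
  have := subsetP SB f fS; rewrite in_setU1 => /orP[/eqP fe|/keptP[j [jm _ h fj]]].
    by move: fd; rewrite fe mem_deleted // out.
  by move: fd; rewrite fj mem_deleted // h.
split=> //.
- move=> j ij; rewrite out6; case: hasP => [[q qT /eqP h]|_]; last by rewrite out // ltnW.
  have qL := TL q qT; rewrite i5 // in h.
  have := mem_nth 0 qL; rewrite h => jL.
  have : edge j \in ball F (edge i) d by apply/LP; exists j.
  move=> /(subsetP (ball_sub F (edge i) d)); rewrite in_setU1 => /orP[/eqP/edge_inj e|].
    by move: ij; rewrite (e (Lm _ jL) im) ltnn.
  by rewrite mem_kept ?Lm // [j < i]ltnNge (ltnW ij).
- exact: locally_interval_sub kE loc.
- move=> D' hD; have := bd D' hD; rewrite dE cardsU (disjoint_setI0 disj) cards0 subn0 setIUr cardsU.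
  have -> : (D' :&: deleted s) :&: (D' :&: S) = set0.
    by rewrite setIACA (disjoint_setI0 disj) setI0.
  rewrite cards0 subn0 mulnDr => h1; apply: leq_add h1 _; apply: leq_trans Sd _.
  rewrite leq_pmulr // card_gt0; apply/eqP => h0; apply: nS; apply: interval_sub hD.
  apply/subsetP => f fS; rewrite inE; have /setP/(_ f) := h0; rewrite in_set0 inE fS andbT => -> /=.
  have := subsetP SB f fS; rewrite in_setU1 => /orP[/eqP->|]; first by rewrite inE mem_nth.
  exact: (subsetP (kept_sub s i)).
Qed.

End Phase1Step.

(** * Phase 2: cutting components at a vertex of minimum degree *)

(** A vertex in no edge is a component by itself, hence the extra [u]. *)
Lemma component_cover (T : finType) (R : {set {set T}}) u :
  component R u \subset u |: cover (component_edges R u).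
Proof.
apply/subsetP => w /componentP j; apply: joined_closed j (setU11 _ _) => e eR.
case/orP: (component_closed u eR) => [sub|dis].
  have [->|[z ze]] := set_0Vmem e; first by rewrite sub0set.
  apply/orP; left; apply: subsetU; apply/orP; right; apply: bigcup_sup.
  rewrite inE eR /=; apply/negP => dj; by have := disjointFl dj (subsetP sub z ze); rewrite ze.
apply/orP; right; apply: disjointWr dis; rewrite subUset sub1set.
apply/andP; split; first by apply/componentP; exists 0.
by apply/bigcupsP => f; apply: component_edges_subset.
Qed.

Lemma card_component (T : finType) (R : {set {set T}}) u d : (forall e, e \in R -> #|e| <= d) ->
  #|component R u| <= 1 + d * #|component_edges R u|.
Proof.
move=> rk; apply: leq_trans (subset_leq_card (component_cover R u)) _.
rewrite cardsU1; apply: leq_add; first by case: (u \in _).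
rewrite mulnC; apply: leq_trans (leq_card_cover _) _.
rewrite -sum_nat_const; apply: leq_sum => e he; apply: rk; exact: (subsetP (component_edges_sub R u)).
Qed.

Definition Size := Arr 1 (Cst 1).

(** * Flooding a component by repeated sweeps *)

Section FloodProgram.
Variable d : nat.
(* Entry 0 of array 2 is stamped temporarily, so that empty slots do not count as unvisited. *)
Definition flood_body := When (Not (Arr 0 (Var 7))) (When (Not (Contains d (Var 7) (Var 14))) (When (Touch d (Var 7))
  (Seq (SetA 2 (Cst 0) (Var 10)) (Seq (When (Any d (fun k => Not (Eq (Arr 2 (Slot k (Var 7))) (Var 10)))) (Let 12 (Cst 1)))
    (Mark d (Var 7)))))).
Definition sweep := For 7 Size flood_body.
Definition sweep_round := When (Var 12) (Seq (Let 12 (Cst 0)) sweep).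
(* Every sweep but the last one marks a new vertex, so [1 + d * m] rounds suffice. *)
Definition flood_loop := For 8 (Add (Cst 1) (Any d (fun _ => Size))) sweep_round.
Definition flood := Seq (Let 10 (Add (Var 10) (Cst 1))) (Seq (SetA 2 (Var 15) (Var 10)) (Seq (Let 12 (Cst 1)) flood_loop)).
End FloodProgram.

Section Flood.
Variables (d W D n : nat) (es : seq {set 'I_n}).
Hypotheses (ues : uniq es) (rk : forall e, e \in es -> #|e| <= d).
Notation eval := (eval D).
Notation exec := (exec W D).
Notation m := (size es).
Notation edge := (nth set0 es).
Notation slots := (slots d es).
Notation codes := (codes es).
Notation kept := (kept es).
Notation loop_cost := (loop_cost W).

(** [a] is a code and not a vertex: the code 1 belongs to no vertex and blocks nothing. *)
Definition unblocked s a := [set f in kept s m | a \notin codes (index f es)].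

Lemma mem_unblocked s a j : j < m -> (edge j \in unblocked s a) = (arr s 0 j == 0) && (a \notin codes j).
Proof. by move=> h; rewrite in_set mem_kept // h index_uniq. Qed.

Lemma exec_flood_body s j : slots s -> arr s 7 0 = j -> j < m -> arr s 2 0 = 0 -> 0 < arr s 10 0 ->
  arr s 14 0 != 0 -> let st := arr s 10 0 in
  let P := (edge j \in unblocked s (arr s 14 0)) && has (fun c => arr s 2 c == st) (codes j) in
  let s' := (exec (flood_body d) s).1 in
  (forall l, arr s' 2 l = if P && (l \in codes j) then st else arr s 2 l) /\
  arr s' 12 0 = if P && has (fun c => arr s 2 c != st) (codes j) then 1 else arr s 12 0.
Proof.
move=> sl e7 jm z0 st0 a0 st P s'; rewrite /P /s' /st mem_unblocked // /flood_body exec_when test_not [eval _ _]/= e7.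
case: (arr s 0 j == 0); last by [].
rewrite !andTb exec_when test_not -[_ == 0]negbK (eval_contains rk) //; last by rewrite [eval _ _]/= e7.
rewrite [eval s (Var 7)]/= [eval s (Var 14)]/= e7; case: (arr s 14 0 \notin codes j); last by [].
rewrite !andTb exec_when (eval_touch rk) //; last 2 first.
- by rewrite [eval _ _]/= e7.
- by rewrite z0 eq_sym -lt0n.
rewrite [eval _ _]/= e7; case: has; last by [].
rewrite !andTb.
rewrite 2!exec_seq exec_set [eval _ (Cst 0)]/= [eval _ (Var 10)]/=.
set s1 := set_arr s 2 0 (arr s 10 0).
have sl1 : slots s1 by [].
have hs : (eval s1 (Any d (fun k => Not (Eq (Arr 2 (Slot k (Var 7))) (Var 10)))) != 0) = has (fun c => arr s 2 c != arr s 10 0) (codes j).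
  rewrite eval_any (eq_has (a2 := fun k => (fun c => (arr s1 2 c != arr s 10 0)) (arr s1 (SL k) j))); last first.
    by move=> k; cbv beta; rewrite test_not -[_ == 0]negbK test_eq -e7.
  rewrite (has_slot (f := fun c => arr s1 2 c != arr s 10 0) rk sl1 jm); last by rewrite /s1 arr_set !eqxx.
  by apply: eq_in_has => c hc; have := codes_gt1 hc; rewrite /s1 /=; case: c hc.
rewrite exec_when hs; set s2 := if _ then _ else _.
have e2 k l : k != 12 -> arr s2 k l = arr s1 k l.
  by move=> h; rewrite /s2; case: ifP => // _; rewrite exec_set arr_set (negbTE h).
have sl2 : slots s2 by move=> l k hl hk; rewrite e2 ?sl1 // /SL; lia.
split.
  move=> l; rewrite (exec_mark _ _ rk sl2 (j := j)) ?e2 //.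
  rewrite [arr s1 10 0]/= [arr s1 2 l]/=; case: eqP => // ->; rewrite z0 andTb.
  by case: ifP => // /codes_gt1.
rewrite exec_same; last by nw.
by rewrite /s2; case: has.
Qed.

Definition marked s := [set u : 'I_n | arr s 2 (val u + 2) == arr s 10 0].

(** Marks made during a sweep already act on later edges, so its exact result depends on the order
    of the edges. It is enough that it stays in the component, takes in every edge touching the old
    marks, and reports whether it marked anything. *)
Lemma exec_sweep s a : slots s -> arr s 1 1 = m -> arr s 2 0 = 0 -> 0 < arr s 10 0 ->
  arr s 14 0 = a -> a != 0 -> (forall l, arr s 2 l <= arr s 10 0) -> let p := exec (sweep d) s in
  [/\ [/\ marked s \subset marked p.1,
          forall x, marked s \subset component (unblocked s a) x -> marked p.1 \subset component (unblocked s a) x &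
          forall e, e \in unblocked s a -> ~~ [disjoint e & marked s] -> e \subset marked p.1],
     arr p.1 12 0 = (if marked p.1 == marked s then arr s 12 0 else 1), arr p.1 2 0 = 0,
     forall l, arr p.1 2 l <= arr s 10 0 & p.2 <= loop_cost Size (flood_body d) * m.+1].
Proof.
move=> sl e1 z0 st0 e14 a0 le p; set R := unblocked s a.
have lf : loopfree (flood_body d) by nw.
have em : eval s Size = m by rewrite /= e1.
have [||t [[h1 h2 h3] h4 h5 h6 ht] hp] := @for_rule W D 7 Size (flood_body d) s (fun i s' t =>
  [/\ [/\ marked s \subset marked s',
       forall x, marked s \subset component R x -> marked s' \subset component R x &
       forall j, j < i -> edge j \in R -> ~~ [disjoint edge j & marked s] -> edge j \subset marked s'],
   arr s' 12 0 = (if marked s' == marked s then arr s 12 0 else 1), arr s' 2 0 = 0,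
   forall l, arr s' 2 l <= arr s 10 0 & t <= i * (bound W (flood_body d) + 8)]).
- by split=> //; rewrite eqxx.
- move=> j s' t; rewrite em => jm sm [[h1 h2 h3] h4 h5 h6 ht].
  set s1 := set_arr s' 7 0 j; set q := exec _ s1.
  have cst : t + q.2 + 8 <= j.+1 * (bound W (flood_body d) + 8).
    by have := exec_bound W D s1 lf; rewrite -/q mulSn; lia.
  have fr k l : nowrite k (sweep d) -> arr s1 k l = arr s k l.
    by move=> h; rewrite arr_set -(sm k l h); case: eqP => // ek; move: h; rewrite ek.
  have sl1 : slots s1 by apply: (slots_same (c := sweep d) sl) => [k l h|k]; [exact: fr | nw].
  have e10 : arr s1 10 0 = arr s 10 0 by apply: fr; nw.
  have e14' : arr s1 14 0 = a by rewrite fr ?e14 //; nw.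
  have [g1 g2] := @exec_flood_body s1 j sl1 erefl jm h5 ltac:(by rewrite e10) ltac:(by rewrite e14').
  rewrite -/q e14' e10 in g1 g2.
  have uE : unblocked s1 a = R.
    by apply/setP => f; rewrite !inE fr //; nw.
  have mE : marked s1 = marked s'.
    by apply/setP => u; rewrite !inE e10; congr (_ == _); rewrite -(sm 10) //; nw.
  have q10 : arr q.1 10 0 = arr s 10 0 by rewrite exec_same ?e10 //; nw.
  rewrite uE in g1 g2; set P := _ && _ in g1 g2.
  have mq : marked q.1 = if P then marked s' :|: edge j else marked s'.
    apply/setP => u; rewrite -mE; have -> : (u \in marked q.1) = (arr q.1 2 (val u + 2) == arr s 10 0) by rewrite inE q10.
    rewrite g1 mem_codes; case: (P) => /=; rewrite ?inE ?e10 //.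
    by case: ifP => h; rewrite ?eqxx ?orbT ?orbF.
  have sub : marked s' \subset marked q.1 by rewrite mq; case: (P); rewrite // subsetUl.
  split=> //.
  + split; first exact: subset_trans h1 sub.
      move=> x hx; rewrite mq; case: ifP => [|_]; last exact: h2.
      move=> /andP[jR]; rewrite has_codes => /exists_inP[u ue hu].
      rewrite subUset h2 //=; case/orP: (component_closed x jR) => // dj.
      have : u \in marked s' by rewrite -mE inE e10.
      by move=> /(subsetP (h2 x hx)) => uc; rewrite (disjointFr dj ue) in uc.
    move=> l lj lR ld; move: lj; rewrite ltnS leq_eqVlt => /orP[/eqP el|lj]; last first.
      by apply: subset_trans sub; apply: h3.
    rewrite mq /P -el lR has_codes ifT ?subsetUr //=.
    move: ld; rewrite -setI_eq0 => /set0Pn[u]; rewrite inE => /andP[ue us].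
    apply/exists_inP; exists u => //; have := subsetP h1 u us; by rewrite -mE inE e10.
  + rewrite g2 mq; have -> : has (fun c => arr s1 2 c != arr s 10 0) (codes j) = ~~ (edge j \subset marked s').
      rewrite has_codes -mE; apply/exists_inP/subsetPn => -[u ue h]; exists u => //; move: h; by rewrite inE e10.
    case: (P) => /=; last exact: h4.
    case: (boolP (edge j \subset marked s')) => hj /=; first by rewrite (setUidPl hj) h4.
    case: eqP => // eU; have := subset_trans (subsetUr (marked s') (edge j)) (_ : _ \subset marked s).
    by rewrite -eU => /(_ (subxx _)) h; case/negP: hj; apply: subset_trans h _; rewrite eU.
  + by rewrite g1 (h5 : arr s1 2 0 = 0); case: ifP => // /andP[_ /codes_gt1].
  + move=> l; rewrite g1; case: ifP => // _; exact: h6.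
rewrite em in h3 ht; split=> //.
  split=> // e eR; have [j [jm _ _ ej]] := keptP (a := m) (s := s) (es := es) (f := e) ltac:(by move: eR; rewrite inE => /andP[]).
  by rewrite ej in eR *; apply: h3.
by rewrite /p hp; apply: leq_trans (loop_cost_le W Size (flood_body d) (leqnn m)); rewrite leq_add2r.
Qed.

Definition flood_cost := bound W (Let 10 (Add (Var 10) (Cst 1))) + bound W (SetA 2 (Var 15) (Var 10)) +
  bound W (Let 12 (Cst 1)) + esize W (Add (Cst 1) (Any d (fun _ => Size))) + 2 +
  d.+1 * (esize W (Var 12) + 10) + bound W (Let 12 (Cst 0)) + loop_cost Size (flood_body d).

(** The cost follows the size of the component and not the number of rounds: each true sweep but the
    last marks a new vertex, and a round after the last sweep costs only a constant. *)
Lemma exec_flood s a (x : 'I_n) : slots s -> arr s 1 1 = m -> arr s 2 0 = 0 ->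
  arr s 14 0 = a -> a != 0 -> arr s 15 0 = val x + 2 -> (forall l, arr s 2 l <= arr s 10 0) ->
  let p := exec (flood d) s in
  [/\ arr p.1 2 0 = 0, forall l, arr p.1 2 l <= arr p.1 10 0, arr p.1 10 0 = (arr s 10 0).+1,
     marked p.1 = component (unblocked s a) x &
     p.2 <= flood_cost * (m.+1 * (#|component (unblocked s a) x|).+1)].
Proof.
move=> sl e1 z0 e14 a0 e15 le p; set R := unblocked s a; set C := component R x.
set s1 := (exec (Let 10 (Add (Var 10) (Cst 1))) s).1.
set s2 := (exec (SetA 2 (Var 15) (Var 10)) s1).1.
set s3 := (exec (Let 12 (Cst 1)) s2).1.
have e10 : arr s1 10 0 = (arr s 10 0).+1 by rewrite /s1 /Let exec_set arr_set /= addn1.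
have E2 l : arr s3 2 l = if l == val x + 2 then (arr s 10 0).+1 else arr s 2 l.
  by rewrite /= e15 /= addn1.
have E k l : k != 2 -> k != 10 -> k != 12 -> arr s3 k l = arr s k l.
  by move=> h1 h2 h3; rewrite /= (negbTE h1) (negbTE h2) (negbTE h3).
have e103 : arr s3 10 0 = (arr s 10 0).+1 by [].
have sl3 : slots s3 by move=> j k hj hk; rewrite E ?sl // /SL; lia.
have m3 : marked s3 = [set x].
  apply/setP => u; rewrite !inE e103 E2 (inj_eq (@addIn 2)) (inj_eq val_inj).
  case: (eqVneq u x) => [_|_]; first by rewrite eqxx.
  by apply/negbTE; rewrite neq_ltn ltnS le.
have Rsub : R \subset kept s m by apply/subsetP => f; rewrite inE => /andP[].
have rkR e : e \in R -> #|e| <= d by move=> /(subsetP Rsub); apply: rk_kept.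
have cR : #|R| <= m.
  apply: leq_trans (card_size es); apply: subset_leq_card; apply/subsetP => f /(subsetP Rsub).
  by rewrite inE => /and3P[].
have cC : #|C| <= 1 + d * m.
  apply: leq_trans (card_component x rkR) _; rewrite leq_add2l leq_mul2l; apply/orP; right.
  by apply: leq_trans cR; apply: subset_leq_card; apply: component_edges_sub.
have sweeps : eval s3 (Add (Cst 1) (Any d (fun _ => Size))) = 1 + d * m.
  have -> : eval s3 (Add (Cst 1) (Any d (fun _ => Size))) = 1 + eval s3 (Any d (fun _ => Size)) by [].
  congr (_ + _); rewrite /Any -{2}(size_iota 0 d).
  by elim: (iota 0 d) => //= k l ->; rewrite e1 mulSn.
have lf : loopfree (flood_body d) by nw.
set q := exec (flood_loop d) s3.
(* [r] counts the sweeps made, and a raised flag reserves one marked vertex for the next sweep.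
   While the flag is up there are more than [i] marked vertices, so it is down after [1 + d * m]
   rounds. *)
have [||t [h1 h2 h3 h4 [r ht]] hq] := @for_rule W D 8 (Add (Cst 1) (Any d (fun _ => Size))) (sweep_round d) s3
  (fun i s' t => [/\ x \in marked s', marked s' \subset C, arr s' 2 0 = 0 /\ (forall l, arr s' 2 l <= arr s3 10 0),
    if arr s' 12 0 == 0 then forall e, e \in R -> ~~ [disjoint e & marked s'] -> e \subset marked s'
    else i < #|marked s'| &
    exists r, r + (arr s' 12 0 != 0) <= #|marked s'| /\
     t <= i * (esize W (Var 12) + 10) + r * (bound W (Let 12 (Cst 0)) + loop_cost Size (flood_body d) * m.+1)]).
- rewrite m3 inE eqxx [arr s3 12 0]/= cards1; split=> //.
  + by rewrite sub1set; apply/componentP; exists 0.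
  + split; first by rewrite E2 addn2.
    by move=> l; rewrite E2 e103; case: eqP => // _; rewrite leqW.
  + by exists 0.
- move=> i s' t; rewrite sweeps => im sm [h1 h2 [h3 h3'] h4 [r [hr ht]]].
  set s4 := set_arr s' 8 0 i.
  have m4 : marked s4 = marked s' by [].
  have fr k l : nowrite k (flood_loop d) -> arr s4 k l = arr s3 k l.
    by move=> h; rewrite arr_set -(sm k l h); case: eqP => // ek; move: h; rewrite ek.
  have cw := cost_when W D (Var 12) (Seq (Let 12 (Cst 0)) (sweep d)) s4.
  rewrite -/(sweep_round d) in cw.
  have ew := exec_when W D (Var 12) (Seq (Let 12 (Cst 0)) (sweep d)) s4.
  rewrite -/(sweep_round d) in ew.
  have e12 : eval s4 (Var 12) = arr s' 12 0 by [].
  rewrite e12 in cw ew; case: (eqVneq (arr s' 12 0) 0) h4 hr ew cw => [z|nz] h4 hr ew cw.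
    have {}cw : (exec (sweep_round d) s4).2 <= esize W (Var 12) + 2 + 0 := cw.
    rewrite (ew : _ = s4) m4 (z : arr s4 12 0 = 0) eqxx; split=> //.
    exists r; split; first by exact: hr.
    by rewrite mulSn; lia.
  have {}ew : _ = (exec (Seq (Let 12 (Cst 0)) (sweep d)) s4).1 := ew.
  have {}cw : (exec (sweep_round d) s4).2 <= esize W (Var 12) + 2 + (exec (Seq (Let 12 (Cst 0)) (sweep d)) s4).2 := cw.
  set s5 := (exec (Let 12 (Cst 0)) s4).1.
  have e5 k l : k != 12 -> arr s5 k l = arr s4 k l by move=> h; rewrite /= (negbTE h).
  have sl5 : slots s5.
    move=> j k hj hk; rewrite e5 /SL; last by lia.
    by rewrite fr ?sl3 //; nw.
  have e105 : arr s5 10 0 = (arr s 10 0).+1 by rewrite e5 // fr //; nw.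
  have m5 : marked s5 = marked s' by rewrite -m4; apply/setP => u; rewrite !inE !e5.
  have R5 : unblocked s5 a = R.
    by apply/setP => f; rewrite !inE e5 // fr ?E //; nw.
  have [||||||[g1 g2 g3] g4 g5 g6 g7] := @exec_sweep s5 a sl5.
  + by rewrite e5 // fr ?E //; nw.
  + by rewrite e5.
  + by rewrite e105.
  + by rewrite e5 // fr ?E //; nw.
  + exact: a0.
  + by move=> l; rewrite e105 (e5 2) // -e103; apply: h3'.
  rewrite R5 m5 in g1 g2 g3 g4 g7; rewrite e105 in g6.
  set s6 := (exec (sweep d) s5).1 in g1 g2 g3 g4 g5 g6 *.
  have -> : (exec (sweep_round d) s4).1 = s6 by rewrite ew.
  have cst : (exec (sweep_round d) s4).2 <= esize W (Var 12) + 2 + (bound W (Let 12 (Cst 0)) + loop_cost Size (flood_body d) * m.+1).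
    by apply: leq_trans cw _; rewrite leq_add2l leq_add2l.
  rewrite g4 [arr s5 12 0]/=; split=> //.
  + exact: (subsetP g1).
  + exact: g2.
  + by split=> // l; rewrite e103; apply: g6.
  + have [eq|ne] := eqVneq (marked s6) (marked s').
      by rewrite eq in g3 *; exact: g3.
    rewrite [_ == 0]/=.
    apply: leq_trans (_ : #|marked s'|.+1 <= _); first exact: h4.
    by apply: proper_card; rewrite properEneq eq_sym ne.
  + exists r.+1; split.
      have [eq|ne] := eqVneq (marked s6) (marked s').
        by rewrite eq [nat_of_bool _]/=; move: hr; rewrite addn0 addn1.
      rewrite [nat_of_bool _]/=.
      apply: leq_trans (_ : #|marked s'|.+1 <= _); first by lia.
      by apply: proper_card; rewrite properEneq eq_sym ne.
    move: cst ht; move: (exec _ _).2 (esize _ _) (bound _ _ + _) => y1 y2 y3; rewrite !mulSn; lia.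
rewrite sweeps in h4 ht; have pE : p.1 = q.1 by [].
have q10 : arr q.1 10 0 = (arr s 10 0).+1 by rewrite exec_same ?e103 //; nw.
case: h3 => h3 h3'; rewrite pE; split=> //.
- by move=> l; rewrite q10 -e103; apply: h3'.
- apply/eqP; rewrite eqEsubset h2 /=; apply/subsetP => u /componentP ju.
  move: h4; case: eqP => [_|_] h4; last first.
    by have := leq_trans h4 (leq_trans (subset_leq_card h2) cC); rewrite ltnn.
  apply: joined_closed ju h1 => e eR; rewrite orbC; case: (boolP [disjoint e & _]) => //= nd; exact: h4.
- have -> : p.2 = (exec (Let 10 (Add (Var 10) (Cst 1))) s).2 + ((exec (SetA 2 (Var 15) (Var 10)) s1).2 +
    ((exec (Let 12 (Cst 1)) s2).2 + q.2)) by [].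
  have k1 := exec_bound W D s (c := Let 10 (Add (Var 10) (Cst 1))) isT.
  have k2 := exec_bound W D s1 (c := SetA 2 (Var 15) (Var 10)) isT.
  have k3 := exec_bound W D s2 (c := Let 12 (Cst 1)) isT.
  have rC : r <= #|C| by case: ht => [hr _]; exact: leq_trans (leq_trans (leq_addr _ _) hr) (subset_leq_card h2).
  case: ht => _ ht; move: k1 k2 k3 ht; rewrite hq /flood_cost.
  move: (exec _ s).2 (exec _ s1).2 (exec _ s2).2 (bound _ _) (bound _ _) (bound _ _) (bound _ _) => y1 y2 y3 x1 x2 x3 x4.
  move: (loop_cost _ _) (esize _ _) (esize _ _) (#|C|) rC => x5 x6 x7 c rc k1 k2 k3 ht.
  have N0 : 0 < m.+1 * c.+1 by [].
  have h5 : r * (x1 + x5 * m.+1) <= (x1 + x5) * (m.+1 * c.+1).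
    rewrite mulnDr mulnDl; apply: leq_add.
      by rewrite mulnC leq_mul2l (leq_trans rc) ?orbT // (leq_trans (leqnSn c)) // leq_pmull.
    by rewrite mulnCA leq_mul2l mulnC leq_mul2l leqW ?orbT.
  have h6 : (1 + d * m) * (x7 + 10) <= d.+1 * (x7 + 10) * (m.+1 * c.+1).
    rewrite -mulnA mulnCA mulnC leq_mul2l; apply/orP; right.
    rewrite mulnA; apply: leq_trans (leq_pmulr _ _) => //; by rewrite mulnS; lia.
  have g A : A <= A * (m.+1 * c.+1) by rewrite leq_pmulr.
  have g1 := leq_trans k1 (g _); have g2 := leq_trans k2 (g _); have g3 := leq_trans k3 (g _).
  have g4 := g x6; have g5 := g 2; move: (m.+1 * c.+1) g1 g2 g3 g4 g5 h5 h6 ht => N.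
  move: (d.+1 * (x7 + 10)) (r * _) ((1 + d * m) * _) => z u w.
  by clear; rewrite !mulnDl; lia.
Qed.

End Flood.

Section Flags.
Variables (W D : nat).
Notation exec := (exec W D).
Notation eval := (eval D).

(** For loops that only raise the flag [g]; [J] carries the rest of the state, and iterations may
    differ in cost. *)
Lemma accum_for j e c s g (J : state -> Prop) (P : pred nat) (B : nat -> nat) : J s ->
  (forall i s', i < eval s e -> same (For j e c) s s' -> J s' -> let q := exec c (set_arr s' j 0 i) in
     [/\ J q.1, (arr q.1 g 0 != 0) = (arr s' g 0 != 0) || P i & q.2 <= B i]) ->
  let q := exec (For j e c) s in [/\ J q.1, (arr q.1 g 0 != 0) = (arr s g 0 != 0) || has P (iota 0 (eval s e)) &
    q.2 <= \sum_(i < eval s e) (B i + 8) + (esize W e + 2)].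
Proof.
move=> J0 step.
have [||t [h1 h2 h3] ht] := @for_rule W D j e c s (fun i s' t => [/\ J s', (arr s' g 0 != 0) = (arr s g 0 != 0) || has P (iota 0 i) &
   t <= \sum_(k < i) (B k + 8)]).
- by rewrite big_ord0 orbF.
- move=> i s' t hi sm [h1 h2 h3]; have [g1 g2 g3] := step i s' hi sm h1.
  split=> //; first by rewrite g2 h2 has_iotaS orbA.
  by rewrite big_ord_recr -addnA; apply: leq_add => //; rewrite leq_add2r.
- by split=> //; rewrite ht leq_add2r.
Qed.

Lemma accum_unroll n f s g (J : state -> Prop) (P : pred nat) B : J s ->
  (forall k s', k < n -> same (Unroll n f) s s' -> J s' -> let q := exec (f k) s' in
     [/\ J q.1, (arr q.1 g 0 != 0) = (arr s' g 0 != 0) || P k & q.2 <= B]) ->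
  let q := exec (Unroll n f) s in [/\ J q.1, (arr q.1 g 0 != 0) = (arr s g 0 != 0) || has P (iota 0 n) & q.2 <= n * B].
Proof.
move=> J0 step.
apply: (@unroll_rule W D n f s (fun i s' t => [/\ J s', (arr s' g 0 != 0) = (arr s g 0 != 0) || has P (iota 0 i) & t <= i * B])).
  by rewrite orbF.
move=> i s' t hi sm [h1 h2 h3]; have [g1 g2 g3] := step i s' hi sm h1.
split=> //; first by rewrite g2 h2 has_iotaS orbA.
by rewrite mulSnr; apply: leq_add.
Qed.

End Flags.

(** * Recognising a component that is not interval *)

Section DetectProgram.
Variable d : nat.
(** In terms of [component_detect]: array 19 holds the index of [f1], 14 the vertex [a], 15 the
    vertex [x]. The current edge plays [f2], and its slot [k] is [y] if the flood has reached it and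
    [f1] does not contain it. *)
Definition check_slot k := When (Slot k (Var 7)) (When (Eq (Arr 2 (Slot k (Var 7))) (Var 10))
  (When (Not (Contains d (Var 19) (Slot k (Var 7)))) (Let 16 (Cst 1)))).
Definition check_body := When (Not (Arr 0 (Var 7))) (When (Contains d (Var 7) (Var 14))
  (When (Not (Contains d (Var 7) (Var 15))) (Unroll d check_slot))).
Definition check_loop := For 7 Size check_body.
Definition try_core k k1 := Seq (Let 14 (Slot k (Var 19))) (Seq (Let 15 (Slot k1 (Var 19)))
  (Seq (flood d) check_loop)).
Definition try_pair k k1 := When (Slot k (Var 19)) (When (Slot k1 (Var 19)) (try_core k k1)).
Definition detect_body := When (Not (Arr 0 (Var 19))) (When (Contains d (Var 19) (Var 13))
  (Unroll d (fun k => Unroll d (try_pair k)))).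
Definition detect_loop := For 19 Size detect_body.
End DetectProgram.

Section Detect.
Variables (d W D n : nat) (es : seq {set 'I_n}).
Hypotheses (d2 : 2 <= d) (ues : uniq es) (rk : forall e, e \in es -> #|e| <= d).
Notation eval := (eval D).
Notation exec := (exec W D).
Notation m := (size es).
Notation edge := (nth set0 es).
Notation slots := (slots d es).
Notation codes := (codes es).
Notation kept := (kept es).
Notation loop_cost := (loop_cost W).

Lemma unblocked_vertex s (a : 'I_n) : unblocked es s (val a + 2) = avoiding (kept s m) a.
Proof.
apply/setP => f; rewrite !inE; case: (boolP (f \in es)) => //= fe.
by rewrite mem_codes nth_index.
Qed.

Lemma unblocked1 s : unblocked es s 1 = kept s m.
Proof.
apply/setP => f; rewrite in_set; case: (f \in _) => //=; apply/negP => /codes_gt1; by rewrite ltnn.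
Qed.

Lemma has_edge_codes j (P : pred nat) (Q : pred 'I_n) : (forall u : 'I_n, u \in edge j -> P (val u + 2) = Q u) ->
  has P (codes j) = [exists u in edge j, Q u].
Proof.
move=> h; rewrite has_codes; apply/exists_inP/exists_inP => -[u ue hu]; exists u => //; by move: hu; rewrite h.
Qed.

Lemma exec_check s j2 (a x : 'I_n) : slots s -> arr s 1 1 = m -> arr s 2 0 = 0 -> 0 < arr s 10 0 -> j2 < m ->
  arr s 19 0 = j2 -> arr s 14 0 = val a + 2 -> arr s 15 0 = val x + 2 -> let q := exec (check_loop d) s in
  (arr q.1 16 0 != 0) = (arr s 16 0 != 0) || has (fun j => [&& arr s 0 j == 0, a \in edge j, x \notin edge j &
     [exists y in edge j, (y \in marked n s) && (y \notin edge j2)]]) (iota 0 m) /\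
  q.2 <= loop_cost Size (check_body d) * m.+1.
Proof.
move=> sl e1 z0 st0 jm2 e19 e14 e15 q.
have em : eval s Size = m by rewrite /= e1.
have lf : loopfree (check_body d) by nw.
have [||_ h1 h2] := @accum_for W D 7 Size (check_body d) s 16 (fun _ => True) (fun j => [&& arr s 0 j == 0, a \in edge j, x \notin edge j &
     [exists y in edge j, (y \in marked n s) && (y \notin edge j2)]]) (fun=> bound W (check_body d)).
- by [].
- move=> j s' ; rewrite em => jm sm _; set s1 := set_arr s' 7 0 j; split=> //; last exact: exec_bound.
  have fr k l : nowrite k (check_loop d) -> arr s1 k l = arr s k l.
    by move=> h; rewrite arr_set -(sm k l h); case: eqP => // ek; move: h; rewrite ek.
  have sl1 : slots s1 by apply: (slots_same (c := check_loop d) sl) => [k l h|k]; [exact: fr | nw].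
  have f0 l : arr s1 0 l = arr s 0 l by apply: fr; nw.
  have f2 l : arr s1 2 l = arr s 2 l by apply: fr; nw.
  have f10 l : arr s1 10 l = arr s 10 l by apply: fr; nw.
  have f14 l : arr s1 14 l = arr s 14 l by apply: fr; nw.
  have f15 l : arr s1 15 l = arr s 15 l by apply: fr; nw.
  have f19 l : arr s1 19 l = arr s 19 l by apply: fr; nw.
  have e7 : eval s1 (Var 7) = j by [].
  have v14 : eval s1 (Var 14) = val a + 2 by rewrite -e14 -f14.
  have v15 : eval s1 (Var 15) = val x + 2 by rewrite -e15 -f15.
  have v0 : eval s1 (Arr 0 (Var 7)) = arr s 0 j by rewrite -f0.
  rewrite /check_body exec_when test_not v0.
  case: (arr s 0 j == 0); last by rewrite orbF.
  rewrite exec_when (eval_contains rk) ?e7 //; last by rewrite v14 addn2.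
  rewrite v14 mem_codes; case: (a \in edge j); last by rewrite orbF.
  rewrite exec_when test_not -[eval _ (Contains _ _ _) == 0]negbK (eval_contains rk) ?e7 //; last by rewrite v15 addn2.
  rewrite v15 mem_codes; case: (x \notin edge j); last by rewrite orbF.
  rewrite !andTb.
  pose P c := [&& c != 0, arr s 2 c == arr s 10 0 & c \notin codes j2].
  have [||_ -> _] := @accum_unroll W D d (check_slot d) s1 16 (fun _ => True) (fun k => P (arr s1 (SL k) j)) (\max_(k < d) bound W (check_slot d k)).
  + by [].
  + move=> k s2 kd sm2 _; split=> //; last first.
      apply: leq_trans (exec_bound _ _ _ _) _; first by nw.
      exact: (leq_bigmax (F := fun k : 'I_d => bound W (check_slot d k)) (Ordinal kd)).
    have fr2 k' l : k' != 16 -> arr s2 k' l = arr s1 k' l.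
      by move=> h; apply: sm2; apply: nowrite_unroll => k0; rewrite /= h.
    have sl2 : slots s2 by move=> j' k' hj hk; rewrite fr2 ?sl1 // /SL; lia.
    have vk : eval s2 (Slot k (Var 7)) = arr s1 (SL k) j.
      rewrite /= !fr2 //; rewrite /SL; lia.
    have v2 : eval s2 (Arr 2 (Slot k (Var 7))) = arr s 2 (arr s1 (SL k) j) by rewrite -vk -f2 -fr2.
    have v10 : eval s2 (Var 10) = arr s 10 0 by rewrite -f10 -fr2.
    rewrite /check_slot exec_when vk /P.
    case: (eqVneq (arr s1 (SL k) j) 0) => [_|nz]; first by rewrite orbF.
    rewrite exec_when test_eq v2 v10; case: (arr s 2 _ == _); last by rewrite orbF.
    have v19 : eval s2 (Var 19) = j2 by rewrite -e19 -f19 -fr2.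
    rewrite exec_when test_not -[eval _ (Contains _ _ _) == 0]negbK (eval_contains rk) ?v19 ?vk //.
    case: (_ \notin codes j2); last by rewrite orbF.
    by rewrite orbT.
  rewrite (has_slot rk (f := P)) //; congr (_ || _).
  apply: has_edge_codes => u _; by rewrite /P mem_codes inE addn2.
rewrite em in h1 h2; split=> //; apply: leq_trans h2 _.
rewrite sum_nat_const card_ord; exact: loop_cost_le.
Qed.

(** The configuration of [component_detect] with [f1], [a] and [x] given. *)
Definition hit (F : {set {set 'I_n}}) (e : {set 'I_n}) (a x : 'I_n) := [exists f in F, [&& a \in f, x \notin f &
  [exists y in f, (y \in component (avoiding F a) x) && (y \notin e)]]].

Definition ready s := arr s 2 0 = 0 /\ forall l, arr s 2 l <= arr s 10 0.

Definition try_cost := \max_(k < d) (bound W (Let 14 (Slot k (Var 19))) + bound W (Let 15 (Slot k (Var 19))) + 2 * esize W (Slot k (Var 19))) + 4 +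
  flood_cost d W + loop_cost Size (check_body d).

(** [N] will be the size of the component under examination, in which all flooded components lie. *)
Lemma exec_try s k k1 j2 N : slots s -> arr s 1 1 = m -> ready s -> j2 < m -> arr s 19 0 = j2 -> k < d -> k1 < d ->
  (forall a x, x \in edge j2 -> #|component (avoiding (kept s m) a) x| <= N) ->
  let q := exec (try_pair d k k1) s in
  [/\ ready q.1, (arr q.1 16 0 != 0) = (arr s 16 0 != 0) || [exists a, exists x, [&& nth 0 (codes j2) k == val a + 2,
      nth 0 (codes j2) k1 == val x + 2 & hit (kept s m) (edge j2) a x]] & q.2 <= (2 * try_cost) * (m.+1 * N.+1)].
Proof.
move=> sl e1 rd jm e19 kd kd1 hN q.
have vk k' : k' < d -> eval s (Slot k' (Var 19)) = nth 0 (codes j2) k' by move=> h; rewrite /= e19 sl.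
have M0 : 0 < m.+1 * N.+1 by [].
have lek k' : k' < d -> bound W (Let 14 (Slot k' (Var 19))) + bound W (Let 15 (Slot k' (Var 19))) + 2 * esize W (Slot k' (Var 19)) + 4 +
  flood_cost d W + loop_cost Size (check_body d) <= try_cost.
  move=> h; rewrite /try_cost !leq_add2r.
  exact: (leq_bigmax (F := fun k : 'I_d => bound W (Let 14 (Slot k (Var 19))) + bound W (Let 15 (Slot k (Var 19))) + 2 * esize W (Slot k (Var 19))) (Ordinal h)).
have cw := cost_when W D (Slot k (Var 19)) (When (Slot k1 (Var 19)) (try_core d k k1)) s.
have cw1 := cost_when W D (Slot k1 (Var 19)) (try_core d k k1) s.
rewrite -/(try_pair d k k1) -/q in cw; rewrite /q /try_pair exec_when; rewrite (vk k kd) in cw *; rewrite (vk k1 kd1) in cw1.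
have small t : t <= try_cost -> t <= (2 * try_cost) * (m.+1 * N.+1).
  by move=> h; apply: leq_trans h _; rewrite -mulnA mulnC -mulnA leq_pmulr // muln_gt0 M0.
have none : nth 0 (codes j2) k = 0 \/ nth 0 (codes j2) k1 = 0 -> [exists a : 'I_n, exists x : 'I_n, [&& nth 0 (codes j2) k == val a + 2,
      nth 0 (codes j2) k1 == val x + 2 & hit (kept s m) (edge j2) a x]] = false.
  by move=> h; apply/existsP => -[a /existsP[x /and3P[/eqP h1 /eqP h2 _]]]; case: h; rewrite ?h1 ?h2 addn2.
case: (eqVneq (nth 0 (codes j2) k) 0) cw none => [z|nz] cw none.
  rewrite none ?orbF; last by left. split=> //; rewrite -/(try_pair d k k1) -/q.
    apply: small; apply: leq_trans (lek _ kd).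
    have {}cw : q.2 <= esize W (Slot k (Var 19)) + 2 + 0 := cw.
    by move: cw; move: (esize _ _) (bound _ _) (bound _ _) (flood_cost _ _) (loop_cost _ _); clear; lia.
rewrite exec_when vk //.
case: (eqVneq (nth 0 (codes j2) k1) 0) cw1 none => [z|nz1] cw1 none.
  rewrite none ?orbF; last by right. split=> //; rewrite -/(try_pair d k k1) -/q; apply: small.
  have {}cw : q.2 <= esize W (Slot k (Var 19)) + 2 + (exec (When (Slot k1 (Var 19)) (try_core d k k1)) s).2 := cw.
  have {}cw1 : (exec (When (Slot k1 (Var 19)) (try_core d k k1)) s).2 <= esize W (Slot k1 (Var 19)) + 2 + 0 := cw1.
  have l1 := lek _ kd; have l2 := lek _ kd1; move: cw cw1 l1 l2.
  move: (esize _ _) (esize _ _) (exec _ _).2 (bound _ _) (bound _ _) (bound _ _) (bound _ _) (flood_cost _ _) (loop_cost _ _) try_cost q.2.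
  by clear; lia.
have [a ae ha] := of_slot nz; have [x xe hx] := of_slot nz1.
set s1 := (exec (Let 14 (Slot k (Var 19))) s).1.
set s2 := (exec (Let 15 (Slot k1 (Var 19))) s1).1.
have E k' l : k' != 14 -> k' != 15 -> arr s2 k' l = arr s k' l by move=> h1 h2; rewrite /= (negbTE h1) (negbTE h2).
have f14 : arr s2 14 0 = val a + 2 by rewrite -ha -(vk k kd).
have f15 : arr s2 15 0 = val x + 2.
  rewrite -hx -(vk k1 kd1) /s2 /Let exec_set arr_set /= ; congr (arr _ _ _); rewrite /SL; lia.
have sl2 : slots s2 by move=> j' k' hj hk; rewrite E ?sl // /SL; lia.
have [r0 r1] := rd.
have [] := @exec_flood d W D n es ues rk s2 (val a + 2) x sl2 ltac:(by rewrite E) ltac:(by rewrite E) f14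
  ltac:(by rewrite addn2) f15 ltac:(by move=> l; rewrite !E).
set s3 := (exec (flood d) s2).1 => h1 h2 h3 h4 h5.
have sm3 : same (flood d) s2 s3 := exec_same W D s2.
have sl3 : slots s3 by apply: (slots_same sl2 sm3) => k'; nw.
have [] := @exec_check s3 j2 a x sl3.
- by rewrite sm3 ?E //; nw.
- by [].
- by rewrite h3.
- by [].
- by rewrite sm3 ?E //; nw.
- by rewrite sm3 //; nw.
- by rewrite sm3 //; nw.
set s4 := (exec (check_loop d) s3).1 => g1 g2.
have sm4 : same (check_loop d) s3 s4 := exec_same W D s3.
have -> : (exec (try_core d k k1) s).1 = s4 by [].
have UE : unblocked es s2 (val a + 2) = avoiding (kept s m) a by rewrite unblocked_vertex (@kept_eq _ _ s).
split.
- split; first by rewrite sm4 ?h1 //; nw.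
  by move=> l; rewrite !sm4; try nw; exact: h2.
- rewrite g1 sm3; last by nw. rewrite E //; congr (_ || _).
  have keep l : arr s3 0 l = arr s 0 l by rewrite sm3 ?E //; nw.
  rewrite h4 UE; apply/hasP/existsP.
    move=> [j]; rewrite mem_iota => /= jm' /and4P[out aj xj /exists_inP[y yj yh]].
    exists a; apply/existsP; exists x; rewrite ha hx !eqxx; apply/exists_inP; exists (edge j).
      by rewrite mem_kept // jm' -keep.
    by rewrite aj xj; apply/exists_inP; exists y.
  move=> [a' /existsP[x' /and3P[]]]; rewrite ha hx !(inj_eq (@addIn 2)) !(inj_eq val_inj) => /eqP<- /eqP<-.
  move=> /exists_inP[f /keptP[j [jm' _ out ->]]] h; exists j; first by rewrite mem_iota.
  by rewrite keep out.
- rewrite -/(try_pair d k k1) -/q.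
  have cE : (exec (try_core d k k1) s).2 = (exec (Let 14 (Slot k (Var 19))) s).2 + ((exec (Let 15 (Slot k1 (Var 19))) s1).2 +
     ((exec (flood d) s2).2 + (exec (check_loop d) s3).2)) by [].
  have k2 := exec_bound W D s (c := Let 14 (Slot k (Var 19))) isT.
  have k3 := exec_bound W D s1 (c := Let 15 (Slot k1 (Var 19))) isT.
  rewrite UE in h5.
  have h5' : (exec (flood d) s2).2 <= flood_cost d W * (m.+1 * N.+1).
    by apply: leq_trans h5 _; rewrite !leq_mul2l ltnS hN ?orbT.
  have g2' : (exec (check_loop d) s3).2 <= loop_cost Size (check_body d) * (m.+1 * N.+1).
    by apply: leq_trans g2 _; rewrite leq_mul2l leq_pmulr ?orbT.
  have {}cw : q.2 <= esize W (Slot k (Var 19)) + 2 + (exec (When (Slot k1 (Var 19)) (try_core d k k1)) s).2 := cw.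
  have {}cw1 : (exec (When (Slot k1 (Var 19)) (try_core d k k1)) s).2 <= esize W (Slot k1 (Var 19)) + 2 + (exec (try_core d k k1) s).2 := cw1.
  have l1 := lek _ kd; have l2 := lek _ kd1; move: cw cw1 cE k2 k3 h5' g2' l1 l2.
  move: (esize _ _) (esize _ _) (exec _ _).2 (exec _ _).2 (exec _ _).2 (exec _ _).2 (exec _ _).2 (exec _ _).2 (bound _ _) (bound _ _) (bound _ _) (bound _ _) (flood_cost _ _) (loop_cost _ _) q.2 try_cost M0.
  move: (m.+1 * N.+1) => M; clear; nia.
Qed.

End Detect.

Section Detection.
Variables (d W D n : nat) (es : seq {set 'I_n}).
Hypotheses (d2 : 2 <= d) (ues : uniq es) (rk : forall e, e \in es -> #|e| <= d).
Notation eval := (eval D).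
Notation exec := (exec W D).
Notation m := (size es).
Notation edge := (nth set0 es).
Notation slots := (slots d es).
Notation codes := (codes es).
Notation kept := (kept es).
Notation loop_cost := (loop_cost W).

Lemma avoiding_component (F : {set {set 'I_n}}) a v x : x \in component F v ->
  component (avoiding F a) x \subset component F v.
Proof.
move=> /componentP vx; apply/subsetP => y /componentP xy; apply/componentP.
apply: joined_trans vx (joined_sub _ xy); apply/subsetP => f; exact: avoidingF.
Qed.

Lemma sum_edges (F : {set {set 'I_n}}) c : \sum_(i < m) (if edge i \in F then c else 0) <= #|F| * c.
Proof.
rewrite -big_mkcond /= sum_nat_const leq_mul2r; apply/orP; right.
rewrite -(card_in_imset (f := fun i : 'I_m => edge i)); last first.
  by move=> i j _ _ h; apply: val_inj; apply: (edge_inj ues) h.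
by apply: subset_leq_card; apply/subsetP => f /imsetP[i h ->].
Qed.

Definition detect_cost := esize W (Not (Arr 0 (Var 19))) + 2 + (esize W (Contains d (Var 19) (Var 13)) + 2) + 8 +
  2 ^ (2 * d) * (d * (d * (2 * try_cost d W))) + (esize W Size + 2).

(** Only edges at [v] are tried as [f1]; there are at most [2 ^ (2 * d)] of them, each with at most
    [d * d] pairs of slots, so the number of floods is bounded. Every other edge costs a
    constant. *)
Lemma exec_detect s (v : 'I_n) : slots s -> arr s 1 1 = m -> ready s -> arr s 13 0 = val v + 2 ->
  arr s 16 0 = 0 -> locally_interval (kept s m) d -> let F := kept s m in let q := exec (detect_loop d) s in
  [/\ ready q.1, (arr q.1 16 0 != 0) <-> ~ interval (component_edges F v) &
   q.2 <= detect_cost * (m.+1 * (#|component F v|).+1)].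
Proof.
move=> sl e1 rd e13 e16 loc F q; set N := #|component F v|.
have em : eval s Size = m by rewrite /= e1.
have rkF e : e \in F -> #|e| <= d by apply: rk_kept.
pose T j k k1 := [exists a, exists x, [&& nth 0 (codes j) k == val a + 2, nth 0 (codes j) k1 == val x + 2 & hit F (edge j) a x]].
pose P j := [&& arr s 0 j == 0, v \in edge j & has (fun k => has (T j k) (iota 0 d)) (iota 0 d)].
pose b0 := esize W (Not (Arr 0 (Var 19))) + 2 + (esize W (Contains d (Var 19) (Var 13)) + 2).
pose star := [set e in F | v \in e].
pose M := m.+1 * N.+1.
have [||h1 h2 h3] := @accum_for W D 19 Size (detect_body d) s 16 ready P
  (fun j => b0 + (if edge j \in star then d * (d * (2 * try_cost d W * M)) else 0)).
- exact: rd.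
- move=> j s'; rewrite em => jm sm rd'; set s1 := set_arr s' 19 0 j => q1.
  have fr k l : nowrite k (detect_loop d) -> arr s1 k l = arr s k l.
    by move=> h; rewrite arr_set -(sm k l h); case: eqP => // ek; move: h; rewrite ek.
  have sl1 : slots s1 by apply: (slots_same (c := detect_loop d) sl) => [k l h|k]; [exact: fr | nw].
  have f0 l : arr s1 0 l = arr s 0 l by apply: fr; nw.
  have e19 : eval s1 (Var 19) = j by [].
  have v13 : eval s1 (Var 13) = val v + 2 by rewrite -e13 -fr //; nw.
  have v0 : eval s1 (Arr 0 (Var 19)) = arr s 0 j by rewrite -f0.
  have rd1 : ready s1 by [].
  have k1 : kept s1 m = F by apply: kept_eq.
  have cw := cost_when W D (Not (Arr 0 (Var 19))) (When (Contains d (Var 19) (Var 13)) (Unroll d (fun k => Unroll d (try_pair d k)))) s1.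
  have cw1 := cost_when W D (Contains d (Var 19) (Var 13)) (Unroll d (fun k => Unroll d (try_pair d k))) s1.
  rewrite -/(detect_body d) -/q1 test_not v0 in cw.
  have ct : (eval s1 (Contains d (Var 19) (Var 13)) != 0) = (v \in edge j).
    by rewrite (eval_contains rk) ?e19 ?v13 ?mem_codes // addn2.
  rewrite ct in cw1.
  have oE : edge j \in star = (arr s 0 j == 0) && (v \in edge j) by rewrite in_set mem_kept // jm.
  rewrite oE.
  have -> : q1.1 = if (arr s 0 j == 0) && (v \in edge j) then (exec (Unroll d (fun k => Unroll d (try_pair d k))) s1).1 else s1.
    rewrite /q1 /detect_body exec_when test_not v0; case: (_ == 0) => //.
    by rewrite exec_when ct.
  rewrite /P; case: (eqVneq (arr s 0 j) 0) cw => [out|_] cw; last first.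
    rewrite /= orbF; split=> //; rewrite addn0; apply: leq_trans cw _; rewrite addn0 /b0; exact: leq_addr.
  have {}cw : q1.2 <= esize W (Not (Arr 0 (Var 19))) + 2 + (exec (When (Contains d (Var 19) (Var 13)) (Unroll d (fun k => Unroll d (try_pair d k)))) s1).2 := cw.
  case: (boolP (v \in edge j)) cw1 => vj cw1; last first.
    by rewrite orbF; split=> //; rewrite addn0; apply: leq_trans cw _; rewrite /b0 leq_add2l; rewrite addn0 in cw1.
  have [||g1 g2 g3] := @accum_unroll W D d (fun k => Unroll d (try_pair d k)) s1 16 ready (fun k => has (T j k) (iota 0 d)) (d * (2 * try_cost d W * M)).
  + exact: rd1.
  + move=> k s2 kd sm2 rd2.
    have fr2 k' l : nowrite k' (detect_body d) -> arr s2 k' l = arr s1 k' l.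
      by move=> /andP[/andP[h _] _]; apply: sm2.
    apply: accum_unroll; first exact: rd2.
    move=> k0 s3 kd0 sm3 rd3.
    have fr3 k' l : nowrite k' (detect_body d) -> arr s3 k' l = arr s1 k' l.
      move=> h; rewrite -fr2 //; apply: sm3; apply: nowrite_unroll => k5.
      by move: h => /andP[/andP[h _] _]; move: h; rewrite /Unroll; case: (d) kd => // d' _ /= /andP[/andP[h _] _].
    have k3 : kept s3 m = F by apply: kept_eq => l; rewrite fr3 //; nw.
    have [] := @exec_try d W D n es ues rk s3 k k0 j N.
    * by apply: (slots_same (c := detect_body d) sl1) => [k' l h|k']; [exact: fr3 | nw].
    * by rewrite fr3 ?fr //; nw.
    * exact: rd3.
    * exact: jm.
    * by rewrite fr3 //; nw.
    * exact: kd.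
    * exact: kd0.
    * move=> a x xj; rewrite k3; apply: subset_leq_card; apply: avoiding_component.
      by apply/componentP; apply: (@joined1 _ _ (edge j)) => //; rewrite mem_kept // jm out.
    * by rewrite k3.
  split=> //; apply: leq_trans cw _; rewrite /b0 -[X in _ <= X]addnA leq_add2l.
  by apply: leq_trans cw1 _; rewrite leq_add2l.
- rewrite em in h2 h3; split=> //.
    rewrite h2 e16 /=; split.
      move=> /hasP[j]; rewrite mem_iota => /= jm /and3P[out vj /hasP[k]]; rewrite mem_iota => kd /hasP[k0].
      rewrite mem_iota => kd0 /existsP[a /existsP[x /and3P[/eqP ha /eqP hx]]].
      move=> /exists_inP[f fF /and3P[af xf /exists_inP[y yf /andP[/componentP xy yj]]]].
      have ae : a \in edge j by rewrite -mem_codes -ha mem_nth // ltnNge; apply/negP => h; move: ha; rewrite nth_default // addn2.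
      have xe : x \in edge j by rewrite -mem_codes -hx mem_nth // ltnNge; apply/negP => h; move: hx; rewrite nth_default // addn2.
      have jF : edge j \in F by rewrite mem_kept // jm.
      have jC u : u \in edge j -> u \in component F v by move=> uj; apply/componentP; apply: (@joined1 _ _ (edge j)).
      apply: (@component_sound _ d d2 F v (edge j) f a x y) => //.
        by rewrite (component_edgesP v jF vj) jC.
      by rewrite (component_edgesP v fF af) jC.
    move=> nint; have [f1 [f2 [a [x [y [h4 h5 h6 [h7 h8 h9 h10 [h11 h12 h13]]]]]]]] := component_detect d2 rkF loc nint.
    have [j [jm _ out fj]] := keptP h4; apply/hasP; exists j; first by rewrite mem_iota.
    rewrite fj in h6 h7 h8 h12; have [k kd hk] := slot_of rk jm h7; have [k0 kd0 hk0] := slot_of rk jm h8.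
    rewrite /P out h6; apply/hasP; exists k; first by rewrite mem_iota.
    apply/hasP; exists k0; first by rewrite mem_iota.
    apply/existsP; exists a; apply/existsP; exists x; rewrite hk hk0 !eqxx; apply/exists_inP; exists f2 => //.
    rewrite h9 h11; apply/exists_inP; exists y => //; rewrite h12 andbT; exact/componentP.
  apply: leq_trans h3 _.
  have sc : #|star| <= 2 ^ (2 * d) by apply: (star_card d2).
  have M0 : 0 < M by [].
  have mM : m <= M by rewrite /M; apply: leq_trans (leqnSn m) _; rewrite leq_pmulr.
  have sE := sum_edges star (d * (d * (2 * try_cost d W * M))).
  rewrite (eq_bigr (fun i : 'I_m => (b0 + 8) + (if edge i \in star then d * (d * (2 * try_cost d W * M)) else 0))); last first.
    by move=> i _; exact: addnAC.
  rewrite big_split sum_nat_const card_ord /=; move: (\sum_(i < m) _) sE => S hS.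
  have hS' : S <= 2 ^ (2 * d) * (d * (d * (2 * try_cost d W))) * M.
    apply: leq_trans hS _; rewrite !mulnA leq_mul2r; apply/orP; right.
    rewrite -!mulnA; exact: leq_mul.
  rewrite /detect_cost -/b0 -/M (mulnDl _ (_ + 2) M) (mulnDl _ _ M); apply: leq_add; last by rewrite leq_pmulr.
  by apply: leq_add => //; rewrite mulnC leq_mul2l mM orbT.
Qed.

End Detection.

(** * Labelling a component and cutting it *)

Section ProcessProgram.
Variable d : nat.
Definition label_body := When (Not (Arr 0 (Var 7))) (When (Touch d (Var 7)) (SetA 4 (Var 7) (Add (Var 6) (Cst 1)))).
Definition label_loop := For 7 Size label_body.
(** The difference is nonzero exactly for a strictly smaller degree; entry 17 starts at [m + 1],
    above every degree. *)
Definition min_slot k := When (Slot k (Var 7)) (When (Sub (Var 17) (Arr 5 (Slot k (Var 7))))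
  (Seq (Let 17 (Arr 5 (Slot k (Var 7)))) (Let 18 (Slot k (Var 7))))).
Definition min_body := When (Eq (Arr 4 (Var 7)) (Add (Var 6) (Cst 1))) (Unroll d min_slot).
Definition min_loop := For 7 Size min_body.
Definition star_body := When (Contains d (Var 7) (Var 18)) (SetA 0 (Var 7) (Cst 1)).
Definition star_loop := For 7 Size star_body.
Definition cut := Seq (Let 17 (Add Size (Cst 1))) (Seq min_loop star_loop).
(** The forbidden code 1 lets the first flood use all kept edges. *)
Definition start_process := Seq (Let 13 (Slot 0 (Var 6))) (Seq (Let 15 (Var 13)) (Let 14 (Cst 1))).
Definition process := Seq start_process (Seq (flood d) (Seq label_loop
  (Seq (Let 16 (Cst 0)) (Seq (detect_loop d) (When (Var 16) cut))))).
Definition phase2_body := When (Not (Arr 0 (Var 6))) (When (Not (Arr 4 (Var 6))) (When (Slot 0 (Var 6)) process)).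
End ProcessProgram.

Section Process.
Variables (d W D n : nat) (es : seq {set 'I_n}).
Hypotheses (d2 : 2 <= d) (ues : uniq es) (rk : forall e, e \in es -> #|e| <= d).
Notation eval := (eval D).
Notation exec := (exec W D).
Notation m := (size es).
Notation edge := (nth set0 es).
Notation slots := (slots d es).
Notation codes := (codes es).
Notation kept := (kept es).
Notation loop_cost := (loop_cost W).

Lemma exec_label s i : slots s -> arr s 1 1 = m -> arr s 6 0 = i -> arr s 2 0 != arr s 10 0 ->
  let q := exec (label_loop d) s in
  (forall l, arr q.1 4 l = if (l < m) && (edge l \in [set e in kept s m | ~~ [disjoint e & marked n s]]) then i.+1 else arr s 4 l) /\
  q.2 <= loop_cost Size (label_body d) * m.+1.
Proof.
move=> sl e1 e6 z0 q; have em : eval s Size = m by rewrite /= e1.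
have lf : loopfree (label_body d) by nw.
have [] := @for_update W D 7 Size (label_body d) s 4
  (fun l => edge l \in [set e in kept s m | ~~ [disjoint e & marked n s]]) i.+1 (bound W (label_body d)).
- by [].
- move=> j s'; rewrite em => jm sm h4; split; last exact: exec_bound.
  set s1 := set_arr s' 7 0 j.
  have fr k l : nowrite k (label_loop d) -> arr s1 k l = arr s k l.
    by move=> h; rewrite arr_set -(sm k l h); case: eqP => // ek; move: h; rewrite ek.
  have sl1 : slots s1 by apply: (slots_same (c := label_loop d) sl) => [k l h|k]; [exact: fr | nw].
  have f0 l : arr s1 0 l = arr s 0 l by apply: fr; nw.
  have f2 l : arr s1 2 l = arr s 2 l by apply: fr; nw.
  have f6 l : arr s1 6 l = arr s 6 l by apply: fr; nw.
  have f10 l : arr s1 10 l = arr s 10 l by apply: fr; nw.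
  have e7 : eval s1 (Var 7) = j by [].
  have v0 : eval s1 (Arr 0 (Var 7)) = arr s 0 j by rewrite -f0.
  have vs : eval s1 (Add (Var 6) (Cst 1)) = i.+1 by rewrite -e6 -f6; apply: addn1.
  move=> l; rewrite in_set mem_kept // jm /label_body exec_when test_not v0.
  case: (arr s 0 j == 0); last by rewrite !(andFb, andTb, andbF).
  rewrite exec_when (eval_touch rk) ?e7 ?f2 ?f10 //.
  have -> : has (fun c => arr s1 2 c == arr s 10 0) (codes j) = ~~ [disjoint edge j & marked n s].
    rewrite has_codes -setI_eq0; apply/exists_inP/set0Pn => [[u ue h]|[u]].
      by exists u; rewrite !inE ue -f2.
    by rewrite !inE => /andP[ue h]; exists u; rewrite ?f2.
  by case: [disjoint _ & _]; rewrite !(andFb, andTb, andbF) // andbT exec_set e7 vs arr_set eqxx.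
rewrite em => h1 h2; split=> //; exact: leq_trans h2 (loop_cost_le _ _ _ (leqnn m)).
Qed.

Lemma exec_star s (u : 'I_n) : slots s -> arr s 1 1 = m -> arr s 18 0 = val u + 2 ->
  let q := exec (star_loop d) s in
  (forall l, arr q.1 0 l = if (l < m) && (u \in edge l) then 1 else arr s 0 l) /\
  q.2 <= loop_cost Size (star_body d) * m.+1.
Proof.
move=> sl e1 e18 q; have em : eval s Size = m by rewrite /= e1.
have lf : loopfree (star_body d) by nw.
have [] := @for_update W D 7 Size (star_body d) s 0 (fun l => u \in edge l) 1 (bound W (star_body d)).
- by [].
- move=> j s'; rewrite em => jm sm h4; split; last exact: exec_bound.
  set s1 := set_arr s' 7 0 j.
  have fr k l : nowrite k (star_loop d) -> arr s1 k l = arr s k l.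
    by move=> h; rewrite arr_set -(sm k l h); case: eqP => // ek; move: h; rewrite ek.
  have sl1 : slots s1 by apply: (slots_same (c := star_loop d) sl) => [k l h|k]; [exact: fr | nw].
  have v18 : eval s1 (Var 18) = val u + 2 by rewrite -e18 -fr //; nw.
  have e7 : eval s1 (Var 7) = j by [].
  move=> l; rewrite /star_body exec_when (eval_contains rk) ?e7 ?v18 ?mem_codes //; last by rewrite addn2.
  by case: (u \in edge j); rewrite ?andbF // andbT exec_set e7 arr_set.
rewrite em => h1 h2; split=> //; exact: leq_trans h2 (loop_cost_le _ _ _ (leqnn m)).
Qed.

Lemma exec_min s i (K : {set {set 'I_n}}) (g : 'I_n -> nat) (v : 'I_n) e0 : slots s -> arr s 1 1 = m -> arr s 6 0 = i ->
  K \subset edges es -> (forall j, j < m -> (arr s 4 j == i.+1) = (edge j \in K)) ->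
  (forall e u, e \in K -> u \in e -> arr s 5 (val u + 2) = g u /\ g u <= m) ->
  arr s 17 0 = m.+1 -> e0 \in K -> v \in e0 -> let q := exec (min_loop d) s in
  (exists e u, [/\ e \in K, u \in e, arr q.1 18 0 = val u + 2 & forall e' w, e' \in K -> w \in e' -> g u <= g w]) /\
  q.2 <= loop_cost Size (min_body d) * m.+1.
Proof.
move=> sl e1 e6 Ke c4 dg e17 e0K ve0 q; have em : eval s Size = m by rewrite /= e1.
have lf : loopfree (min_body d) by nw.
pose best s' := arr s' 17 0 = m.+1 \/ exists e u, [/\ e \in K, u \in e, arr s' 18 0 = val u + 2 & arr s' 17 0 = g u].
have [||t [h1 h2 ht] hq] := @for_rule W D 7 Size (min_body d) s (fun j s' t =>
  [/\ best s', forall j' w, j' < j -> edge j' \in K -> w \in edge j' -> arr s' 17 0 <= g w & t <= j * (bound W (min_body d) + 8)]).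
- by split=> //; left.
- move=> j s' t; rewrite em => jm sm [h1 h2 ht]; set s1 := set_arr s' 7 0 j.
  have cst : t + (exec (min_body d) s1).2 + 8 <= j.+1 * (bound W (min_body d) + 8).
    by have := exec_bound W D s1 lf; rewrite mulSn; lia.
  have fr k l : nowrite k (min_loop d) -> arr s1 k l = arr s k l.
    by move=> h; rewrite arr_set -(sm k l h); case: eqP => // ek; move: h; rewrite ek.
  have sl1 : slots s1 by apply: (slots_same (c := min_loop d) sl) => [k l h|k]; [exact: fr | nw].
  have f4 l : arr s1 4 l = arr s 4 l by apply: fr; nw.
  have f5 l : arr s1 5 l = arr s 5 l by apply: fr; nw.
  have f6 l : arr s1 6 l = arr s 6 l by apply: fr; nw.
  have v4 : eval s1 (Arr 4 (Var 7)) = arr s 4 j by rewrite -f4.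
  have vs : eval s1 (Add (Var 6) (Cst 1)) = i.+1 by rewrite -e6 -f6; apply: addn1.
  have b1 : best s1 by [].
  have old j' w : j' < j -> edge j' \in K -> w \in edge j' -> arr s1 17 0 <= g w by apply: h2.
  move: cst; set s2 := (exec (min_body d) s1).1.
  have s2E : s2 = if edge j \in K then (exec (Unroll d min_slot) s1).1 else s1.
    by rewrite /s2 /min_body exec_when test_eq v4 vs c4.
  move=> cst; rewrite s2E; case: (boolP (edge j \in K)) => jK; last first.
    split=> // j' w; rewrite ltnS leq_eqVlt => /orP[/eqP->|]; [by rewrite (negbTE jK) | exact: old].
  have [||g1 g2 g3] := @unroll_rule W D d min_slot s1 (fun k s' _ => [/\ best s', arr s' 17 0 <= arr s1 17 0 &
     forall k' (w : 'I_n), k' < k -> nth 0 (codes j) k' = val w + 2 -> arr s' 17 0 <= g w]).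
  - by [].
  - move=> k s3 _ kd sm3 [p1 p2 p3].
    have fr3 k' l : nowrite k' (Unroll d min_slot) -> arr s3 k' l = arr s1 k' l by apply: sm3.
    have vk : eval s3 (Slot k (Var 7)) = nth 0 (codes j) k.
      by rewrite /= !fr3 ?sl1 //; nw.
    rewrite /min_slot exec_when vk.
    case: (eqVneq (nth 0 (codes j) k) 0) => [z|nz].
      split=> // k' w; rewrite ltnS leq_eqVlt => /orP[/eqP->|]; last exact: p3.
      by rewrite z addn2.
    have [u ue hu] := of_slot nz; have [dg1 dg2] := dg _ u jK ue.
    have v5 : eval s3 (Arr 5 (Slot k (Var 7))) = g u.
      by rewrite [eval _ _]/= -[arr s3 (SL k) _]/(eval s3 (Slot k (Var 7))) vk hu fr3 ?f5 //; nw.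
    have uniqu (w : 'I_n) : nth 0 (codes j) k = val w + 2 -> w = u.
      by rewrite hu => h; apply: val_inj; move: h; rewrite !addn2 => -[].
    rewrite exec_when [eval _ (Sub _ _)]/= -[arr s3 5 _]/(eval s3 (Arr 5 (Slot k (Var 7)))) v5 subn_eq0 -ltnNge.
    case: ltnP => gu.
      have -> : (exec (Seq (Let 17 (Arr 5 (Slot k (Var 7)))) (Let 18 (Slot k (Var 7)))) s3).1 =
         set_arr (set_arr s3 17 0 (g u)) 18 0 (val u + 2).
        rewrite exec_seq /Let 2!exec_set v5 [eval _ (Cst 0)]/=; congr (set_arr _ _ _ _).
        by rewrite -hu -vk.
      split.
      - by right; exists (edge j), u.
      - by apply: leq_trans p2; apply: ltnW.
      - move=> k' w; rewrite ltnS leq_eqVlt => /orP[/eqP->|hk] hw; first by rewrite (uniqu w).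
        by apply: leq_trans (p3 k' w hk hw); apply: ltnW.
    split=> // k' w; rewrite ltnS leq_eqVlt => /orP[/eqP->|]; last exact: p3.
    by move=> /uniqu->.
  split=> // j' w; rewrite ltnS leq_eqVlt => /orP[/eqP->|hj] jK' wj; last first.
    by apply: leq_trans g2 _; apply: old hj jK' wj.
  by have [k kd hk] := slot_of rk jm wj; apply: g3 kd hk.
rewrite em in h2 ht; split; last first.
  by rewrite /q hq; apply: leq_trans (loop_cost_le W Size (min_body d) (leqnn m)); rewrite leq_add2r.
have all e' w : e' \in K -> w \in e' -> arr q.1 17 0 <= g w.
  move=> eK we; have /(subsetP Ke) := eK; rewrite inE => /edgeP[j jm ej].
  by apply: (h2 j) => //; rewrite -ej.
case: h1 => [h|[e [u [eK ue h3 h4]]]].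
  have := all _ _ e0K ve0; have [_] := dg _ _ e0K ve0; rewrite h; lia.
by exists e, u; split=> // e' w eK' we; rewrite -h4; apply: all eK' we.
Qed.

Definition process_cost := bound W start_process + (flood_cost d W + (loop_cost Size (label_body d) + (bound W (Let 16 (Cst 0)) +
  (detect_cost d W + ((esize W (Var 16) + 2) + (bound W (Let 17 (Add Size (Cst 1))) + (loop_cost Size (min_body d) +
  loop_cost Size (star_body d)))))))).

Lemma leq_add_mul A B M x y : x <= A * M -> y <= B * M -> x + y <= (A + B) * M.
Proof. by rewrite mulnDl; apply: leq_add. Qed.

(** The degrees are required to be right on this component only. A cut flags all edges at [u],
    including those already deleted. *)
Lemma exec_process s i (v : 'I_n) : let F := kept s m in let C := component F v in let K := component_edges F v in
  slots s -> arr s 1 1 = m -> ready s -> i < m -> arr s 6 0 = i -> nth 0 (codes i) 0 = val v + 2 ->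
  locally_interval F d -> (forall l, arr s 4 l <= i) -> edge i \in F ->
  (forall u, u \in C -> arr s 5 (val u + 2) = degree F u) -> let q := exec (process d) s in
  [/\ (forall l, arr q.1 4 l = if (l < m) && (edge l \in K) then i.+1 else arr s 4 l), ready q.1,
    (interval K /\ forall l, arr q.1 0 l = arr s 0 l) \/
    (~ interval K /\ exists u, [/\ u \in C, forall w, w \in C -> degree F u <= degree F w &
      forall l, arr q.1 0 l = if (l < m) && (u \in edge l) then 1 else arr s 0 l]) &
    q.2 <= process_cost * (m.+1 * #|C|.+1)].
Proof.
move=> F C K sl e1 rd im e6 ev loc le4 iF dg q.
have d0 : 0 < d by lia.
have vi : v \in edge i by rewrite -mem_codes -ev mem_nth // ltnNge; apply/negP => h; move: ev; rewrite nth_default // addn2.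
set s1 := (exec start_process s).1.
have E k l : k != 13 -> k != 14 -> k != 15 -> arr s1 k l = arr s k l.
  by move=> h1 h2 h3; rewrite /= (negbTE h1) (negbTE h2) (negbTE h3).
have v0 : eval s (Slot 0 (Var 6)) = val v + 2 by rewrite -ev /= e6 sl.
have f13 : arr s1 13 0 = val v + 2 by rewrite -v0.
have f15 : arr s1 15 0 = val v + 2 by rewrite -v0.
have sl1 : slots s1 by move=> j k hj hk; rewrite E ?sl // /SL; lia.
have [r0 r1] := rd.
have k1 : kept s1 m = F by apply: kept_eq => l; rewrite E.
have [] := @exec_flood d W D n es ues rk s1 1 v sl1 ltac:(by rewrite E) ltac:(by rewrite E) erefl isT f15
  ltac:(by move=> l; rewrite !E).
rewrite unblocked1 k1; set s2 := (exec (flood d) s1).1 => h1 h2 h3 h4 h5.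
have sm2 : same (flood d) s1 s2 := exec_same W D s1.
have sl2 : slots s2 by apply: (slots_same sl1 sm2) => k; nw.
have k2 : kept s2 m = F by apply: kept_eq => l; rewrite sm2 ?E //; nw.
have e62 : arr s2 6 0 = i by rewrite sm2 ?E //; nw.
have e12 : arr s2 1 1 = m by rewrite sm2 ?E //; nw.
have [] := @exec_label s2 i sl2 e12 e62 ltac:(by rewrite h1 h3).
rewrite k2 h4 -/(component_edges F v) -/K; set s3 := (exec (label_loop d) s2).1 => l1 l2.
have sm3 : same (label_loop d) s2 s3 := exec_same W D s2.
set s4 := (exec (Let 16 (Cst 0)) s3).1.
have fr4 k l : k != 16 -> nowrite k (label_loop d) -> arr s4 k l = arr s2 k l.
  by move=> h hl; rewrite /= (negbTE h) /= sm3.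
have sl4 : slots s4 by move=> j k hj hk; rewrite fr4 ?sl2.
have k4 : kept s4 m = F by rewrite -k2; apply: kept_eq => l; rewrite fr4 //; nw.
have rd4 : ready s4.
  by split; rewrite ?fr4 ?h1 // => l; rewrite !fr4.
have [] := @exec_detect d W D n es d2 ues rk s4 v sl4 ltac:(by rewrite fr4 //; nw) rd4 ltac:(by rewrite fr4 ?sm2 //; nw)
  erefl ltac:(by rewrite k4).
rewrite k4; set s5 := (exec (detect_loop d) s4).1 => [[rd5 rd5']] b5 c5.
have sm5 : same (detect_loop d) s4 s5 := exec_same W D s4.
have fr5 k l : k != 16 -> nowrite k (label_loop d) -> nowrite k (detect_loop d) -> nowrite k (flood d) ->
  k != 13 -> k != 14 -> k != 15 -> arr s5 k l = arr s k l.
  by move=> g1 g2 g3 g4 g5 g6 g7; rewrite sm5 // fr4 // sm2 // E.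
have o5 l : arr s5 0 l = arr s 0 l by apply: fr5; nw.
have c4 l : arr s5 4 l = if (l < m) && (edge l \in K) then i.+1 else arr s 4 l.
  rewrite sm5; last by nw.
  rewrite [arr s4 4 l]/= l1 sm2 ?E //; nw.
have M0 : 0 < m.+1 * #|C|.+1 by [].
have gM t c : t <= c * m.+1 -> t <= c * (m.+1 * #|C|.+1).
  by move=> h; apply: leq_trans h _; rewrite leq_mul2l leq_pmulr ?orbT.
have gM1 t c : t <= c -> t <= c * (m.+1 * #|C|.+1) by move=> h; apply: leq_trans h _; rewrite leq_pmulr.
have qE : q.1 = if arr s5 16 0 != 0 then (exec (cut d) s5).1 else s5.
  have -> : q.1 = (exec (When (Var 16) (cut d)) s5).1.
    by rewrite /q /process (exec_seq _ _ start_process) (exec_seq _ _ (flood d)) (exec_seq _ _ (label_loop d))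
      (exec_seq _ _ (Let 16 (Cst 0))) (exec_seq _ _ (detect_loop d)).
  by rewrite exec_when.
have cE : q.2 <= (exec start_process s).2 + ((exec (flood d) s1).2 + ((exec (label_loop d) s2).2 + ((exec (Let 16 (Cst 0)) s3).2 +
    ((exec (detect_loop d) s4).2 + (esize W (Var 16) + 2 + (if arr s5 16 0 != 0 then (exec (cut d) s5).2 else 0)))))).
  have -> : q.2 = (exec start_process s).2 + ((exec (flood d) s1).2 + ((exec (label_loop d) s2).2 + ((exec (Let 16 (Cst 0)) s3).2 +
    ((exec (detect_loop d) s4).2 + (exec (When (Var 16) (cut d)) s5).2)))).
    by rewrite /q /process (cost_seq _ _ start_process) (cost_seq _ _ (flood d)) (cost_seq _ _ (label_loop d))
      (cost_seq _ _ (Let 16 (Cst 0))) (cost_seq _ _ (detect_loop d)).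
  by do 5![apply: leq_add => //]; apply: cost_when.
have b1 := gM1 _ _ (exec_bound W D s (c := start_process) isT).
have b2 := gM1 _ _ (exec_bound W D s3 (c := Let 16 (Cst 0)) isT).
have b3 := gM1 _ _ (leqnn (esize W (Var 16) + 2)).
have b4 := gM _ _ l2.
case: (boolP (arr s5 16 0 != 0)) qE cE => h16 qE cE; last first.
  rewrite qE; split=> //.
    left; split=> //; have [//|nint] := classic (interval K); by move: h16; rewrite (b5.2 nint).
  apply: leq_trans cE _; rewrite /process_cost; move: (bound _ (Let 17 _) + _) => B.
  exact: leq_add_mul b1 (leq_add_mul h5 (leq_add_mul b4 (leq_add_mul b2 (leq_add_mul c5 (leq_add_mul b3 (leq0n _)))))).
have nint := b5.1 h16.
set s6 := (exec (Let 17 (Add Size (Cst 1))) s5).1.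
have fr6 k l : k != 17 -> arr s6 k l = arr s5 k l by move=> h; rewrite /= (negbTE h).
have sl6 : slots s6.
  move=> j k hj hk; rewrite fr6; last by rewrite /SL; lia.
  by rewrite fr5 ?sl //; nw.
have e16 : arr s6 1 1 = m by rewrite fr6 // fr5 //; nw.
have e66 : arr s6 6 0 = i by rewrite fr6 // fr5 //; nw.
have Csub e u : e \in K -> u \in e -> u \in C by move=> /component_edges_subset/subsetP; apply.
have iK : edge i \in K by rewrite (component_edgesP v iF vi); apply/componentP; exists 0.
have dm u : degree F u <= m.
  apply: leq_trans (card_size es); apply: subset_leq_card; apply/subsetP => f; by rewrite !inE => /andP[/and3P[]].
have [] := @exec_min s6 i K (degree F) v (edge i) sl6 e16 e66.
- exact: subset_trans (component_edges_sub F v) (kept_sub _ _ _).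
- move=> j jm; rewrite fr6 // c4 jm /=; case: ifP => _; first by rewrite eqxx.
  by have := le4 j; apply: contraTF => /eqP->; rewrite ltnn.
- move=> e u eK ue; rewrite fr6 // fr5; try by nw.
  by split=> //; apply: dg; apply: Csub eK ue.
- rewrite /s6 /Let exec_set arr_set /= fr5 ?e1 ?addn1 //; nw.
- exact: iK.
- exact: vi.
set s7 := (exec (min_loop d) s6).1 => -[e [u [eK ue e18 mn]]] c7.
have sm7 : same (min_loop d) s6 s7 := exec_same W D s6.
have sl7 : slots s7 by apply: (slots_same sl6 sm7) => k; nw.
have [] := @exec_star s7 u sl7 ltac:(by rewrite sm7 //; nw) e18.
set s8 := (exec (star_loop d) s7).1 => st8 c8.
have sm8 : same (star_loop d) s7 s8 := exec_same W D s7.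
have -> : q.1 = s8 by rewrite qE.
have fr8 k l : nowrite k (star_loop d) -> nowrite k (min_loop d) -> k != 17 -> arr s8 k l = arr s5 k l.
  by move=> g1 g2 g3; rewrite sm8 // sm7 // fr6.
split.
- by move=> l; rewrite fr8 ?c4 //; nw.
- split; first by rewrite fr8 //; nw.
  by move=> l; rewrite !fr8 //; nw.
- right; split=> //; exists u; split.
  + exact: Csub eK ue.
  + move=> w wC; have := subsetP (component_cover F v) w wC; rewrite in_setU1 => /orP[/eqP->|/bigcupP[e' eK' we]].
      exact: mn iK vi.
    exact: mn eK' we.
  + by move=> l; rewrite st8 sm7 ?fr6 ?o5 //; nw.
- apply: leq_trans cE _.
  have -> : (exec (cut d) s5).2 = (exec (Let 17 (Add Size (Cst 1))) s5).2 + ((exec (min_loop d) s6).2 + (exec (star_loop d) s7).2) by [].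
  have b5' := gM1 _ _ (exec_bound W D s5 (c := Let 17 (Add Size (Cst 1))) isT).
  have b6 := gM _ _ c7; have b7 := gM _ _ c8.
  rewrite /process_cost; exact: leq_add_mul b1 (leq_add_mul h5 (leq_add_mul b4 (leq_add_mul b2 (leq_add_mul c5 (leq_add_mul b3
   (leq_add_mul b5' (leq_add_mul b6 b7))))))).
Qed.

End Process.

Section Phase2.
Variables (d W D n : nat) (es : seq {set 'I_n}).
Hypotheses (d2 : 2 <= d) (ues : uniq es) (rk : forall e, e \in es -> #|e| <= d).
Notation eval := (eval D).
Notation exec := (exec W D).
Notation m := (size es).
Notation edge := (nth set0 es).
Notation slots := (slots d es).
Notation codes := (codes es).
Notation kept := (kept es).
Notation deleted := (deleted es).

Definition labelled s := [set f in es | arr s 4 (index f es) != 0].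

Lemma mem_labelled s j : j < m -> (edge j \in labelled s) = (arr s 4 j != 0).
Proof. by move=> h; rewrite inE mem_nth // index_uniq. Qed.

Lemma setP_edges (A B : {set {set 'I_n}}) : A \subset edges es -> B \subset edges es ->
  (forall j, j < m -> (edge j \in A) = (edge j \in B)) -> A = B.
Proof.
move=> hA hB h; apply/setP => f; have [fe|fe] := boolP (f \in es).
  by have [j jm ->] := edgeP fe; apply: h.
have no (X : {set {set 'I_n}}) : X \subset edges es -> f \in X = false.
  by move=> hX; apply/negP => /(subsetP hX); rewrite inE (negbTE fe).
by rewrite !no.
Qed.

Lemma deleted_sub s : deleted s \subset edges es.
Proof. by apply/subsetP => f; rewrite !inE => /andP[]. Qed.

Lemma labelled_sub s : labelled s \subset edges es.
Proof. by apply/subsetP => f; rewrite !inE => /andP[]. Qed.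

(** The kept labelled edges form finished components. Deletions are charged to the part of a
    solution inside [deleted s :|: L]; a new component is disjoint from both and brings its own
    share. Degrees computed once before the loop stay right on unlabelled edges, since cuts remove
    edges of labelled components only. *)
Definition inv2 i s := let F := kept s m in let L := labelled s in
  [/\ slots s, arr s 1 1 = m, ready s, forall l, arr s 4 l <= i &
   [/\ locally_interval F d,
     forall e f, e \in F -> e \in L -> f \in F -> ~~ [disjoint e & f] -> f \in L,
     interval (F :&: L),
     forall D', interval (edges es :\: D') -> #|deleted s| <= d.+1 * #|D' :&: (deleted s :|: L)| &
     (forall j, j < i -> edge j \in F -> edge j = set0 \/ edge j \in L) /\
     (forall e u, e \in F -> e \notin L -> u \in e -> arr s 5 (val u + 2) = degree F u)]].

Definition skip_cost := (esize W (Not (Arr 0 (Var 6))) + 2) + ((esize W (Not (Arr 4 (Var 6))) + 2) + (esize W (Slot 0 (Var 6)) + 2)).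
Definition cost2 := skip_cost + process_cost d W * d.+2.

(* The cost of treating a component is charged to its newly labelled edges. *)
Lemma phase2_step s i : inv2 i s -> i < m -> arr s 6 0 = i ->
  let q := exec (phase2_body d) s in inv2 i.+1 q.1 /\
  q.2 + cost2 * m.+1 * #|labelled s| <= cost2 * m.+1 * #|labelled q.1| + skip_cost.
Proof.
move=> I2 im e6 q; case: (I2) => sl e1 rd le4 [loc clo int bd [dn dg]]; set F := kept s m in loc clo int dn dg; set L := labelled s in clo int bd dn dg.
have rkF e : e \in F -> #|e| <= d by apply: rk_kept.
have ei : edge i \in es by apply: mem_nth.
have d0 : 0 < d by lia.
have c1 := cost_when W D (Not (Arr 0 (Var 6))) (When (Not (Arr 4 (Var 6))) (When (Slot 0 (Var 6)) (process d))) s.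
have c2 := cost_when W D (Not (Arr 4 (Var 6))) (When (Slot 0 (Var 6)) (process d)) s.
have c3 := cost_when W D (Slot 0 (Var 6)) (process d) s.
have v0 : eval s (Arr 0 (Var 6)) = arr s 0 i by rewrite -e6.
have v4 : eval s (Arr 4 (Var 6)) = arr s 4 i by rewrite -e6.
have vs : eval s (Slot 0 (Var 6)) = nth 0 (codes i) 0 by rewrite /= e6 sl.
rewrite -/(phase2_body d) -/q test_not v0 in c1; rewrite test_not v4 in c2; rewrite vs in c3.
have qE : q.1 = if [&& arr s 0 i == 0, arr s 4 i == 0 & nth 0 (codes i) 0 != 0] then (exec (process d) s).1 else s.
  rewrite /q /phase2_body exec_when test_not v0; case: (_ == 0) => //.
  rewrite exec_when test_not v4; case: (_ == 0) => //.
  by rewrite exec_when vs.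
have cE : q.2 <= skip_cost + if [&& arr s 0 i == 0, arr s 4 i == 0 & nth 0 (codes i) 0 != 0] then (exec (process d) s).2 else 0.
  rewrite /skip_cost -addnA; apply: leq_trans c1 (leq_add (leqnn _) _); rewrite -addnA.
  case: (arr s 0 i == 0); last by [].
  apply: leq_trans c2 (leq_add (leqnn _) _); case: (arr s 4 i == 0); last by [].
  by apply: leq_trans c3 (leq_add (leqnn _) _).
case: ifP qE cE => [/and3P[/eqP out /eqP un nz] | skip] qE cE; last first.
  rewrite qE; split; last by move: cE; rewrite addn0; clear; lia.
  split=> //; first by move=> l; apply: leqW.
  split=> //; split=> // j; rewrite ltnS leq_eqVlt => /orP[/eqP->|]; last exact: dn.
  rewrite mem_kept // im andTb => iF; move: skip; rewrite iF mem_labelled //.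
  case: (arr s 4 i =P 0) => [_|] /=; last by right.
  move=> /negbFE/eqP z; left; apply/eqP; apply: contraT => /set0Pn[u]; rewrite -mem_codes.
  case: (codes i) z (@codes_gt1 n es i) => [//|c cs] /= -> /(_ 0); rewrite inE eqxx; by move/(_ isT).
have [v vi ev] := of_slot nz; set C := component F v; set K := component_edges F v.
have iF : edge i \in F by rewrite mem_kept // im out.
have iL : edge i \notin L by rewrite mem_labelled // un.
have KF : K \subset F := component_edges_sub F v.
have FE : F \subset edges es := kept_sub es s m.
have iK : edge i \in K by rewrite (component_edgesP v iF vi); apply/componentP; exists 0.
have vnL e : e \in F -> e \in L -> v \notin e.
  move=> eF eL; apply/negP => ve; case/negP: iL; apply: (clo e) => //.
  by rewrite -setI_eq0; apply/set0Pn; exists v; rewrite inE ve.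
(* Every kept edge lies inside [cov] or misses it; [v] is outside, so its component meets no
   labelled edge. *)
pose cov := cover (F :&: L).
have closed f : f \in F -> (f \subset cov) || [disjoint f & cov].
  move=> fF; case: (boolP [disjoint f & cov]) => [_|]; first by rewrite orbT.
  rewrite -setI_eq0 => /set0Pn[z]; rewrite inE => /andP[zf /bigcupP[g]]; rewrite in_setI => /andP[gF gL] zg.
  rewrite orbF; apply: bigcup_sup; rewrite in_setI fF; apply: clo gF gL fF _.
  by rewrite -setI_eq0; apply/set0Pn; exists z; rewrite inE zg.
have sep e : e \in F :&: L -> [disjoint e & C].
  rewrite in_setI => /andP[eF eL]; rewrite -setI_eq0 -[_ == _]negbK; apply/negP => /set0Pn[w].
  rewrite in_setI => /andP[we /componentP vw].
  have wL : w \in cov by apply/bigcupP; exists e; rewrite ?in_setI ?eF.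
  have /bigcupP[f] := joined_closed closed (joined_sym vw) wL.
  by rewrite in_setI => /andP[fF fL] vf; have := vnL f fF fL; rewrite vf.
have KL e : e \in K -> e \notin L.
  move=> eK; apply/negP => eL; have := sep e; rewrite in_setI (subsetP KF _ eK) eL => /(_ isT) h.
  by move: eK; rewrite inE h andbF.
have Kdel e : e \in K -> e \notin deleted s.
  by move=> /(subsetP KF)/keptP[j [jm _ h ->]]; rewrite mem_deleted // h.
have FC f u : f \in F -> u \in f -> u \in C -> f \in K by move=> fF uf uC; rewrite (component_edgesP v fF uf).
have z0 : nth 0 (codes i) 0 = val v + 2 := ev.
have dgC u : u \in C -> arr s 5 (val u + 2) = degree F u.
  move=> uC; have := subsetP (component_cover F v) u uC; rewrite in_setU1 => /orP[/eqP->|/bigcupP[e eK ue]].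
    exact: dg iF iL vi.
  by apply: (dg e) => //; [exact: (subsetP KF) | exact: KL].
have [] := @exec_process d W D n es d2 ues rk s i v sl e1 rd im e6 ev loc le4 iF dgC.
set s' := (exec (process d) s).1 => p4 rd' outcome cst.
have sm : same (process d) s s' := exec_same W D s.
have lE : labelled s' = L :|: K.
  apply: setP_edges => [||j jm]; rewrite ?subUset ?labelled_sub ?(subset_trans KF) //.
  rewrite in_setU !mem_labelled // p4 jm /=; by case: (edge j \in K); rewrite ?orbT ?orbF.
(* [S] is what this call deletes: nothing, or all kept edges at [u]. In the second case
   [component_star] makes the rest interval and [component_degree] pays for [S]. *)
have [S [SK kE dE iS bS]] : exists S : {set {set 'I_n}}, [/\ S \subset K, kept s' m = F :\: S, deleted s' = deleted s :|: S,
    interval (K :\: S) & forall D', interval (edges es :\: D') -> #|S| <= d.+1 * #|D' :&: K|].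
  case: outcome => [[iK' o']|[nint [u [uC mn o']]]].
    exists set0; rewrite sub0set setD0 setU0 setD0 cards0; split=> //; first exact: kept_eq.
    by apply/setP => f; rewrite !inE o'.
  exists [set e in F | u \in e]; split.
  - by apply/subsetP => f; rewrite inE => /andP[fF uf]; apply: FC uf uC.
  - apply: setP_edges => [||j jm]; rewrite ?kept_sub ?(subset_trans _ FE) ?subsetDl //.
    rewrite mem_kept // in_setD in_set (mem_kept ues s m jm) jm o' jm /=; by case: (u \in edge j); rewrite ?andbF ?andbT ?andNb.
  - apply: setP_edges => [||j jm]; rewrite ?deleted_sub ?subUset ?deleted_sub //=.
      by apply/subsetP => f; rewrite inE => /andP[/(subsetP FE)].
    rewrite mem_deleted // in_setU mem_deleted // in_set (mem_kept ues s m jm) o' jm /=; case: (u \in edge j); rewrite ?andbF ?orbF //.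
    by rewrite andbT orNb.
  - apply: interval_sub (component_star (v := v) d2 rkF loc uC).
    by apply/subsetP => f; rewrite !inE => /andP[h /andP[fF fC]]; rewrite fF fC; move: h; rewrite fF.
  - move=> D' iD; have iKD : interval (K :\: D').
      by apply: interval_sub iD; apply: setSD; apply: subset_trans KF FE.
    exact: (component_degree d2 rkF uC mn nint iKD).
have SF : S \subset F := subset_trans SK KF.
rewrite qE; split; last first.
  rewrite lE cardsU disjoint_setI0 ?cards0 ?subn0; last first.
    by rewrite disjoint_sym; apply/pred0P => e /=; apply/negP => /andP[eK eL]; have := KL e eK; rewrite eL.
  (* From [#|C| <= 1 + d * #|K|], where [K] contains edge [i]; this is the origin of the factor
     [d.+2] in [cost2]. *)
  have cC : (#|C|).+1 <= d.+2 * #|K|.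
    have K0 : 0 < #|K| by apply/card_gt0P; exists (edge i).
    have := card_component v rkF; rewrite -/C -/K; move: (#|C|) (#|K|) K0 => c k k0 h; clear -k0 h.
    by rewrite !mulSn; lia.
  have := leq_trans cE (leq_add (leqnn _) cst); move=> h.
  have h2 : process_cost d W * (m.+1 * #|C|.+1) <= cost2 * m.+1 * #|K|.
    rewrite /cost2.
    apply: leq_trans (_ : process_cost d W * (m.+1 * (d.+2 * #|K|)) <= _).
      by rewrite !leq_mul2l cC !orbT.
    move: (process_cost d W) skip_cost (#|K|) (d.+2) (m.+1) => x y k c M; clear.
    by rewrite [M * (c * k)]mulnCA !mulnA !leq_mul2r leq_addl !orbT.
  rewrite mulnDr; apply: leq_trans (leq_add h (leqnn _)) _; move: h2.
  by move: (process_cost d W * _) (cost2 * m.+1 * #|K|) (cost2 * m.+1 * #|L|) skip_cost; clear; lia.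
split.
- by apply: (slots_same sl sm) => k; nw.
- by rewrite sm //; nw.
- exact: rd'.
- by move=> l; rewrite p4; case: ifP => // _; apply: leqW.
rewrite kE lE dE; split.
- by apply: locally_interval_sub loc; apply: subsetDl.
- move=> e f; rewrite !in_setD !in_setU => /andP[_ eF] /orP[eL|eK] /andP[_ fF] ef; apply/orP.
    by left; apply: clo eF eL fF ef.
  right; rewrite inE fF /=; apply: contra ef => fC; rewrite disjoint_sym.
  by apply: disjointWr fC; apply: component_edges_subset eK.
- apply: interval_sub (_ : _ \subset (K :\: S) :|: (F :&: L)) _.
    by apply/subsetP => f; rewrite !in_setI !in_setU !in_setD in_setI => /andP[/andP[-> ->] /orP[->|->]]; rewrite ?orbT.
  apply: (@interval_disjointU _ _ _ C) => //.
  by move=> e; rewrite in_setD => /andP[_]; apply: component_edges_subset.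
- move=> D' iD; have h1 := bd D' iD; have h2 := bS D' iD.
  apply: leq_trans (leq_card_setU _ _) _; apply: leq_trans (leq_add h1 h2) _; rewrite -mulnDr leq_mul2l /=.
  have -> : #|D' :&: (deleted s :|: L)| + #|D' :&: K| = #|(D' :&: (deleted s :|: L)) :|: (D' :&: K)|.
    rewrite cardsU [_ :&: (D' :&: K)]disjoint_setI0 ?cards0 ?subn0 //; apply/pred0P => e /=; apply/negP.
    rewrite !in_setI in_setU => /andP[/andP[_ h] /andP[_ eK]]; move: h; by rewrite (negbTE (Kdel e eK)) (negbTE (KL e eK)).
  apply: subset_leq_card; apply/subsetP => e; rewrite !(in_setI, in_setU) => /orP[/andP[-> /orP[->|->]]|/andP[-> ->]]; by rewrite ?orbT.
split.
- move=> j; rewrite ltnS leq_eqVlt in_setD in_setU => /orP[/eqP->|ji] /andP[_ jF]; first by right; rewrite iK orbT.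
  by case: (dn j ji jF) => h; [left | right; rewrite h].
- move=> e u; rewrite in_setD in_setU negb_or => /andP[_ eF] /andP[eL eK] ue.
  rewrite sm; last by nw. rewrite (dg e) //; congr #|pred_of_set _|; apply/setP => f; rewrite !inE.
  case: (boolP (u \in f)) => uf; rewrite ?andbF // !andbT; case: (boolP (f \in S)) => //= fS.
  have fK := subsetP SK f fS; case/negP: eK; apply: (FC e u) => //.
  by have := component_edges_subset fK; move/subsetP; apply.
Qed.

End Phase2.

(** * The complete algorithm *)

Section MainProgram.
Variables (d b Z : nat).
(** Raw cell [e] is input cell [Z + e]; after the loop the whole encoding is in array 1 under its
    original indices. *)
Definition copy_body := SetA 1 (Add (Cst Z) (Var 7)) (Raw (Var 7)).
Definition copy_loop := For 7 (Add (Cst 2) (Any d.+1 (fun _ => Size))) copy_body.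
Definition unpack_slot k := When (Sub (Var 21) (Cst k)) (SetA (SL k) (Var 6) (Add (Arr 1 (Add (Var 9) (Cst k.+1))) (Cst 2))).
Definition unpack_body := Seq (Let 21 (Arr 1 (Var 9))) (Seq (Unroll d unpack_slot)
  (Let 9 (Add (Var 9) (Add (Var 21) (Cst 1))))).
Definition unpack_loop := For 6 Size unpack_body.
Definition phase1_loop := For 6 Size (phase1_body d b).
Definition degree_body := When (Not (Arr 0 (Var 7)))
  (Unroll d (fun k => SetA 5 (Slot k (Var 7)) (Add (Arr 5 (Slot k (Var 7))) (Cst 1)))).
Definition degree_loop := For 7 Size degree_body.
(** Phase 1 uses stamps up to [m], so the next flood begins with the new stamp [m + 1]. *)
Definition reset := Seq (SetA 2 (Cst 0) (Cst 0)) (Let 10 Size).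
Definition phase2_loop := For 6 Size (phase2_body d).
(** Flags from index [Z] on go to the raw block, where the output convention expects them; those
    below [Z] are left to the epilogue. *)
Definition output_body := SetRaw (Var 7) (Arr 0 (Add (Cst Z) (Var 7))).
Definition output_loop := For 7 (Sub Size (Cst Z)) output_body.
Definition main := Seq copy_loop (Seq (Let 9 (Cst 2)) (Seq unpack_loop (Seq phase1_loop
  (Seq degree_loop (Seq reset (Seq phase2_loop output_loop)))))).
End MainProgram.

Section Loops.
Variables (d W D n : nat) (es : seq {set 'I_n}).
Notation eval := (eval D).
Notation exec := (exec W D).
Notation m := (size es).
Notation edge := (nth set0 es).
Notation slots := (slots d es).
Notation codes := (codes es).
Notation kept := (kept es).
Notation deleted := (deleted es).
Notation loop_cost := (loop_cost W).

Lemma eval_sum s k : arr s 1 1 = m -> eval s (Add (Cst 2) (Any k (fun _ => Size))) = 2 + k * m.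
Proof.
move=> e1; have -> : eval s (Add (Cst 2) (Any k (fun _ => Size))) = 2 + eval s (Any k (fun _ => Size)) by [].
by congr (_ + _); rewrite /Any -{2}(size_iota 0 k); elim: (iota 0 k) => //= a l ->; rewrite e1 mulSn.
Qed.

Lemma exec_copy Z s (I : nat -> nat) : 1 < Z -> (d.+1 * m).+1 <= D -> arr s 1 1 = m ->
  (forall a, 0 < a < Z -> arr s 1 a = I a) -> (forall e, e <= D -> raw s e = I (Z + e)) ->
  let q := exec (copy_loop d Z) s in
  (forall a, 0 < a < Z + (2 + d.+1 * m) -> arr q.1 1 a = I a) /\
  q.2 <= d.+2 * loop_cost (Add (Cst 2) (Any d.+1 (fun _ => Size))) (copy_body Z) * m.+1.
Proof.
move=> Z1 hD e1 lo hi q; set e := Add _ _; have em : eval s e = 2 + d.+1 * m by apply: eval_sum.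
have [||t [h1 _ h2] hq] := @for_rule W D 7 e (copy_body Z) s (fun i s' t =>
  [/\ forall a, 0 < a < Z + i -> arr s' 1 a = I a, raw s' = raw s & t <= i * (bound W (copy_body Z) + 8)]).
- by split=> // a; rewrite addn0; apply: lo.
- move=> i s' t; rewrite em => hi' sm [h1 rs h2]; set s1 := set_arr s' 7 0 i.
  split; [|exact: rs|]; last first.
    by have := exec_bound W D s1 (c := copy_body Z) isT; rewrite mulSn; lia.
  move=> a; rewrite /copy_body exec_set arr_set [eval s1 (Add _ _)]/= [eval s1 (Raw _)]/=.
  rewrite (minn_idPl _); last by lia.
  case: (eqVneq a (Z + i)) => [->|ne] ha /=; first by rewrite rs hi //; lia.
  apply: h1; lia.
rewrite em in h1 h2; split=> //; rewrite /q hq.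
apply: leq_trans (leq_add h2 (leqnn _)) _.
rewrite /loop_cost; move: (bound _ _ + 8) (esize _ _ + 2) => x y; clear.
rewrite mulnAC mulnDr; apply: leq_add; last by rewrite leq_pmull.
by rewrite leq_mul2r; apply/orP; right; rewrite mulSn mulnS; lia.
Qed.

Lemma exec_output Z s : arr s 1 1 = m -> m <= D -> let q := exec (output_loop Z) s in
  [/\ arr q.1 0 =1 arr s 0, forall e, e < m - Z -> raw q.1 e = arr s 0 (Z + e) &
    q.2 <= loop_cost (Sub Size (Cst Z)) (output_body Z) * m.+1].
Proof.
move=> e1 mD q; have em : eval s (Sub Size (Cst Z)) = m - Z by rewrite /= e1.
have [||t [h1 h2] hq] := @for_rule W D 7 (Sub Size (Cst Z)) (output_body Z) s (fun i s' t =>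
  (forall e, e < i -> raw s' e = arr s 0 (Z + e)) /\ t <= i * (bound W (output_body Z) + 8)).
- by [].
- move=> i s' t; rewrite em => im sm [h1 h2]; set s1 := set_arr s' 7 0 i; split; last first.
    by have := exec_bound W D s1 (c := output_body Z) isT; rewrite mulSn; lia.
  have f0 l : arr s' 0 l = arr s 0 l by apply: sm.
  move=> e; rewrite ltnS leq_eqVlt /= (minn_idPl _); last by move: im mD; clear; lia.
  case: (eqVneq e i) => [->|ne] /=; first by rewrite f0.
  exact: h1.
rewrite em in h1 h2; split=> //.
  by move=> l; rewrite /q exec_same.
by rewrite /q hq; apply: leq_trans (loop_cost_le W _ (output_body Z) (leq_subr Z m)); rewrite leq_add2r.
Qed.

Lemma size_encode_edge (e : {set 'I_n}) : size (encode_edge e) = #|e|.+1.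
Proof. by rewrite /= size_map -cardE. Qed.

Lemma size_encodes (s : seq {set 'I_n}) : (forall e, e \in s -> #|e| <= d) ->
  size (flatten [seq encode_edge e | e <- s]) <= d.+1 * size s.
Proof.
elim: s => [|e s IH] h; first by [].
rewrite [flatten _]/= -cat_cons -/(encode_edge e) size_cat mulnS size_encode_edge leq_add ?ltnS ?h ?mem_head //.
by apply: IH => f fs; apply: h; rewrite inE fs orbT.
Qed.

Hypothesis rk : forall e, e \in es -> #|e| <= d.

Definition offset i := 2 + size (flatten [seq encode_edge e | e <- take i es]).

Lemma offsetS i : i < m -> offset i.+1 = offset i + #|edge i|.+1.
Proof.
move=> im; rewrite /offset (take_nth set0 im) map_rcons flatten_rcons size_cat size_encode_edge addnA //.
Qed.

Lemma offset_bound i : i < m -> offset i.+1 <= 2 + d.+1 * m.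
Proof.
move=> im; rewrite /offset leq_add2l; apply: leq_trans (size_encodes _) _.
  by move=> e /mem_take; apply: rk.
by rewrite leq_mul2l size_take_min geq_minr orbT.
Qed.

Lemma nth_encode i k : i < m -> k <= #|edge i| -> nth 0 (encode es) (offset i + k) = nth 0 (encode_edge (edge i)) k.
Proof.
move=> im ki; have E : flatten [seq encode_edge e | e <- es] =
  flatten [seq encode_edge e | e <- take i es] ++ (encode_edge (edge i) ++ flatten [seq encode_edge e | e <- drop i.+1 es]).
  by rewrite -[in LHS](cat_take_drop i es) (drop_nth set0 im) map_cat flatten_cat.
rewrite /encode E /offset -addnA; set x := flatten _; set y := encode_edge _; set z := flatten _.
have -> : nth 0 [:: n, m & x ++ y ++ z] (2 + (size x + k)) = nth 0 (x ++ y ++ z) (size x + k) by [].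
rewrite nth_cat ltnNge leq_addr addKn; change (nth 0 (y ++ z) k = nth 0 y k).
by rewrite nth_cat size_encode_edge ltnS ki.
Qed.

Lemma exec_unpack s : arr s 1 1 = m -> arr s 9 0 = 2 ->
  (forall a, 0 < a < 2 + d.+1 * m -> arr s 1 a = nth 0 (encode es) a) ->
  (forall k j, k < d -> arr s (SL k) j = 0) -> let q := exec (unpack_loop d) s in
  slots q.1 /\ q.2 <= loop_cost Size (unpack_body d) * m.+1.
Proof.
move=> e1 e9 kin z q; have em : eval s Size = m by rewrite /= e1.
have lf : loopfree (unpack_body d) by nw.
have [||t [h1 h2 h3] hq] := @for_rule W D 6 Size (unpack_body d) s (fun i s' t =>
  [/\ forall j k, k < d -> arr s' (SL k) j = if j < i then nth 0 (codes j) k else 0, arr s' 9 0 = offset i &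
     t <= i * (bound W (unpack_body d) + 8)]).
- by split=> // [j k kd|]; [rewrite z | rewrite e9 /offset take0].
- move=> i s' t; rewrite em => im sm [h1 h2 h3]; set s1 := set_arr s' 6 0 i.
  have ob := offset_bound im; have oS := offsetS im.
  have fr l : arr s1 1 l = arr s 1 l by apply: sm; nw.
  have rd k : k <= #|edge i| -> arr s1 1 (offset i + k) = nth 0 (encode_edge (edge i)) k.
    by move=> hk; rewrite fr kin ?nth_encode //; rewrite oS in ob; have : 0 < offset i by []; move: ob hk; clear; lia.
  set s2 := (exec (Let 21 (Arr 1 (Var 9))) s1).1.
  have e9' : arr s2 9 0 = offset i by [].
  have e21 : arr s2 21 0 = #|edge i|.
    by rewrite /s2 /Let exec_set arr_set /= h2 -[arr s' 1 _]/(arr s1 1 _) -(addn0 (offset i)) rd.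
  have e6 : arr s2 6 0 = i by [].
  have f1 l : arr s2 1 l = arr s1 1 l by [].
  have cst : t + (exec (unpack_body d) s1).2 + 8 <= i.+1 * (bound W (unpack_body d) + 8).
    by have := exec_bound W D s1 lf; rewrite mulSn; lia.
  move: cst; have -> : (exec (unpack_body d) s1).1 = (exec (Let 9 (Add (Var 9) (Add (Var 21) (Cst 1)))) (exec (Unroll d (unpack_slot)) s2).1).1 by [].
  set s3 := (exec (Unroll d unpack_slot) s2).1; move=> cst.
  have sc : size (codes i) = #|edge i| by rewrite size_map -cardE.
  have h4 j k : k < d -> arr s3 (SL k) j = if j == i then nth 0 (codes i) k else arr s2 (SL k) j.
    have := @unroll_rule W D d unpack_slot s2 (fun a s' _ => forall j k, k < d ->
      arr s' (SL k) j = if (j == i) && (k < a) then nth 0 (codes i) k else arr s2 (SL k) j).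
    move=> H kd; have := H _ _ j k kd; rewrite kd andbT; apply=> //; first by move=> ? ?; rewrite andbF.
    move=> a s4 _ ad sm4 IH j0 k0 kd0.
    have v21 : eval s4 (Sub (Var 21) (Cst a)) = #|edge i| - a by rewrite -e21 /= sm4 //; nw.
    have v9 : eval s4 (Add (Var 9) (Cst a.+1)) = offset i + a.+1 by rewrite -e9' /= sm4 //; nw.
    have v6 : eval s4 (Var 6) = i by rewrite -e6 /= sm4 //; nw.
    rewrite /unpack_slot exec_when v21 subn_eq0 -ltnNge.
    have step x y : (if (j0 == i) && (k0 == a) then x else if (j0 == i) && (k0 < a) then nth 0 (codes i) k0 else y) =
       if (j0 == i) && (k0 < a.+1) then (if k0 == a then x else nth 0 (codes i) k0) else y.
      by rewrite ltnS [k0 <= a]leq_eqVlt; case: (j0 == i); case: (k0 == a).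
    case: ltnP => hc; last first.
      rewrite IH // ltnS [k0 <= a]leq_eqVlt; case: (eqVneq k0 a) => [->|] //=.
      by rewrite ltnn andbF andbT; case: eqP => // ->; rewrite nth_default ?sc // /s2 /= h1 // ltnn.
    have vr : eval s4 (Add (Arr 1 (Add (Var 9) (Cst a.+1))) (Cst 2)) = nth 0 (codes i) a.
      have -> : eval s4 (Add (Arr 1 (Add (Var 9) (Cst a.+1))) (Cst 2)) = arr s4 1 (eval s4 (Add (Var 9) (Cst a.+1))) + 2 by [].
      rewrite v9 sm4; last by nw. rewrite f1 rd // /encode_edge /= /(codes i).
      (* [nth_map] asks for a default vertex; the vertex number [a] of the edge, which exists by
         [hc], is taken. *)
      by rewrite !(nth_map (widen_ord (leqnn n) (Ordinal (ltn_ord (enum_val (cast_ord (esym (erefl _)) (Ordinal hc))))))) -?cardE.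
    rewrite exec_set v6 vr arr_set [SL k0 == SL a](_ : _ = (k0 == a)); last by rewrite /SL; lia.
    rewrite IH // [(k0 == a) && _]andbC step; case: ifP => // _; by case: eqP => // ->.
  split=> //.
    move=> j k kd; rewrite /Let exec_set arr_set /= h4 // ltnS leq_eqVlt; case: eqP => [->|_] //=.
    exact: h1.
  have sm3 : same (Unroll d unpack_slot) s2 s3 := exec_same W D s2.
  rewrite /Let exec_set arr_set !eqxx oS [eval s3 _]/= addn1 (sm3 9) ?e9' ?(sm3 21) ?e21 //; nw.
rewrite em in h1 h2 h3; split; first by move=> j k jm kd; rewrite h1 // jm.
by rewrite /q hq; apply: leq_trans (loop_cost_le W Size (unpack_body d) (leqnn m)); rewrite leq_add2r.
Qed.

(** The vertices of an edge are listed without repetition, so each is counted at most once. *)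
Lemma count_slot j (u : 'I_n) : j < m -> count (fun k => nth 0 (codes j) k == val u + 2) (iota 0 d) = (u \in edge j).
Proof.
move=> jm; have sd := size_codes rk jm.
rewrite -(subnKC sd) iotaD count_cat add0n (_ : count _ (iota (size _) _) = 0) ?addn0; last first.
  apply/eqP; rewrite -leqn0 leqNgt -has_count; apply/hasPn => k; rewrite mem_iota => /andP[h _].
  by rewrite nth_default // addn2.
rewrite -(count_map (nth 0 (codes j)) (pred1 (val u + 2))) -/(mkseq _ _) mkseq_nth count_uniq_mem ?mem_codes //.
by rewrite map_inj_uniq ?enum_uniq // => x y /addIn/val_inj.
Qed.

Hypothesis ues : uniq es.

Lemma exec_degree s : slots s -> arr s 1 1 = m -> (forall l, arr s 5 l = 0) -> let q := exec (degree_loop d) s in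
  (forall u : 'I_n, arr q.1 5 (val u + 2) = degree (kept s m) u) /\ q.2 <= loop_cost Size (degree_body d) * m.+1.
Proof.
move=> sl e1 z q; have em : eval s Size = m by rewrite /= e1.
have lf : loopfree (degree_body d) by nw.
have [||t [h1 h2] hq] := @for_rule W D 7 Size (degree_body d) s (fun i s' t =>
  (forall u : 'I_n, arr s' 5 (val u + 2) = degree (kept s i) u) /\ t <= i * (bound W (degree_body d) + 8)).
- split=> // u; rewrite z; apply/esym/eqP; rewrite cards_eq0; apply/eqP/setP => f; by rewrite !inE andbF.
- move=> i s' t; rewrite em => im sm [h1 h2]; set s1 := set_arr s' 7 0 i.
  split; last by have := exec_bound W D s1 lf; rewrite mulSn; lia.
  have fr k l : nowrite k (degree_loop d) -> arr s1 k l = arr s k l.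
    by move=> h; rewrite arr_set -(sm k l h); case: eqP => // ek; move: h; rewrite ek.
  have sl1 : slots s1 by apply: (slots_same (c := degree_loop d) sl) => [k l h|k]; [exact: fr | nw].
  have v0 : eval s1 (Arr 0 (Var 7)) = arr s 0 i by rewrite -(fr 0) //; nw.
  have f5 u : arr s1 5 (val u + 2) = degree (kept s i) u := h1 u.
  move=> u; rewrite /degree_body exec_when test_not v0.
  have kS : kept s i.+1 = if arr s 0 i == 0 then edge i |: kept s i else kept s i.
    apply: (@setP_edges _ es) => [||j jm]; rewrite ?kept_sub //.
      by case: ifP; rewrite ?subUset ?kept_sub // sub1set inE mem_nth.
    rewrite mem_kept // ltnS leq_eqVlt; case: (eqVneq j i) => [->|ne] /=.
      by case: eqP => h; rewrite ?setU11 // mem_kept // ltnn.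
    case: ifP => _; rewrite ?in_setU1 ?nth_uniq ?(negbTE ne) ?mem_kept //.
  rewrite kS; case: (arr s 0 i == 0); last exact: f5.
  have := @unroll_rule W D d (fun k => SetA 5 (Slot k (Var 7)) (Add (Arr 5 (Slot k (Var 7))) (Cst 1))) s1
    (fun k s'' _ => forall l, arr s'' 5 l = arr s1 5 l + count (fun k => nth 0 (codes i) k == l) (iota 0 k)).
  move=> ->; first 1 last.
  - by move=> l; rewrite addn0.
  - move=> k s2 _ kd sm2 IH l.
    have vk : eval s2 (Slot k (Var 7)) = nth 0 (codes i) k by rewrite /= !sm2 ?sl1 //; nw.
    have v5 : eval s2 (Add (Arr 5 (Slot k (Var 7))) (Cst 1)) = arr s2 5 (nth 0 (codes i) k) + 1 by rewrite -vk.
    have cS f : count f (iota 0 k.+1) = count f (iota 0 k) + f k by rewrite -[k.+1]addn1 iotaD count_cat /= addn0.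
    rewrite exec_set vk v5 arr_set eqxx andTb cS addnA [l == _]eq_sym -IH.
    by case: eqP => [->|ne]; rewrite ?addn0.
  rewrite count_slot // f5 /degree.
  rewrite (_ : [set e in edge i |: kept s i | u \in e] = if u \in edge i then edge i |: [set e in kept s i | u \in e] else [set e in kept s i | u \in e]).
    case: ifP => ui; rewrite ?addn0 // cardsU1 [_ \in finset _]in_set mem_kept // ltnn /= addnC //.
  apply/setP => f; case: ifP => ui; rewrite !(in_set, in_setU1); case: (eqVneq f (edge i)) => [->|] //=.
  by rewrite ui andbF.
rewrite em in h1 h2; split=> //.
by rewrite /q hq; apply: leq_trans (loop_cost_le W Size (degree_body d) (leqnn m)); rewrite leq_add2r.
Qed.

Hypothesis d2 : 2 <= d.

(** The charges of [phase2_step] telescope to [cost2 * m.+1] times the number of labelled edges,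
    which is at most [m]. *)
Lemma exec_phase2_loop s : inv2 d es 0 s -> let q := exec (phase2_loop d) s in inv2 d es m q.1 /\
  q.2 <= (cost2 d W + (skip_cost W + 8) + (esize W Size + 2)) * (m.+1 * m.+1).
Proof.
move=> I0 q; have e1 : arr s 1 1 = m by case: I0.
have em : eval s Size = m by rewrite /= e1.
have [||t [h1 h2] hq] := @for_rule W D 6 Size (phase2_body d) s (fun i s' t =>
  inv2 d es i s' /\ t <= cost2 d W * m.+1 * #|labelled es s'| + i * (skip_cost W + 8)).
- by split.
- move=> i s' t; rewrite em => im sm [h1 h2].
  have [g1 g2] := @phase2_step d W D n es d2 ues rk (set_arr s' 6 0 i) i h1 im erefl.
  split=> //; move: g2 h2; rewrite -[labelled es (set_arr s' 6 0 i)]/(labelled es s') mulSn.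
  by move: (exec _ _).2 (cost2 d W * _ * _) (cost2 d W * _ * _) => x y z; clear; lia.
rewrite em in h1 h2; split=> //; rewrite /q hq; apply: leq_trans (leq_add h2 (leqnn _)) _.
have lm : #|labelled es (exec (phase2_loop d) s).1| <= m.+1.
  apply: leq_trans (leqnSn m); apply: leq_trans (card_size es); apply: subset_leq_card; apply/subsetP => f.
  by rewrite inE => /andP[].
rewrite mulnDl; apply: leq_add; last by rewrite leq_pmulr.
rewrite mulnDl; apply: leq_add; first by rewrite -mulnA !leq_mul2l lm !orbT.
by rewrite mulnC leq_mul2l (leq_trans (leqnSn m)) ?orbT // leq_pmulr.
Qed.

Variable b : nat.
Hypothesis hb : (1 + d * 2 ^ (2 * d)) ^ d <= b.

Lemma exec_phase1_loop s : slots s -> arr s 1 1 = m -> (forall k l, k \in [:: 0; 2; 3] -> arr s k l = 0) ->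
  let q := exec (phase1_loop d b) s in inv1 d es m q.1 /\
  q.2 <= (cost1 d b W + 8 + (esize W Size + 2)) * (m.+1 * m.+1).
Proof.
move=> sl e1 z q; have em : eval s Size = m by rewrite /= e1.
have [||t [h1 h2] hq] := @for_rule W D 6 Size (phase1_body d b) s (fun i s' t =>
  inv1 d es i s' /\ t <= i * (cost1 d b W * m.+1 + 8)).
- split=> //; split=> //.
  + by move=> j _; apply: z.
  + by move=> l; rewrite !z.
  + move=> S hS _; exists (fun x : 'I_n => val x); split; first exact: val_inj.
    move=> e /(subsetP hS); by rewrite inE andbF.
  + move=> D' _; have -> : deleted s = set0 by apply/setP => f; rewrite !inE z ?andbF.
    by rewrite cards0.
- move=> i s' t; rewrite em => im sm [h1 h2].
  have [g1 g2] := @phase1_step d b W D n es d2 ues rk hb (set_arr s' 6 0 i) i h1 im erefl.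
  by split=> //; move: g2 h2; rewrite mulSn; move: (exec _ _).2 => x; clear; lia.
rewrite em in h1 h2; split=> //; rewrite /q hq; apply: leq_trans (leq_add h2 (leqnn _)) _.
rewrite mulnDl; apply: leq_add; last by rewrite leq_pmulr.
rewrite mulnDl mulnDr; apply: leq_add; last by rewrite mulnC leq_mul2l (leq_trans (leqnSn m)) // leq_pmulr.
by rewrite mulnCA leq_mul2l leq_mul2r leqnSn !orbT.
Qed.

End Loops.

Section WellFormed.
Variable d b : nat.
Notation W := (32 + d.*2).

Lemma cwf_unroll V k f : (forall i, i < k -> cwf V (f i)) -> cwf V (Unroll k f).
Proof.
move=> h; have : all (fun i => cwf V (f i)) (iota 0 k) by apply/allP => i; rewrite mem_iota => /h.
by rewrite /Unroll; elim: (iota 0 k) => //= i l IH /andP[-> /IH].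
Qed.

Lemma ewf_any V k f : (forall i, i < k -> ewf V (f i)) -> ewf V (Any k f).
Proof.
move=> h; have : all (fun i => ewf V (f i)) (iota 0 k) by apply/allP => i; rewrite mem_iota => /h.
by rewrite /Any; elim: (iota 0 k) => //= i l IH /andP[-> /IH].
Qed.

Lemma cwf_tree V qs acc leaf : all (fun q => ewf V q.1 && ewf V q.2) qs -> (forall l, cwf V (leaf l)) -> cwf V (tree qs acc leaf).
Proof.
move=> h hl; elim: qs acc h => //= q qs IH acc /andP[/andP[h1 h2] h3].
by rewrite h1 h2 !IH.
Qed.

Ltac wf := cbn -[tree Unroll Any addn double leq SL BS decide];
  repeat first [ apply: cwf_unroll => ? ?; cbn -[tree Unroll Any addn double leq SL BS decide]
    | apply: ewf_any => ? ?; cbn -[tree Unroll Any addn double leq SL BS decide]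
    | match goal with |- is_true (_ && _) => apply/andP; split end | done
    | progress (unfold unpack_slot, tag_body, mark_body, gather_body, degree_body, phase2_body, process, label_body, detect_body,
        try_pair, check_body, check_slot, flood_body, sweep_round, min_body, min_slot, star_body, When, Eq, Not);
      cbn -[tree Unroll Any addn double leq SL BS decide]
    | rewrite /SL /BS; lia ].

Lemma cwf_main Z : 0 < d -> cwf W (main d b Z).
Proof.
move=> d0; have wdec : cwf W (decide d b).
  apply: cwf_tree; last by move=> l; elim: choose_obstruction => //= p T ->; wf.
  have h z : z \in None :: map Some (cells d b) -> ewf W (if z is Some c then Arr (BS c.2) (Cst c.1) else Cst 0).
    rewrite inE => /predU1P[->//|/mapP[c /allpairsP[[p k] /= [_ hk ->]] ->]] /=.
    by move: hk; rewrite mem_iota /BS /= andbT; lia.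
  rewrite all_map; apply/allP => xy; move: (None :: _) h => l h /allpairsP[[x y] [hx hy ->]].
  by apply/andP; split; apply: h.
by rewrite /main /phase1_loop /phase1_body; wf.
Qed.

End WellFormed.

(** * The whole program *)

Section Correctness.
Variables (d b W D n : nat) (es : seq {set 'I_n}).
Hypotheses (d2 : 2 <= d) (ues : uniq es) (rk : forall e, e \in es -> #|e| <= d)
  (hb : (1 + d * 2 ^ (2 * d)) ^ d <= b).
Notation exec := (exec W D).
Notation m := (size es).
Notation slots := (slots d es).

(** At the end every kept edge is empty or labelled, and the kept labelled edges are interval. *)
Lemma inv2_final s : inv2 d es m s -> interval (edges es :\: deleted es s) /\
  forall D', interval (edges es :\: D') -> #|deleted es s| <= d.+1 * #|D'|.
Proof.
move=> [_ _ _ _ [_ _ int bd [dn _]]]; split; last first.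
  by move=> D' iD; apply: leq_trans (bd D' iD) _; rewrite leq_mul2l subset_leq_card ?subsetIl ?orbT.
apply: interval_set0U; apply: interval_sub int; apply/subsetP => f.
rewrite !in_setD in_set1 => /and3P[f0 fd]; rewrite inE => fe; have [j jm fj] := edgeP fe.
rewrite fj mem_deleted // negbK in fd; rewrite fj in f0 *.
have jF : nth set0 es j \in kept es s m by rewrite mem_kept // jm.
rewrite in_setI jF; by case: (dn j jm jF) => [e|//]; rewrite e eqxx in f0.
Qed.

Lemma inv2_initial s : inv1 d es m s -> arr s 1 1 = m -> arr s 2 0 = 0 -> (forall l, arr s 2 l <= arr s 10 0) ->
  (forall l, arr s 4 l = 0) -> (forall u : 'I_n, arr s 5 (val u + 2) = degree (kept es s m) u) -> inv2 d es 0 s.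
Proof.
move=> [sl _ _ loc bd] e1 z2 le z4 dg.
have L0 : labelled es s = set0 by apply/setP => f; rewrite !inE z4 andbF.
split=> //; first by move=> l; rewrite z4.
rewrite L0 setI0 setU0; split=> //.
- by move=> e f _; rewrite inE.
- by exists (fun x : 'I_n => val x); split; [exact: val_inj | move=> e; rewrite inE].
Qed.

Definition main_cost Z := d.+2 * loop_cost W (Add (Cst 2) (Any d.+1 (fun _ => Size))) (copy_body Z) +
  (bound W (Let 9 (Cst 2)) + (loop_cost W Size (unpack_body d) + ((cost1 d b W + 8 + (esize W Size + 2)) +
  (loop_cost W Size (degree_body d) + (bound W reset + ((cost2 d W + (skip_cost W + 8) + (esize W Size + 2)) +
  loop_cost W (Sub Size (Cst Z)) (output_body Z))))))).

Lemma exec_main Z (I : nat -> nat) s : 1 < Z -> (d.+1 * m).+1 <= D -> I =1 nth 0 (encode es) ->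
  (forall k l, arr s k l = if (k == 1) && (0 < l < Z) then I l else 0) -> (forall e, e <= D -> raw s e = I (Z + e)) ->
  let q := exec (main d b Z) s in
  [/\ interval (edges es :\: deleted es q.1),
     forall D', interval (edges es :\: D') -> #|deleted es q.1| <= d.+1 * #|D'|,
     forall e, e < m - Z -> raw q.1 e = arr q.1 0 (Z + e) &
     q.2 <= main_cost Z * (m.+1 * m.+1)].
Proof.
move=> Z1 hD hI ar ra q; have I1 : I 1 = m by rewrite hI.
have M0 : 0 < m.+1 * m.+1 by [].
have gM t c : t <= c * m.+1 -> t <= c * (m.+1 * m.+1).
  by move=> h; apply: leq_trans h _; rewrite leq_mul2l leq_pmulr ?orbT.
have gM1 t c : t <= c -> t <= c * (m.+1 * m.+1) by move=> h; apply: leq_trans h _; rewrite leq_pmulr.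
have := @exec_copy d W D n es Z s I Z1 hD ltac:(by rewrite ar I1 Z1) ltac:(by move=> a ha; rewrite ar ha) ra.
set s1 := (exec (copy_loop d Z) s).1 => -[k1 c1].
have f1 k l : k != 1 -> k != 7 -> arr s1 k l = 0.
  by move=> h h'; rewrite /s1 exec_same ?ar ?(negbTE h) //= h' h.
have mb : m <= d.+1 * m by rewrite leq_pmull.
set s2 := (exec (Let 9 (Cst 2)) s1).1.
have k2 l : arr s2 1 l = arr s1 1 l by [].
have e12 : arr s2 1 1 = m by rewrite k2 k1 // addnC.
have := @exec_unpack d W D n es rk s2 e12 erefl.
case=> [a ha|k j kd|]; [by rewrite k2 k1 ?hI //; lia | by rewrite /s2 /Let exec_set arr_set f1 // /SL; lia |].
set s3 := (exec (unpack_loop d) s2).1 => sl3 c3.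
have f3 k l : nowrite k (unpack_loop d) -> k != 1 -> k != 7 -> k != 9 -> arr s3 k l = 0.
  move=> h1 h2 h3 h4; rewrite /s3 exec_same // /s2 /Let exec_set arr_set (negbTE h4); exact: f1.
have e13 : arr s3 1 1 = m by rewrite /s3 exec_same //; nw.
have [] := @exec_phase1_loop d W D n es rk ues d2 b hb s3 sl3 e13.
  by move=> k l; rewrite !inE => /or3P[] /eqP->; apply: f3 => //; nw.
set s4 := (exec (phase1_loop d b) s3).1 => i4 c4.
have sl4 : slots s4 by case: i4.
have nwl k : k != 0 -> nowrite k (decide d b).
  by move=> h; apply: nowrite_tree => l; elim: choose_obstruction => //= p T ->; rewrite h.
have e14 : arr s4 1 1 = m.
  by rewrite /s4 exec_same // /phase1_loop /phase1_body; cbn -[Unroll decide]; rewrite nwl //; nw.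
have f4 k l : (k == 4) || (k == 5) -> arr s4 k l = 0.
  move=> hk; rewrite /s4 exec_same ?f3 //; case/orP: hk => /eqP->; try by nw.
    by rewrite /phase1_loop /phase1_body; cbn -[Unroll decide]; rewrite nwl //; nw.
  by rewrite /phase1_loop /phase1_body; cbn -[Unroll decide]; rewrite nwl //; nw.
have := @exec_degree d W D n es rk ues s4 sl4 e14 (fun l => f4 5 l isT).
set s5 := (exec (degree_loop d) s4).1 => -[dg5 c5].
have sm5 : same (degree_loop d) s4 s5 := exec_same W D s4.
set s6 := (exec reset s5).1.
have f6 k l : k != 2 -> k != 10 -> arr s6 k l = arr s5 k l by move=> h h'; rewrite /= (negbTE h) (negbTE h').
have e15 : arr s5 1 1 = m by rewrite sm5 //; nw.
have e16 : arr s6 1 1 = m by rewrite f6.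
have f64 k l : nowrite k (degree_loop d) -> k != 2 -> k != 10 -> arr s6 k l = arr s4 k l.
  by move=> h1 h2 h3; rewrite f6 // sm5.
have v2 l : arr s6 2 l = if l == 0 then 0 else arr s4 2 l.
  by rewrite /s6 /reset exec_seq /Let !exec_set !arr_set /= sm5 //; nw.
have v10 : arr s6 10 0 = m by rewrite /= e15.
have o6 l : arr s6 0 l = arr s4 0 l by apply: f64; nw.
have i6 : inv2 d es 0 s6.
  apply: inv2_initial => //.
  - case: i4 => g1 g2 g3 g4 g5; have kE : kept es s6 m = kept es s4 m by apply: kept_eq.
    have dE : deleted es s6 = deleted es s4 by apply/setP => f; rewrite !inE o6.
    split.
    + by move=> j k jm kd; rewrite f64 ?sl4 //; nw.
    + by move=> j mj; rewrite o6 g2.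
    + move=> l; rewrite v2 f64; [|nw|by []|by []]; have [g31 g32] := g3 l; split=> //; by case: ifP.
    + by rewrite kE.
    + by rewrite dE.
  - by move=> l; rewrite v2 v10; case: ifP => // _; case: i4 => _ _ /(_ l)[].
  - by move=> l; rewrite f64 ?f4 //; nw.
  - by move=> u; rewrite f6 // dg5; congr (degree _ _); apply/esym/kept_eq.
have := @exec_phase2_loop d W D n es rk ues d2 s6 i6.
set s7 := (exec (phase2_loop d) s6).1 => -[i7 c7].
have e17 : arr s7 1 1 = m by case: i7.
have [] := @exec_output W D n es Z s7 e17 ltac:(by apply: leq_trans mb (ltnW hD)).
set s8 := (exec (output_loop Z) s7).1 => o8 r8 c8.
have -> : q.1 = s8 by [].
have dE : deleted es s8 = deleted es s7 by apply/setP => f; rewrite !inE o8.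
have [g1 g2] := inv2_final i7.
rewrite dE; split=> //; first by move=> e he; rewrite r8 // o8.
have -> : q.2 = (exec (copy_loop d Z) s).2 + ((exec (Let 9 (Cst 2)) s1).2 + ((exec (unpack_loop d) s2).2 +
  ((exec (phase1_loop d b) s3).2 + ((exec (degree_loop d) s4).2 + ((exec reset s5).2 +
  ((exec (phase2_loop d) s6).2 + (exec (output_loop Z) s7).2)))))) by [].
have c2 := gM1 _ _ (exec_bound W D s1 (c := Let 9 (Cst 2)) isT).
have c6 := gM1 _ _ (exec_bound W D s5 (c := reset) isT).
rewrite /main_cost; exact: (leq_add_mul (gM _ _ c1) (leq_add_mul c2 (leq_add_mul (gM _ _ c3) (leq_add_mul c4
  (leq_add_mul (gM _ _ c5) (leq_add_mul c6 (leq_add_mul c7 (gM _ _ c8)))))))).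
Qed.

End Correctness.

Theorem theorem6 (d : nat) (hd : 2 <= d) :
  exists (P : program) (C : nat),
    forall (n : nat) (es : seq {set 'I_n}),
      uniq es ->
      (forall e, e \in es -> #|e| <= d) ->
      let E := [set e | e \in es] in
      exists M : memory,
        run P (C * ((size es) ^ 2 + 1)) 0 (init_mem (encode es)) = Some M /\
        let Ep := output_set es M in
        Ep \subset E /\
        interval_hypergraph (E :\: Ep) /\
        (forall Estar : {set {set 'I_n}},
            Estar \subset E -> interval_hypergraph (E :\: Estar) ->
            #|Ep| <= d.+1 * #|Estar|).
Proof.
(* [b] bounds a ball of radius [d], and [W] exceeds every array number. [Z] can be defined from
   [main d b 0] because the registers needed do not depend on the constant [Z] in the program. The
   encoding has at most [2 + d.+1 * m] cells, whence [q]. *)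
pose b := (1 + d * 2 ^ (2 * d)) ^ d; pose W := 32 + d.*2; pose Z := 3 + cneed (main d b 0); pose q := d.+1.
pose fixed := size (prologue W Z q) + size (epilogue W Z) + 1.
exists (compile W Z q (main d b Z)), (fixed + 2 * main_cost d b W Z).
move=> n es ues rk E.
have W1 : 1 < W by [].
have Z3 : 3 <= Z by rewrite leq_addr.
have I0 a : Z + q * size es + 3 <= a -> init_mem (encode es) a = 0.
  move=> ha; rewrite /init_mem nth_default //; apply: leq_trans ha; rewrite /encode /=.
  have := size_encodes rk; rewrite -/q; move: (size (flatten _)) (q * _) Z3 => x y; clear; lia.
have d0 : 0 < d by apply: leq_trans hd.
have [M [hrun [lo hi]]] := compile_correct W1 Z3 (cwf_main b Z d0) (leqnn Z) (erefl : init_mem (encode es) 1 = size es) I0.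
have [] := @exec_main d b W (q * size es + 2) n es hd ues rk (leqnn _) Z (init_mem (encode es)) (initial Z (init_mem (encode es))).
- exact: leq_trans Z3.
- by rewrite /q addn2.
- by [].
- by [].
- by [].
set p := exec _ _ _ _ in hrun lo hi *; clearbody p => int apx rw cost.
exists M; split.
  apply: hrun; move: cost; rewrite -/fixed mulnDl -mulnA => cost.
  (* Accounts for the factor 2 in the constant. *)
  have m2 : (size es).+1 * (size es).+1 <= 2 * (size es ^ 2 + 1) by rewrite -mulnn; nia.
  apply: leq_trans (_ : fixed + main_cost d b W Z * (2 * (size es ^ 2 + 1)) <= _).
    have := leq_trans cost (leq_mul (leqnn _) m2); move: (main_cost _ _ _ _ * _) => x.
    by rewrite /fixed; move: (size _) (size _) p.2; clear; lia.
  by rewrite mulnCA leq_add2r leq_pmulr // addn1.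
have oE : output_set es M = deleted es p.1.
  apply/setP => f; rewrite !inE; case: (boolP (f \in es)) => //= fe.
  have jm : index f es < size es by rewrite index_mem.
  (* Cells below [Z] are filled from array 0 by the epilogue, the others through the raw block by
     [output_loop]. *)
  have [h|h] := ltnP (index f es) Z; first by rewrite lo.
  rewrite -(subnKC h) hi ?rw //; last by rewrite /q; lia.
  by rewrite ltn_sub2r // (leq_ltn_trans h).
rewrite oE /=; split; first exact: deleted_sub.
split; first by apply/interval_hypergraphP.
by move=> Es _ /interval_hypergraphP; apply: apx.
Qed.
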